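(* There exists a function $K_0:\mathbb{Z}_{\geq 1}\to\mathbb{Z}_{\geq 1}$ with $K_0(l)=O(l^4)$ such that the following holds. Let $B$ (blue points) and $R$ (red points) be disjoint finite sets in the plane such that $B\cup R$ is in general position (no three points collinear), $|R|=l\geq 1$, and the vertices of the convex hull of $B\cup R$ are $n$ blue points. Let $k=|B|-n$ be the number of blue points in the interior of $\mathrm{Conv}(B)$. If $k\geq K_0(l)$, then there exists a simple polygon whose vertex set is exactly $B$ and which excludes $R$ (every red point lies in the exterior of the polygon).
   Context: $\mathrm{Conv}(X)$ denotes the convex hull of $X$. A polygonization of a finite point set $S$ is a simple (closed, non-self-intersecting) polygon whose vertex set is exactly $S$. A polygon excludes a point set $V$ if all points of $V$ lie in the exterior of the polygon. *)

(* Defs.v *)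
From HB Require Import structures.
From mathcomp Require Import all_boot all_order all_algebra finmap.
From mathcomp Require Import all_classical all_reals all_analysis.

Set Implicit Arguments.
Unset Strict Implicit.
Unset Printing Implicit Defensive.

Import Order.TTheory GRing.Theory Num.Theory.
Import numFieldNormedType.Exports.

Local Open Scope classical_set_scope.
Local Open Scope ring_scope.

Section Plane.
Context {R : realType}.
Implicit Types (a b c x y z : R * R) (S V : {fset R * R}) (C X : set (R * R))
  (p : seq (R * R)).

Definition conv_hull X : set (R * R) := smallest (@convex_set R (R * R)%type) X.

Definition segment a b : set (R * R) :=
  [set (1 - t) *: a + t *: b | t in `[0, 1]%classic].

(* The vertices of a convex polygon C are its extreme points. *)
Definition extreme_points C : set (R * R) :=
  [set x | C x /\ forall y z, C y -> C z ->
     forall t : R, 0 < t < 1 -> x = (1 - t) *: y + t *: z -> y = z].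

Definition line a v : set (R * R) := [set a + t *: v | t in [set: R]].

Definition collinear a b c :=
  exists q v, [/\ v != 0, line q v a, line q v b & line q v c].

Definition general_position S :=
  forall a b c, a \in S -> b \in S -> c \in S ->
    a != b -> a != c -> b != c -> ~ collinear a b c.

(* A closed polygon is given by the cyclic sequence of its vertices. *)
Definition vertex p i : R * R := nth 0 p (i %% size p).

Definition edge p i : set (R * R) := segment (vertex p i) (vertex p i.+1).

Definition boundary p : set (R * R) := \bigcup_(i < size p) edge p i.

Definition edge_ends p i : set (R * R) := [set vertex p i; vertex p i.+1].

(* As the vertices are distinct, the last clause says that consecutive edges
   meet only in their common vertex and that other edges are disjoint. *)
Definition simple_polygon p :=
  [/\ (3 <= size p)%N, uniq p &
    forall i j, (i < size p)%N -> (j < size p)%N -> i != j ->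
      edge p i `&` edge p j `<=` edge_ends p i `&` edge_ends p j].

(* The unbounded component of the complement of the boundary; the component
   of a point of the boundary is empty, hence bounded. *)
Definition exterior p : set (R * R) :=
  [set x | ~ bounded_set (connected_component (~` boundary p) x)].

Definition polygonization S p := simple_polygon p /\ p =i S.

Definition excludes p V := forall x, x \in V -> exterior p x.

End Plane.

(* Main.v *)
Require Import Defs.
From HB Require Import structures.
From mathcomp Require Import all_boot all_order all_algebra finmap.
From mathcomp Require Import all_classical all_reals all_analysis.
From mathcomp Require Import zify ring lra.
Import Order.TTheory GRing.Theory Num.Theory.
Import numFieldNormedType.Exports.
Local Open Scope classical_set_scope.
Local Open Scope ring_scope.

Set Implicit Arguments.
Unset Strict Implicit.
Unset Printing Implicit Defensive.

(* Let l be the number of red points. In a convex region with two boundary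
   corners p and q, suppose there are 2l blue points ("supply") such that every
   red point is to the left of the line from p, and to the right of the line
   from q, through every supply point. Then some simple path from p to q visits
   all blue points of the region, and every red point escapes off the path to
   infinity or across pq: cut the region along a line through a supply point y
   which splits supply and red points in balance, and recurse on both sides with
   y as a new corner.

   Let v be a hull vertex. By pigeonhole, many inner blue points have the red
   points on the same sides as seen from v. If T = 8l(l+1)^2 of them lie in a
   triangle spanned by v and a hull edge ab, two more pigeonholes keep 8l points
   having the same property with respect to a and b; a median direction at v
   contains a point o such that each of the sectors vob, boa, aov has 2l of these
   points, and the three sector paths form the polygon. Otherwise, fewer than T
   of them lie in the triangle at either end of the angular order, so that two
   hull vertices a and b separate 4l of them from those at the ends. Then the
   hull chain from b to a is closed up by two sector paths through v, on either
   side of a median direction.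

   At v this takes 2T + 4l + 2 points, hence (l+1)(2T + 4l + 2) inner points. *)

(** * Half-planes and orientation *)

Section Geometry.
Variable R : realType.
Notation pt := (R * R)%type.
Implicit Types (a b c d e x y z p q u v w : pt) (h : pt * pt) (hs : seq (pt * pt)).

Lemma fstD x y : (x + y).1 = x.1 + y.1. Proof. by []. Qed.
Lemma sndD x y : (x + y).2 = x.2 + y.2. Proof. by []. Qed.
Lemma fstN x : (- x).1 = - x.1. Proof. by []. Qed.
Lemma sndN x : (- x).2 = - x.2. Proof. by []. Qed.
Lemma fstZ (t : R) x : (t *: x).1 = t * x.1. Proof. by []. Qed.
Lemma sndZ (t : R) x : (t *: x).2 = t * x.2. Proof. by []. Qed.
Definition ptE := (fstD, sndD, fstN, sndN, fstZ, sndZ).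

Definition det u w : R := u.1 * w.2 - u.2 * w.1.
(* Positive iff [c] lies to the left of the line from [a] to [b]; equivalently,
   iff [c] comes after [b] in counterclockwise order around [a]. *)
Definition ot a b c : R := det (b - a) (c - a).

(* An open half-plane is coded by a point [h.1] of its boundary line and a
   direction [h.2] of this line, the half-plane being to the left. *)
Definition hp h x : R := det h.2 (x - h.1).
Definition inG hs x := forall h, h \in hs -> 0 < hp h x.
Definition clG hs x := forall h, h \in hs -> 0 <= hp h x.

Lemma hp_conv h (t : R) a b :
  hp h ((1 - t) *: a + t *: b) = (1 - t) * hp h a + t * hp h b.
Proof. rewrite /hp /det !ptE; ring. Qed.

Lemma hp_ray h x (t : R) d : hp h (x + t *: d) = hp h x + t * det h.2 d.
Proof. rewrite /hp /det !ptE; ring. Qed.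

Lemma exit_ray hs x d : inG hs x ->
  (forall t : R, 0 <= t -> inG hs (x + t *: d)) \/
  exists t : R, [/\ 0 < t, clG hs (x + t *: d), ~ inG hs (x + t *: d) &
    forall t' : R, 0 <= t' < t -> inG hs (x + t' *: d)].
Proof.
elim: hs => [|h hs IH] Gx; first by left => t _ h; rewrite in_nil.
have hx : 0 < hp h x by apply: Gx; rewrite inE eqxx.
have Gx' : inG hs x by move=> h' h'in; apply: Gx; rewrite inE h'in orbT.
have cl0 s z : inG s z -> clG s z by move=> G h' /G /ltW.
have GC z : 0 < hp h z -> inG hs z -> inG (h :: hs) z.
  by move=> ? G h'; rewrite inE => /orP[/eqP->//|/G].
have CC z : 0 <= hp h z -> clG hs z -> clG (h :: hs) z.
  by move=> ? G h'; rewrite inE => /orP[/eqP->//|/G].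
have [b0|b0] := leP 0 (det h.2 d).
  have P t : 0 <= t -> 0 < hp h (x + t *: d) by move=> t0; rewrite hp_ray; nra.
  case: (IH Gx') => [A|[t [t0 A B C]]]; [left=> t t0; apply: GC; auto|right].
  exists t; split=> //; first by apply: CC => //; apply/ltW/P/ltW.
  - by move=> G; apply: B => h' h'in; apply: G; rewrite inE h'in orbT.
  - by move=> t' /andP[t'0 t't]; apply: GC; [exact: P|apply: C; rewrite t'0].
pose th := hp h x / - det h.2 d.
have th0 : 0 < th by rewrite divr_gt0 // oppr_gt0.
have hpt t : hp h (x + t *: d) = (th - t) * - det h.2 d.
  by rewrite hp_ray /th; field; rewrite ltr0_neq0.
have nb0 : 0 < - det h.2 d by rewrite oppr_gt0.
right.
have here : (forall t : R, 0 <= t <= th -> inG hs (x + t *: d)) \/ clG hs (x + th *: d) /\ (forall t : R, 0 <= t < th -> inG hs (x + t *: d)) ->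
   exists t : R, [/\ 0 < t, clG (h :: hs) (x + t *: d), ~ inG (h :: hs) (x + t *: d) &
    forall t' : R, 0 <= t' < t -> inG (h :: hs) (x + t' *: d)].
  move=> H; exists th; split=> //.
  - apply: CC; first by rewrite hpt subrr mul0r.
    by case: H => [H|[]//]; apply: cl0; apply: H; rewrite (ltW th0) lexx.
  - by move=> /(_ h); rewrite inE eqxx => /(_ isT); rewrite hpt subrr mul0r ltxx.
  - move=> t /andP[t0 tth]; apply: GC; first by rewrite hpt mulr_gt0 // subr_gt0.
    case: H => [H|[_ H]]; apply: H; rewrite t0 //=; exact: ltW.
case: (IH Gx') => [A|[t [t0 A B C]]]; first by apply: here; left=> t /andP[? _]; apply: A.
have [tth|tth] := ltP t th.
  exists t; split=> //.
  - by apply: CC => //; rewrite hpt mulr_ge0 ?subr_ge0 // ltW.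
  - by move=> G; apply: B => h' h'in; apply: G; rewrite inE h'in orbT.
  - move=> t' /andP[t'0 t't]; apply: GC; last by apply: C; rewrite t'0.
    by rewrite hpt mulr_gt0 // subr_gt0 (lt_trans t't).
apply: here; right; split; last by move=> t' /andP[a b]; apply: C; rewrite a (lt_le_trans b).
move: tth; rewrite le_eqVlt => /orP[/eqP->//|tth].
by apply: cl0; apply: C; rewrite (ltW th0).
Qed.

Lemma small_eps (s : seq (R * R)) : exists2 e : R, 0 < e &
  forall al be : R, (al, be) \in s ->
    (0 < al -> 0 < al + e * be) /\ (al < 0 -> al + e * be < 0).
Proof.
suff [e e0 H] : exists2 e : R, 0 < e & forall e' : R, 0 < e' <= e -> forall al be : R, (al, be) \in s ->
    (0 < al -> 0 < al + e' * be) /\ (al < 0 -> al + e' * be < 0).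
  by exists e => //; apply: H; rewrite e0 lexx.
elim: s => [|[a b] s [e e0 IH]]; first by exists 1.
have [a0|a0] := eqVneq a 0.
  exists e => // e' He' al be; rewrite inE => /orP[/eqP[-> _]|]; last exact: IH.
  by rewrite a0 ltxx.
pose e1 := `|a| / (`|b| + 1).
have b1 : 0 < `|b| + 1 by rewrite ltr_wpDl.
have e10 : 0 < e1 by rewrite divr_gt0 ?normr_gt0.
exists (Num.min e e1); first by rewrite lt_min e0.
move=> e' /andP[e'0]; rewrite le_min => /andP[e'e e'e1] al be.
rewrite inE => /orP[/eqP[-> ->]|]; last by apply: IH; rewrite e'0.
have K : e' * `|b| < `|a|.
  have : e' * (`|b| + 1) <= `|a| by rewrite -ler_pdivlMr.
  by nra.
have := ler_norm (e' * b); have := ler_norm (- (e' * b)).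
rewrite normrN normrM (gtr0_norm e'0) => B1 B2.
by split=> aa; [rewrite (gtr0_norm aa) in K|rewrite (ltr0_norm aa) in K]; lra.
Qed.

Lemma perturb u n (s : seq pt) : exists2 e : R, 0 < e &
  forall w, w \in s -> (0 < det u w -> 0 < det (u + e *: n) w) /\
    (det u w < 0 -> det (u + e *: n) w < 0).
Proof.
have [e e0 H] := small_eps [seq (det u w, det n w) | w <- s].
exists e => // w ws.
have -> : det (u + e *: n) w = det u w + e * det n w by rewrite /det !ptE; ring.
by apply: H; apply/mapP; exists w.
Qed.

Section Cut.
Variables (hs : seq (pt * pt)) (p q y d : pt).
Hypothesis Gy : inG hs y.
Hypothesis clp : clG hs p.
Hypothesis clq : clG hs q.
Hypothesis pqJ : forall h, h \in hs -> 0 < hp h p + hp h q.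
Hypothesis pl : 0 < det d (p - y).
Hypothesis qr : det d (q - y) < 0.
Hypothesis ypq : ot p q y != 0.

(* Both lemmas argue by contradiction: if [z] were not beyond the line [pq],
   then [z], or the corner which lies on the boundary, would be a barycentre
   with a positive weight on an interior point. *)
Lemma ext_left z : ~ inG hs p -> clG hs z -> ~ inG hs z -> 0 <= det d (z - y) -> 0 < ot p y z ->
  0 < ot p q z.
Proof.
move=> nGp clz nGz zl pyz; rewrite ltNge; apply/negP => pqz.
move: ypq; rewrite neq_lt => /orP[yin|yout].
  apply: nGz => h hin; have Jh := pqJ hin; have hp0 := clp hin; have hq0 := clq hin; have hy := Gy hin.
  pose Dl := - ot p q y; pose b := - ot p q z; pose c := ot p y z.
  have EQ (k : pt * pt) : Dl * hp k z = (Dl - b - c) * hp k p + b * hp k y + c * hp k q.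
    by rewrite /Dl /b /c /ot /hp /det !ptE; ring.
  have Dl0 : 0 < Dl by rewrite /Dl oppr_gt0.
  have b0 : 0 <= b by rewrite /b oppr_ge0.
  have W : 0 < Dl - b - c.
    have := EQ (y, d); rewrite /hp /= subrr.
    have -> : det d 0 = 0 by rewrite /det /= !mulr0 subr0.
    move=> E; rewrite ltNge; apply/negP => W.
    have : 0 <= Dl * det d (z - y) by rewrite mulr_ge0 // ltW.
    rewrite E; have : c * det d (q - y) < 0 by rewrite pmulr_rlt0.
    have : (Dl - b - c) * det d (p - y) <= 0 by rewrite mulr_le0_ge0 // ltW.
    lra.
  have : 0 < Dl * hp h z.
    rewrite EQ; have : 0 <= b * hp h y by rewrite mulr_ge0 // ltW.
    have [hp1|hp1] := ltP 0 (hp h p).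
      have : 0 < (Dl - b - c) * hp h p by rewrite mulr_gt0.
      have : 0 <= c * hp h q by rewrite mulr_ge0 // ltW.
      lra.
    have -> : hp h p = 0 by lra.
    have : 0 < c * hp h q by rewrite mulr_gt0 //; lra.
    lra.
  by rewrite pmulr_rgt0.
apply: nGp => h hin; have Jh := pqJ hin; have hp0 := clp hin; have hq0 := clq hin; have hy := Gy hin.
have hz := clz _ hin.
have EQ : (ot p y z - ot p q z + ot p q y) * hp h p =
   ot p y z * hp h q + (- ot p q z) * hp h y + ot p q y * hp h z.
  by rewrite /ot /hp /det !ptE; ring.
have [//|hp1] := ltP 0 (hp h p).
have E0 : hp h p = 0 by lra.
have : 0 < ot p y z * hp h q by rewrite mulr_gt0 //; lra.
have : 0 <= (- ot p q z) * hp h y by rewrite mulr_ge0 ?oppr_ge0 // ltW.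
have : 0 <= ot p q y * hp h z by rewrite mulr_ge0 // ltW.
by rewrite E0 mulr0 in EQ; lra.
Qed.

End Cut.

Lemma ext_right hs p q y d z : inG hs y -> clG hs p -> clG hs q ->
  (forall h, h \in hs -> 0 < hp h p + hp h q) ->
  0 < det d (p - y) -> det d (q - y) < 0 -> ot p q y != 0 ->
  ~ inG hs q -> clG hs z -> ~ inG hs z ->
  det d (z - y) <= 0 -> 0 < ot y q z -> 0 < ot p q z.
Proof.
pose m x : pt := (- x.1, x.2).
pose mh h : pt * pt := (m h.1, - m h.2).
have mhp h x : hp (mh h) (m x) = hp h x by rewrite /hp /det /= ; ring.
have mot a b c : ot (m a) (m b) (m c) = - ot a b c by rewrite /ot /det /=; ring.
have mG s x : inG (map mh s) (m x) <-> inG s x.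
  split=> H h hin; first by rewrite -mhp; apply: H; apply: map_f.
  by move/mapP: hin => [k kin ->]; rewrite mhp; apply: H.
have mC s x : clG (map mh s) (m x) <-> clG s x.
  split=> H h hin; first by rewrite -mhp; apply: H; apply: map_f.
  by move/mapP: hin => [k kin ->]; rewrite mhp; apply: H.
move=> Gy cp cq J pl qr ypq nGq cz nGz zr yqz.
have md x : det (m d) (m x - m y) = - det d (x - y) by rewrite /det /=; ring.
have mcyc a b c : ot (m a) (m b) (m c) = ot b a c by rewrite mot /ot /det /=; ring.
rewrite -mcyc; apply: (@ext_left (map mh hs) (m q) (m p) (m y) (m d)).
- exact/mG.
- exact/mC.
- exact/mC.
- by move=> h /mapP[k kin ->]; rewrite !mhp addrC; apply: J.
- by rewrite md oppr_gt0.
- by rewrite md oppr_lt0.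
- by rewrite mcyc.
- by move/mG.
- exact/mC.
- by move/mG.
- by rewrite md oppr_ge0.
- by rewrite mcyc.
Qed.

End Geometry.

(** * Polygonal paths and escapes *)

Section Traces.
Variable R : realType.
Notation pt := (R * R)%type.
Implicit Types (a b c d e x y z p q u v w : pt) (h : pt * pt) (hs : seq (pt * pt)) (s : seq pt).

Lemma segmentP a b x : segment a b x <->
  exists t : R, 0 <= t <= 1 /\ x = (1 - t) *: a + t *: b.
Proof.
split; first by case=> t /=; rewrite in_itv /= => t01 <-; exists t.
by case=> t [t01 ->]; exists t => //=; rewrite in_itv.
Qed.

Fixpoint tr x s : set pt :=
  if s is y :: s' then segment x y `|` tr y s' else [set x].

Fixpoint spath x s : Prop :=
  if s is y :: s' then segment x y `&` tr y s' `<=` [set y] /\ spath y s' else True.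

Lemma segment_l a b : segment a b a.
Proof. by apply/segmentP; exists 0; rewrite lexx ler01 subr0 scale1r scale0r addr0. Qed.

Lemma segment_r a b : segment a b b.
Proof. by apply/segmentP; exists 1; rewrite lexx ler01 subrr scale1r scale0r add0r. Qed.

Lemma segment_sym a b : segment a b = segment b a.
Proof.
suff H u w : segment u w `<=` segment w u by apply/seteqP; split.
move=> x /segmentP[t [/andP[t0 t1] ->]]; apply/segmentP; exists (1 - t); split.
  by rewrite subr_ge0 t1 gerBl.
by rewrite opprB addrCA subrr addr0 addrC.
Qed.

Lemma tr_head x s : tr x s x.
Proof. by case: s => [//|y s]; left; exact: segment_l. Qed.

Lemma tr_cat x s y s' : tr x (rcons s y ++ s') = tr x (rcons s y) `|` tr y s'.
Proof.
elim: s x => [|z s IH] x /=; last by rewrite IH setUA.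
by rewrite -setUA; congr (_ `|` _); apply/seteqP; split=> [w|w [->|//]]; [right|exact: tr_head].
Qed.

Lemma tr_last x s y : tr x (rcons s y) y.
Proof. by elim: s x => [|z s IH] x /=; right. Qed.

Lemma spath_cat x s y s' : spath x (rcons s y) -> spath y s' ->
  tr x (rcons s y) `&` tr y s' `<=` [set y] -> spath x (rcons s y ++ s').
Proof.
elim: s x => [|z s IH] x /=; first by move=> [_ _] Hs H; split=> // w [w1 w2]; apply: H; split=> //; left.
move=> [H1 H2] Hs H; split.
  rewrite tr_cat => w [w1 [w2|w2]]; first by apply: H1.
  have E : w = y by apply: H; split=> //; left.
  by apply: H1; split=> //; rewrite E; exact: tr_last.
apply: IH => // w [w1 w2]; apply: H; split=> //; by right.
Qed.

Lemma seg_pos h a b z : (a = z \/ 0 < hp h a) -> (b = z \/ 0 < hp h b) -> 0 <= hp h z ->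
  segment a b `<=` [set x | x = z \/ 0 < hp h x].
Proof.
move=> Ha Hb z0 x /segmentP[t [/andP[t0 t1] ->]] /=.
have [Ha1|Ha1] := ltP 0 (hp h a); last first.
  have E : a = z by case: Ha => //; rewrite ltNge Ha1.
  have [Hb1|Hb1] := ltP 0 (hp h b); last first.
    have -> : b = z by case: Hb => //; rewrite ltNge Hb1.
    by left; rewrite E -scalerDl subrK scale1r.
  have [->|tn0] := eqVneq t 0; first by left; rewrite E subr0 scale1r scale0r addr0.
  have tp : 0 < t by rewrite lt_def tn0.
  right; rewrite hp_conv E; have : 0 < t * hp h b by rewrite mulr_gt0.
  have : 0 <= (1 - t) * hp h z by apply: mulr_ge0 => //; lra.
  lra.
have hb0 : 0 <= hp h b by case: Hb => [->//|/ltW].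
have [Et|tn1] := eqVneq t 1.
  by rewrite Et subrr scale0r scale1r add0r; case: Hb; [left|right].
right; rewrite hp_conv; have : 0 < (1 - t) * hp h a.
  by rewrite mulr_gt0 // subr_gt0 lt_def t1 eq_sym tn1.
have : 0 <= t * hp h b by rewrite mulr_ge0.
lra.
Qed.

Lemma tr_pos h x s z : 0 <= hp h z -> (forall w, w \in x :: s -> w = z \/ 0 < hp h w) ->
  tr x s `<=` [set w | w = z \/ 0 < hp h w].
Proof.
move=> z0; elim: s x => [|y s IH] x H /=.
  by move=> w /= ->; apply: H; rewrite inE.
rewrite subUset; split; last by apply: IH => w ws; apply: H; rewrite inE ws orbT.
by apply: seg_pos => //; apply: H; rewrite !inE eqxx ?orbT.
Qed.

Lemma tr_ge0 h x s : (forall w, w \in x :: s -> 0 <= hp h w) ->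
  forall w, tr x s w -> 0 <= hp h w.
Proof.
elim: s x => [|y s IH] x H /=.
  by move=> w /= ->; apply: H; rewrite inE.
move=> w [|]; last by apply: IH => z zs; apply: H; rewrite inE zs orbT.
move=> /segmentP[t [/andP[t0 t1] ->]]; have t1' : 0 <= 1 - t by lra.
by rewrite hp_conv addr_ge0 // mulr_ge0 // H // !inE eqxx ?orbT.
Qed.

Lemma tr_rcons x s y : tr x (rcons s y) = tr x s `|` segment (last x s) y.
Proof.
elim: s x => [|z s IH] x /=; last by rewrite IH setUA.
apply/seteqP; split=> w /= [H|H]; first by right.
- by right; rewrite H; exact: segment_r.
- by left; rewrite H; exact: segment_l.
- by left.
Qed.

Definition ray x d (I : set R) : set pt := [set x + t *: d | t in I].

Lemma ray_connected x d (I : set R) : is_interval I -> connected (ray x d I).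
Proof.
move=> itv; apply: connected_continuous_connected; first exact/connected_intervalP.
apply: continuous_subspaceT => t; apply: cvgD; first exact: cvg_cst.
by apply: cvgZr_tmp; exact: cvg_id.
Qed.

Lemma bounded_norm (A : set pt) : bounded_set A -> exists M : R, forall x, A x -> `|x| <= M.
Proof.
move=> [M [Mr H]]; exists (M + 1) => x Ax; apply: (H (M + 1)) => //.
by rewrite ltrDl.
Qed.

Lemma sub_bounded (A B : set pt) : A `<=` B -> bounded_set B -> bounded_set A.
Proof. by move=> AB [M [Mr H]]; exists M; split=> // x Mx y Ay; apply: (H x Mx); apply: AB. Qed.

Lemma ray_unbounded x d : d != 0 -> ~ bounded_set (ray x d [set t | 0 <= t]).
Proof.
move=> d0 /bounded_norm[M H].
have M0 : 0 <= M by apply: le_trans (H x _) => //; exists 0 => //=; rewrite scale0r addr0.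
have d0' : 0 < `|d| by rewrite normr_gt0.
pose t := (M + `|x| + 1) / `|d|.
have t0 : 0 <= t by rewrite divr_ge0 // addr_ge0 // addr_ge0.
have := H (x + t *: d) (ex_intro2 _ _ t t0 erefl).
have := ler_normB (x + t *: d) x; rewrite addrAC subrr add0r normrZ (ger0_norm t0).
rewrite /t divfK ?gt_eqF //; lra.
Qed.

(* [r] can be joined, off [T] and within [G], either to infinity or to a
   boundary point of [G] beyond the line [pq]. *)
Definition esc hs p q (T : set pt) (r : pt) := exists C : set pt,
  [/\ connected C, C r, C `&` T = set0 &
    (C `<=` inG hs /\ ~ bounded_set C) \/
    exists z, [/\ C z, clG hs z, ~ inG hs z, 0 < ot p q z &
      C `<=` [set x | x = z \/ inG hs x]]].

Definition sol hs p q (A Rd : seq pt) := exists s : seq pt,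
  [/\ perm_eq s A, spath p (rcons s q),
    tr p (rcons s q) `<=` [set x | [\/ x = p, x = q | inG hs x]] &
    forall r, r \in Rd -> esc hs p q (tr p (rcons s q)) r].

Lemma in_cut h hs x : inG (h :: hs) x <-> 0 < hp h x /\ inG hs x.
Proof.
split=> [H|[H1 H2] k]; last by rewrite inE => /orP[/eqP->//|/H2].
by split=> [|k kin]; apply: H; rewrite inE ?eqxx ?kin ?orbT.
Qed.

Lemma cl_cut h hs x : clG (h :: hs) x <-> 0 <= hp h x /\ clG hs x.
Proof.
split=> [H|[H1 H2] k]; last by rewrite inE => /orP[/eqP->//|/H2].
by split=> [|k kin]; apply: H; rewrite inE ?eqxx ?kin ?orbT.
Qed.

Lemma det0r d : det d 0 = 0.
Proof. by rewrite /det /= !mulr0 subr0. Qed.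

Lemma detNl d x : det (- d) x = - det d x. Proof. by rewrite /det !ptE; ring. Qed.
Lemma detZr d t x : det d (t *: x) = t * det d x. Proof. by rewrite /det !ptE; ring. Qed.

Lemma detdd d : det d d = 0. Proof. by rewrite /det; ring. Qed.

Lemma det_eq0_ray d x : d != 0 -> det d x = 0 -> exists t : R, x = t *: d.
Proof.
case: d x => [d1 d2] [x1 x2]; rewrite /det /= => d0 E.
have [d10|d10] := eqVneq d1 0; last first.
  exists (x1 / d1); apply/eqP; rewrite xpair_eqE /=; apply/andP; split; apply/eqP.
    by rewrite -[RHS]/(x1 / d1 * d1) divfK.
  rewrite -[RHS]/(x1 / d1 * d2) mulrAC; apply: (canRL (mulfK d10)); lra.
have d20 : d2 != 0 by apply: contra d0 => /eqP ->; rewrite d10.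
exists (x2 / d2); apply/eqP; rewrite xpair_eqE /=; apply/andP; split; apply/eqP.
  by rewrite -[RHS]/(x2 / d2 * d1) mulrAC; apply: (canRL (mulfK d20)); lra.
by rewrite -[RHS]/(x2 / d2 * d2) divfK.
Qed.

Lemma perm_of_eq (T : eqType) (s t : seq T) : s = t -> perm_eq s t.
Proof. by move=> ->. Qed.

Lemma combine hs p q y d (A Rd : seq pt) :
  inG hs y -> clG hs p -> clG hs q -> ~ inG hs p -> ~ inG hs q ->
  (forall h, h \in hs -> 0 < hp h p + hp h q) ->
  0 < det d (p - y) -> det d (q - y) < 0 -> ot p q y != 0 ->
  uniq A -> y \in A ->
  (forall x, x \in A -> x != y -> det d (x - y) != 0) ->
  (forall r, r \in Rd -> inG hs r) ->
  (forall r, r \in Rd -> det d (r - y) = 0 -> exists2 t : R, 0 < t & r = y + t *: d) ->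
  sol ((y, d) :: hs) p y [seq x <- A | 0 < det d (x - y)] [seq x <- Rd | 0 < det d (x - y)] ->
  sol ((y, - d) :: hs) y q [seq x <- A | det d (x - y) < 0] [seq x <- Rd | det d (x - y) < 0] ->
  sol hs p q A Rd.
Proof.
move=> Gy cp cq nGp nGq J pl qr ypq uA yA gA RG Rl [s1 [P1 S1 T1 E1]] [s2 [P2 S2 T2 E2]].
have hl x : hp (y, d) x = det d (x - y) by [].
have hr x : hp (y, - d) x = - det d (x - y) by rewrite /hp /= detNl.
have T1' x : tr p (rcons s1 y) x -> [\/ x = p, x = y | inG hs x] /\ (x = y \/ 0 < det d (x - y)).
  move=> /T1[->|->|/in_cut[H1 H2]].
  - by split; [exact: Or31|right].
  - by split; [exact: Or32|left].
  - by split; [exact: Or33|right].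
have T2' x : tr y (rcons s2 q) x -> [\/ x = y, x = q | inG hs x] /\ (x = y \/ det d (x - y) < 0).
  move=> /T2[->|->|/in_cut[H1 H2]].
  - by split; [exact: Or31|left].
  - by split; [exact: Or32|right].
  - by split; [exact: Or33|right; rewrite hr oppr_gt0 in H1].
have dy : det d (y - y) = 0 by rewrite subrr det0r.
exists (s1 ++ y :: s2).
have -> : rcons (s1 ++ y :: s2) q = rcons s1 y ++ rcons s2 q by rewrite rcons_cat cat_rcons.
have TT : tr p (rcons s1 y ++ rcons s2 q) = tr p (rcons s1 y) `|` tr y (rcons s2 q) by rewrite tr_cat.
have dn0 : d != 0 by apply/eqP => E; move: pl; rewrite E /det /= !mul0r subrr ltxx.
have fwd x : tr p (rcons s1 y ++ rcons s2 q) x -> forall t : R, 0 < t -> x <> y + t *: d.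
  rewrite TT => Hx t t0 E.
  have D0 : det d (x - y) = 0 by rewrite E addrAC subrr add0r detZr detdd mulr0.
  have xy : x != y.
    rewrite E; apply/eqP => E'; have : (y + t *: d) - y = 0 by rewrite E' subrr.
    by rewrite addrAC subrr add0r => /eqP; rewrite scaler_eq0 (gt_eqF t0) (negbTE dn0).
  by case: Hx => [/T1'|/T2'] [_ []]; rewrite ?D0 ?ltxx // => E'; rewrite E' eqxx in xy.
(* The path meets the cut only behind [y], so its forward ray is an escape route. *)
have slit (C : set pt) z r (t : R) : 0 < t -> z = y + t *: d -> inG hs z ->
    connected C -> C r -> C z -> C `&` tr p (rcons s1 y ++ rcons s2 q) = set0 -> C `<=` inG hs ->
    esc hs p q (tr p (rcons s1 y ++ rcons s2 q)) r.
  move=> t0 Ez Gz Cc Cr Cz CT CG.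
  have [A0|[t1 [t10 c1 n1 i1]]] := exit_ray d Gz.
    exists (C `|` ray z d [set t | 0 <= t]); split.
    - apply: connectedU => //; first by exists z; split=> //; exists 0 => //=; rewrite scale0r addr0.
      by apply: ray_connected => a b /= a0 b0 c /andP[ac cb]; apply: le_trans ac.
    - by left.
    - rewrite setIUl CT set0U; apply/seteqP; split=> // w [[t' /= t'0 <-]].
      by move=> /fwd/(_ (t + t') (ltr_wpDr t'0 t0)); rewrite scalerDl addrA -Ez.
    - left; split; first by rewrite subUset; split=> // _ [t' /= t'0 <-]; apply: A0.
      move=> B; apply: (@ray_unbounded z d) => //; move: B; apply: sub_bounded => w Hw.
      by right.
  exists (C `|` ray z d [set t' | 0 <= t' <= t1]); split.
  - apply: connectedU => //; first by exists z; split=> //; exists 0; rewrite /= ?lexx ?(ltW t10) // scale0r addr0.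
    apply: ray_connected => a b /= /andP[a0 a1] /andP[b0 b1] c /andP[ac cb].
    by rewrite (le_trans a0 ac) (le_trans cb b1).
  - by left.
  - rewrite setIUl CT set0U; apply/seteqP; split=> // w [[t' /= /andP[t'0 _] <-]].
    by move=> /fwd/(_ (t + t') (ltr_wpDr t'0 t0)); rewrite scalerDl addrA -Ez.
  - right; exists (z + t1 *: d).
    have E : z + t1 *: d - y = (t + t1) *: d by rewrite Ez scalerDl -!addrA addrC -!addrA addNr addr0.
    split=> //.
    + by right; exists t1 => //=; rewrite lexx (ltW t10).
    + apply: (ext_left Gy cp cq J pl qr ypq nGp c1 n1).
        by rewrite E detZr detdd mulr0 lexx.
      have -> : ot p y (z + t1 *: d) = (t + t1) * det d (p - y).
        by rewrite Ez /ot /det !ptE; ring.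
      by rewrite mulr_gt0 // addr_gt0.
    + rewrite subUset; split=> [w /CG|_ [t' /= /andP[t'0 t't] <-]]; first by right.
      move: t't; rewrite le_eqVlt => /orP[/eqP->|t't]; first by left.
      by right; apply: i1; rewrite t'0.
split.
- rewrite perm_sym; apply: (@perm_trans _ (y :: s1 ++ s2)); last first.
    by rewrite perm_sym -cat1s perm_catCA.
  rewrite (perm_trans (perm_to_rem yA)) // perm_cons.
  apply: (@perm_trans _ ([seq x <- A | 0 < det d (x - y)] ++ [seq x <- A | det d (x - y) < 0])); last first.
    by rewrite perm_sym; apply: perm_cat.
  rewrite rem_filter //; apply: (@perm_trans _ ([seq x <- [seq x <- A | x != y] | 0 < det d (x - y)] ++ [seq x <- [seq x <- A | x != y]  | ~~ (0 < det d (x - y))])).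
    by rewrite perm_sym; apply/permPl/perm_filterC.
  rewrite -!filter_predI; apply: perm_cat.
    apply: perm_of_eq; apply: eq_in_filter => x xA /=; have [->|//] := eqVneq x y; rewrite ?dy ?ltxx ?andbF ?andbT //.
  apply: perm_of_eq; apply: eq_in_filter => x xA /=; have [->|nx] := eqVneq x y; first by rewrite dy ltxx andbF.
  by rewrite andbT -leNgt le_eqVlt (negbTE (gA _ xA nx)).
- apply: spath_cat => // w [/T1'[_ H1] /T2'[_ H2]].
  by case: H1 => // H1; case: H2 => // H2; move: (lt_trans H1 H2); rewrite ltxx.
- rewrite TT subUset; split=> w; first by move=> /T1'[[->|->|?] _]; [apply: Or31|apply: Or33|apply: Or33].
  by move=> /T2'[[->|->|?] _]; [apply: Or33|apply: Or32|apply: Or33].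
- move=> r rRd; have [D|D|D] := ltgtP (det d (r - y)) 0; last first.
  + have [t t0 Er] := Rl r rRd D.
    apply: (@slit [set r] r r t) => //; [exact: RG|exact: connected1| |by move=> _ ->; exact: RG].
    by apply/seteqP; split=> // w [/= -> /fwd/(_ t t0)].
  + have [C [Cc Cr CT CE]] := E1 r ltac:(by rewrite mem_filter D).
    have sub : C `<=` [set x | 0 < det d (x - y)] -> C `&` tr p (rcons s1 y ++ rcons s2 q) = set0.
      move=> H; rewrite TT setIUr CT set0U; apply/seteqP; split=> // w [/H /= D1 /T2'[_ [E|D2]]].
        by rewrite E dy ltxx in D1.
      by move: (lt_trans D1 D2); rewrite ltxx.
    case: CE => [[CG nb]|[z [Cz cz nz ez Csub]]].
      exists C; split=> //; first by apply: sub => w /CG/in_cut[].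
      by left; split=> // w /CG/in_cut[].
    move/cl_cut: cz => [zl cz]; rewrite hl in zl.
    have zy : z != y by apply/eqP => E; move: ez; rewrite E /ot /det /=; lra.
    have CTz : C `&` tr p (rcons s1 y ++ rcons s2 q) = set0.
      rewrite TT setIUr CT set0U; apply/seteqP; split=> // w [Cw /T2'[_ H2]].
      case: (Csub w Cw) => /= [E|/in_cut[D1 _]]; last first.
        rewrite hl in D1; case: H2 => [E|D2]; first by rewrite E dy ltxx in D1.
        by move: (lt_trans D1 D2); rewrite ltxx.
      rewrite E in H2; case: H2 => [/eqP|]; first by rewrite (negbTE zy).
      by rewrite ltNge zl.
    have [Gz|nGz] := pselect (inG hs z); last first.
      exists C; split=> //; right; exists z; split=> //.
        exact: (ext_left Gy cp cq J pl qr ypq nGp cz nGz zl ez).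
      by move=> w /Csub[->|/in_cut[_]]; [left|right].
    have z0 : det d (z - y) = 0.
      apply/eqP; rewrite eq_le zl andbT leNgt; apply/negP => D1; apply: nz; exact/in_cut.
    have [t Et] := det_eq0_ray dn0 z0.
    have Ez : z = y + t *: d by rewrite -Et addrC subrK.
    have t0 : 0 < t.
      move: ez; have -> : ot p y z = t * det d (p - y) by rewrite Ez /ot /det !ptE; ring.
      by rewrite pmulr_lgt0.
    by apply: (@slit C z r t) => // w /Csub[->//|/in_cut[]].
  + have [C [Cc Cr CT CE]] := E2 r ltac:(by rewrite mem_filter D).
    have sub : C `<=` [set x | det d (x - y) < 0] -> C `&` tr p (rcons s1 y ++ rcons s2 q) = set0.
      move=> H; rewrite TT setIUr CT setU0; apply/seteqP; split=> // w [/H /= D1 /T1'[_ [E|D2]]].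
        by rewrite E dy ltxx in D1.
      by move: (lt_trans D1 D2); rewrite ltxx.
    case: CE => [[CG nb]|[z [Cz cz nz ez Csub]]].
      exists C; split=> //; first by apply: sub => w /CG/in_cut[]; rewrite hr oppr_gt0.
      by left; split=> // w /CG/in_cut[].
    move/cl_cut: cz => [zl cz]; rewrite hr oppr_ge0 in zl.
    have zy : z != y by apply/eqP => E; move: ez; rewrite E /ot /det /=; lra.
    have CTz : C `&` tr p (rcons s1 y ++ rcons s2 q) = set0.
      rewrite TT setIUr CT setU0; apply/seteqP; split=> // w [Cw /T1'[_ H2]].
      case: (Csub w Cw) => /= [E|/in_cut[D1 _]]; last first.
        rewrite hr oppr_gt0 in D1; case: H2 => [E|D2]; first by rewrite E dy ltxx in D1.
        by move: (lt_trans D1 D2); rewrite ltxx.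
      rewrite E in H2; case: H2 => [/eqP|]; first by rewrite (negbTE zy).
      by rewrite ltNge zl.
    have [Gz|nGz] := pselect (inG hs z); last first.
      exists C; split=> //; right; exists z; split=> //.
        exact: (ext_right Gy cp cq J pl qr ypq nGq cz nGz zl ez).
      by move=> w /Csub[->|/in_cut[_]]; [left|right].
    have z0 : det d (z - y) = 0.
      apply/eqP; rewrite eq_le zl /= leNgt; apply/negP => D1; apply: nz; apply/in_cut.
      by rewrite hr oppr_gt0.
    have [t Et] := det_eq0_ray dn0 z0.
    have Ez : z = y + t *: d by rewrite -Et addrC subrK.
    have t0 : 0 < t.
      move: ez; have -> : ot y q z = t * - det d (q - y) by rewrite Ez /ot /det !ptE; ring.
      by rewrite pmulr_lgt0 // oppr_gt0.
    by apply: (@slit C z r t) => // w /Csub[->//|/in_cut[]].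
Qed.

End Traces.

Lemma word_split (T : eqType) (f : pred T) (w : seq T) (s : nat) :
  count f w = s.+1 -> count (predC f) w = s.*2 ->
  exists w1 b w2, w = w1 ++ b :: w2 /\
    if f b then ((count f w1).*2.-1 <= count (predC f) w2)%N /\
                ((count f w2).*2.-1 <= count (predC f) w1)%N
    else [/\ (0 < count f w1)%N, (0 < count f w2)%N,
             ((count f w1).*2.-1 <= count (predC f) (b :: w2))%N &
             ((count f w2).*2.-1 <= count (predC f) w1)%N].
Proof.
move=> Hf Hs.
pose P j := ((count f (take j w)).*2 <= (count (predC f) (drop j w)).+1)%N.
have ex : exists j, ~~ P j by exists (size w); rewrite /P take_size drop_size Hf /=; lia.
have := ex_minnP ex => -[m nPm mmin].
have m0 : (0 < m)%N by case: m nPm {mmin} => // /negP[]; rewrite /P take0.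
have Pm : P m.-1 by apply: contraT => /mmin; lia.
have msz : (m.-1 < size w)%N.
  rewrite ltnNge; apply/negP => sz.
  move: Pm; rewrite /P take_oversize // drop_oversize // Hf /=; lia.
have x0 : T by case: (w) msz => // x.
exists (take m.-1 w), (nth x0 w m.-1), (drop m w).
have E : w = take m.-1 w ++ nth x0 w m.-1 :: drop m w.
  by rewrite -[in LHS](cat_take_drop m.-1 w) (drop_nth x0 msz) prednK.
split=> //.
move: Pm nPm; rewrite /P.
rewrite (drop_nth x0 msz) prednK //.
have -> : take m w = rcons (take m.-1 w) (nth x0 w m.-1) by rewrite -take_nth // prednK.
move: Hf Hs; rewrite {1 2}E !count_cat -cats1 !count_cat /=.
by case: (f _) => /= H1 H2 H3 H4; split; lia.
Qed.

(** * Paths through a sector *)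

Section Sector.
Variable R : realType.
Notation pt := (R * R)%type.
Implicit Types (a b c d e x y z p q u v w : pt) (h : pt * pt) (hs : seq (pt * pt)).

Lemma generic_dir u (ws : seq pt) : u != 0 -> exists2 d, 0 < det u d &
  forall w, w \in ws -> w != 0 ->
    [/\ det d w != 0, 0 < det u w -> 0 < det d w & det u w < 0 -> det d w < 0].
Proof.
move=> u0; pose n : pt := (- u.2, u.1).
have un : 0 < det u n.
  rewrite /det /n /=; have [u10|u10] := eqVneq u.1 0.
    have u20 : u.2 != 0.
      apply: contra u0 => /eqP u20; rewrite (surjective_pairing u) u10 u20 //.
    rewrite u10 mul0r mulrN opprK add0r; have := sqr_ge0 u.2; rewrite expr2 => H.
    by rewrite lt_def H mulf_neq0.
  have : 0 < u.1 * u.1 by rewrite lt_def mulf_neq0 //= -expr2 sqr_ge0.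
  have : 0 <= u.2 * u.2 by rewrite -expr2 sqr_ge0.
  lra.
have [e e0 H] := perturb u n ws.
exists (u + e *: n).
  have -> : det u (u + e *: n) = e * det u n by rewrite /det !ptE; ring.
  by rewrite mulr_gt0.
move=> w /H [H1 H2] w0; split=> //.
have [D|D|D] := ltgtP (det u w) 0; [by rewrite lt_eqF ?H2|by rewrite gt_eqF ?H1|].
have [t Et] := det_eq0_ray u0 D.
have t0 : t != 0 by apply: contra w0 => /eqP t0; rewrite Et t0 scale0r.
have -> : det (u + e *: n) w = - (e * t * det u n) by rewrite Et /det !ptE; ring.
by rewrite oppr_eq0 !mulf_neq0 // gt_eqF.
Qed.

Definition gpos (S : seq pt) := forall a b c, a \in S -> b \in S -> c \in S ->
  a != b -> a != c -> b != c -> ot a b c != 0.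

Lemma ang_trans g v a b c : 0 < det g (a - v) -> 0 < det g (b - v) -> 0 < det g (c - v) ->
  0 < ot v a b -> 0 < ot v b c -> 0 < ot v a c.
Proof.
move=> ga gb gc ab bc.
have : det g (b - v) * ot v a c = det g (a - v) * ot v b c + det g (c - v) * ot v a b.
  by rewrite /ot /det !ptE; ring.
have : 0 < det g (a - v) * ot v b c by rewrite mulr_gt0.
have : 0 < det g (c - v) * ot v a b by rewrite mulr_gt0.
move=> H1 H2 E; have : 0 < det g (b - v) * ot v a c by lra.
by rewrite pmulr_rgt0.
Qed.

Lemma ot_anti v a b : ot v b a = - ot v a b.
Proof. by rewrite /ot /det !ptE; ring. Qed.

Lemma ang_max S g v (X : seq pt) : gpos S -> v \in S -> {subset X <= S} ->
  (forall x, x \in X -> 0 < det g (x - v)) -> X != [::] ->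
  exists2 y, y \in X & forall x, x \in X -> x != y -> 0 < ot v x y.
Proof.
move=> GP vS; elim: X => [//|a X IH] XS gX _.
have [X0|X0] := eqVneq X [::].
  by rewrite X0; exists a => [|x]; rewrite inE // => /eqP->; rewrite eqxx.
have [||y yX ymax] := IH _ _ X0.
- by move=> x xX; apply: XS; rewrite inE xX orbT.
- by move=> x xX; apply: gX; rewrite inE xX orbT.
have nv x : x \in a :: X -> v != x.
  by move=> /gX H; apply/eqP => E; rewrite -E subrr det0r ltxx in H.
have aX : a \in a :: X by rewrite inE eqxx.
have yX' : y \in a :: X by rewrite inE yX orbT.
have [ay|ay] := eqVneq a y.
  by exists y => // x; rewrite inE => /orP[/eqP->|/ymax//]; rewrite ay eqxx.
have := GP v a y vS (XS _ aX) (XS _ yX') (nv _ aX) (nv _ yX') ay.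
rewrite neq_lt => /orP[L|L]; last first.
  by exists y => // x; rewrite inE => /orP[/eqP->//|/ymax].
exists a => // x; rewrite inE => /orP[/eqP->|xX]; first by rewrite eqxx.
move=> xa; have ya : 0 < ot v y a by rewrite ot_anti oppr_gt0.
have [->//|xy] := eqVneq x y.
apply: (@ang_trans g v x y a) => //; try exact: gX; last exact: ymax.
by apply: gX; rewrite inE xX orbT.
Qed.

(* The corner [y] inherits the role of [p] and [q]: seen from [v] it lies
   between the supply and the red points, hence on the right side of all lines
   joining them. *)
Lemma lens_step v y d x r : 0 < det d (v - y) ->
  0 < ot v x y -> 0 < ot v y r ->
  (0 < det d (x - y) -> 0 < det d (r - y) -> ot y x r < 0) /\
  (det d (x - y) < 0 -> det d (r - y) < 0 -> 0 < ot y x r).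
Proof.
move=> vd xy yr.
have E : det d (v - y) * ot y x r = - (ot v y r * det d (x - y) + ot v x y * det d (r - y)).
  by rewrite /ot /det !ptE; ring.
split=> dx dr.
  rewrite -(pmulr_rlt0 _ vd) E oppr_lt0 addr_gt0 // mulr_gt0 //.
rewrite -(pmulr_rgt0 _ vd) E oppr_gt0.
have : ot v y r * det d (x - y) < 0 by rewrite pmulr_rlt0.
have : ot v x y * det d (r - y) < 0 by rewrite pmulr_rlt0.
lra.
Qed.

Definition valid (S : seq pt) hs p q v g (A Rd X : seq pt) :=
  [/\ [/\ p \in S, q \in S, v \in S & p != q],
      [/\ {subset A <= S}, {subset Rd <= S}, uniq A, uniq Rd & forall x, x \in A -> x \notin Rd],
      [/\ uniq X, {subset X <= A}, forall y, y \in X -> 0 < det g (y - v) &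
        forall y r, y \in X -> r \in Rd -> [/\ 0 < ot p y r, ot q y r < 0 & 0 < ot v y r]],
      [/\ clG hs p, clG hs q, ~ inG hs p, ~ inG hs q &
        forall h, h \in hs -> 0 < hp h p + hp h q] &
      (forall x, x \in A -> inG hs x) /\ (forall x, x \in Rd -> inG hs x)].

Lemma sol_nil hs p q : clG hs p -> clG hs q ->
  (forall h, h \in hs -> 0 < hp h p + hp h q) -> sol hs p q [::] [::].
Proof.
move=> cp cq J; exists [::]; split=> //=.
rewrite subUset; split=> w; last by move=> /= ->; apply: Or32.
move=> /segmentP[t [/andP[t0 t1] ->]] /=.
have [->|tn0] := eqVneq t 0; first by apply: Or31; rewrite subr0 scale1r scale0r addr0.
have [->|tn1] := eqVneq t 1; first by apply: Or32; rewrite subrr scale1r scale0r add0r.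
apply: Or33 => h hin; rewrite hp_conv.
have tp : 0 < t by rewrite lt_def tn0.
have t1p : 0 < 1 - t by rewrite subr_gt0 lt_def t1 eq_sym tn1.
have := J _ hin; have := cp _ hin; have := cq _ hin => a b c.
have [P|P] := ltP 0 (hp h p).
  by rewrite ltr_pwDl // ?mulr_gt0 // mulr_ge0 // ltW.
have -> : hp h p = 0 by lra.
by rewrite mulr0 add0r mulr_gt0 //; lra.
Qed.

Lemma det_opp d x y : det d (x - y) = - det d (y - x).
Proof. by rewrite /det !ptE; ring. Qed.

Lemma sector S hs p q v g (A Rd X : seq pt) : gpos S -> valid S hs p q v g A Rd X ->
  ((size Rd).*2.-1 <= size X)%N -> sol hs p q A Rd.
Proof.
move=> GP; have [n] := ubnP (size A).
elim: n hs p q A Rd X => [//|n IH] hs p q A Rd X /ltnSE szA V szX.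
have [[pS qS vS pq] [AS RS uA uR dAR] [uX XA gX lens] [cp cq nGp nGq J] [AG RG]] := V.
have notG x y : inG hs x -> ~ inG hs y -> x != y by move=> Gx nGy; apply/eqP => E; apply: nGy; rewrite -E.
have [A0|A0] := eqVneq A [::].
  have X0 : X = [::].
    by case: (X) XA => // x X' /(_ x); rewrite inE eqxx A0 => /(_ isT).
  have -> : Rd = [::] by case: (Rd) szX => //= r Rd'; rewrite X0.
  by rewrite A0; apply: sol_nil.
have cut y d (X' : seq pt) : y \in A -> 0 < det d (p - y) -> det d (q - y) < 0 ->
    (forall x, x \in A -> x != y -> det d (x - y) != 0) ->
    (forall r, r \in Rd -> det d (r - y) = 0 -> d = r - y) ->
    uniq X' -> {subset X' <= X} -> (Rd != [::] -> 0 < det d (v - y)) ->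
    (forall x r, x \in X' -> r \in Rd -> 0 < ot v x y /\ 0 < ot v y r) ->
    ((size [seq x <- Rd | (0 < det d (x - y))%R]).*2.-1 <= size [seq x <- X' | (0 < det d (x - y))%R])%N ->
    ((size [seq x <- Rd | (det d (x - y) < 0)%R]).*2.-1 <= size [seq x <- X' | (det d (x - y) < 0)%R])%N ->
    sol hs p q A Rd.
  move=> yA pl qr gA Rl uX' X'X vd vX sz1 sz2.
  have Gy := AG _ yA.
  have yS := AS _ yA.
  have yp := notG _ _ Gy nGp; have yq := notG _ _ Gy nGq.
  have szf (P : pred pt) : ~~ P y -> (size [seq x <- A | P x] < n)%N.
    move=> nPy; apply: leq_trans szA; rewrite size_filter -(count_predC P A) -addn1 leq_add2l -has_count.
    by apply/hasP; exists y.
  have dy : det d (y - y) = 0 by rewrite subrr det0r.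
  apply: (combine Gy cp cq nGp nGq J pl qr _ uA yA gA RG).
  - by apply: GP; rewrite // eq_sym.
  - by move=> r rR /(Rl _ rR) ->; exists 1 => //; rewrite scale1r addrC subrK.
  - apply: IH sz1; first by apply: szf; rewrite dy ltxx.
    split; split=> //; rewrite ?filter_uniq //; try by rewrite eq_sym.
    + by move=> x; rewrite mem_filter => /andP[_ /AS].
    + by move=> x; rewrite mem_filter => /andP[_ /RS].
    + by move=> x; rewrite !mem_filter => /andP[_ /dAR]; rewrite negb_and orbC => ->.
    + by move=> x; rewrite !mem_filter => /andP[-> /X'X/XA].
    + by move=> x; rewrite mem_filter => /andP[_ /X'X/gX].
    + move=> x r; rewrite !mem_filter => /andP[dx xX'] /andP[dr rR].
      have [l1 l2 l3] := lens x r (X'X _ xX') rR; split=> //.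
      have [v1 v2] := vX _ _ xX' rR.
      have vd' : 0 < det d (v - y) by apply: vd; apply/eqP => E; rewrite E in rR.
      by case: (lens_step vd' v1 v2) => + _; apply.
    + by apply/cl_cut; split=> //; exact: ltW.
    + by apply/cl_cut; split; [rewrite /hp /= dy|move=> h /Gy/ltW].
    + by move=> /in_cut[_].
    + by move=> /in_cut[]; rewrite /hp /= dy ltxx.
    + move=> h; rewrite inE => /orP[/eqP->|hin]; first by rewrite /hp /= dy addr0.
      by rewrite ltr_wpDl ?cp ?Gy.
    + by move=> x; rewrite mem_filter => /andP[dx xA]; apply/in_cut; split=> //; exact: AG.
    + by move=> x; rewrite mem_filter => /andP[dx xA]; apply/in_cut; split=> //; exact: RG.
  - apply: IH sz2; first by apply: szf; rewrite dy ltxx.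
    split; split=> //; rewrite ?filter_uniq //.
    + by move=> x; rewrite mem_filter => /andP[_ /AS].
    + by move=> x; rewrite mem_filter => /andP[_ /RS].
    + by move=> x; rewrite !mem_filter => /andP[_ /dAR]; rewrite negb_and orbC => ->.
    + by move=> x; rewrite !mem_filter => /andP[-> /X'X/XA].
    + by move=> x; rewrite mem_filter => /andP[_ /X'X/gX].
    + move=> x r; rewrite !mem_filter => /andP[dx xX'] /andP[dr rR].
      have [l1 l2 l3] := lens x r (X'X _ xX') rR; split=> //.
      have [v1 v2] := vX _ _ xX' rR.
      have vd' : 0 < det d (v - y) by apply: vd; apply/eqP => E; rewrite E in rR.
      by case: (lens_step vd' v1 v2) => _; apply.
    + by apply/cl_cut; split; [rewrite /hp /= detNl dy oppr0|move=> h /Gy/ltW].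
    + by apply/cl_cut; split=> //; rewrite /hp /= detNl oppr_ge0 ltW.
    + by move=> /in_cut[]; rewrite /hp /= detNl dy oppr0 ltxx.
    + by move=> /in_cut[_].
    + move=> h; rewrite inE => /orP[/eqP->|hin]; first by rewrite /hp /= !detNl dy oppr0 add0r oppr_gt0.
      by rewrite ltr_pwDl ?cq ?Gy.
    + by move=> x; rewrite mem_filter => /andP[dx xA]; apply/in_cut; split; [rewrite /hp /= detNl oppr_gt0|exact: AG].
    + by move=> x; rewrite mem_filter => /andP[dx xA]; apply/in_cut; split; [rewrite /hp /= detNl oppr_gt0|exact: RG].
have [R0|R0] := eqVneq Rd [::].
  case: (A) A0 => // y A' _ in cut AG AS *.
  have yA : y \in y :: A' by rewrite inE eqxx.
  have Gy := AG _ yA.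
  have yp := notG _ _ Gy nGp; have yq := notG _ _ Gy nGq.
  have w0 : ot p q y != 0 by apply: GP => //; [exact: AS|rewrite eq_sym|rewrite eq_sym].
  pose u : pt := (ot p q y) *: (2%:R *: y - p - q).
  have up : det u (p - y) = ot p q y ^+ 2 by rewrite /u /ot /det !ptE; ring.
  have uq : det u (q - y) = - ot p q y ^+ 2 by rewrite /u /ot /det !ptE; ring.
  have w2 : 0 < ot p q y ^+ 2 by rewrite lt_def sqrf_eq0 w0 sqr_ge0.
  have u0 : u != 0 by apply/eqP => E; move: up w2; rewrite E /det /= !mul0r subrr => <-; rewrite ltxx.
  have [d _ Hd] := generic_dir [seq x - y | x <- p :: q :: y :: A'] u0.
  have HD x : x \in p :: q :: y :: A' -> x != y -> [/\ det d (x - y) != 0, 0 < det u (x - y) -> 0 < det d (x - y) & det u (x - y) < 0 -> det d (x - y) < 0].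
    by move=> xin xy; apply: Hd; [apply/mapP; exists x|rewrite subr_eq0].
  apply: (cut y d [::]) => //.
  - have [||_ H _] := HD p; [by rewrite inE eqxx|by rewrite eq_sym|].
    by apply: H; rewrite up.
  - have [||_ _ H] := HD q; [by rewrite !inE eqxx orbT|by rewrite eq_sym|].
    by apply: H; rewrite uq oppr_lt0.
  - by move=> x xA xy; have [||] := HD x => //; rewrite !inE in xA *; rewrite xA !orbT.
  - by rewrite R0.
  - by rewrite R0.
  - by rewrite R0.
  - by rewrite R0.
pose X0 := take (size Rd).*2.-1 X.
have szX0 : size X0 = (size Rd).*2.-1 by rewrite size_take; case: ltngtP szX => // ->.
have X0X : {subset X0 <= X} by move=> x; exact: mem_take.
have X00 : X0 != [::] by rewrite -size_eq0 szX0; case: (Rd) R0.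
have X0S : {subset X0 <= S} by move=> x /X0X/XA/AS.
have X0g x : x \in X0 -> 0 < det g (x - v) by move=> /X0X/gX.
have [y yX0 ymax] := ang_max GP vS X0S X0g X00.
have uX0 : uniq X0 by rewrite take_uniq.
have yX := X0X _ yX0; have yA := XA _ yX; have yS := AS _ yA; have Gy := AG _ yA.
pose X' := rem y X0.
have X'E x : x \in X' -> x \in X0 /\ x != y by rewrite mem_rem_uniq // inE => /andP[].
have uX' : uniq X' by rewrite rem_uniq.
have szX' : size X' = (size Rd).-1.*2.
  by rewrite size_rem // szX0; case: (size Rd) => //= m; lia.
pose dir x := if x \in Rd then x - y else y - x.
pose E := Rd ++ X'.
have nR x : x \in X' -> x \notin Rd by move=> /X'E[/X0X/XA/dAR].
have ES x : x \in E -> x \in S /\ x != y.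
  rewrite mem_cat => /orP[xR|xX].
    by split; [exact: RS|apply/eqP => E'; move: (dAR _ yA); rewrite -E' xR].
  by case: (X'E _ xX) => /X0X/XA/AS.
have uE : uniq E.
  rewrite cat_uniq uR uX' andbT /=; apply/hasPn => x /nR; by [].
have dirk x : x \in E -> 0 < det (y - v) (dir x).
  rewrite mem_cat /dir => /orP[xR|xX].
    rewrite xR; have [_ _] := lens y x yX xR.
    by rewrite (_ : ot v y x = det (y - v) (x - y)) // /ot /det !ptE; ring.
  rewrite (negbTE (nR _ xX)); have [xX0 xy] := X'E _ xX.
  have := ymax _ xX0 xy.
  by rewrite (_ : ot v x y = det (y - v) (y - x)) // /ot /det !ptE; ring.
have dir0 a b : a \in E -> b \in E -> a != b -> det (dir a) (dir b) != 0.
  move=> /ES[aS ay] /ES[bS bY] ab.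
  have := GP y a b yS aS bS; rewrite eq_sym ay eq_sym bY ab => /(_ isT isT isT).
  rewrite /dir; case: ifP => _; case: ifP => _.
  - by rewrite (_ : det (a - y) (b - y) = ot y a b) // /ot.
  - by rewrite (_ : det (a - y) (y - b) = - ot y a b) ?oppr_eq0 // /ot /det !ptE; ring.
  - by rewrite (_ : det (y - a) (b - y) = - ot y a b) ?oppr_eq0 // /ot /det !ptE; ring.
  - by rewrite (_ : det (y - a) (y - b) = ot y a b) // /ot /det !ptE; ring.
pose leT a b := det (dir a) (dir b) <= 0.
pose L := sort leT E.
have LE x : (x \in L) = (x \in E) by rewrite mem_sort.
have tot : {in [in E] &, total leT}.
  move=> a b _ _; rewrite /leT.
  have -> : det (dir b) (dir a) = - det (dir a) (dir b) by rewrite /det; ring.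
  by rewrite oppr_le0 le_total.
have tra : {in [in E] & &, transitive leT}.
  move=> b a c bE aE cE; rewrite /leT => ab bc.
  have ID : det (y - v) (dir b) * det (dir a) (dir c) =
    det (y - v) (dir a) * det (dir b) (dir c) + det (y - v) (dir c) * det (dir a) (dir b).
    by rewrite /det; ring.
  rewrite -(pmulr_rle0 _ (dirk _ bE)) ID.
  have : det (y - v) (dir a) * det (dir b) (dir c) <= 0 by rewrite pmulr_rle0 ?dirk.
  have : det (y - v) (dir c) * det (dir a) (dir b) <= 0 by rewrite pmulr_rle0 ?dirk.
  lra.
have allE : all [in E] E by apply/allP.
have pwL : pairwise leT L.
  rewrite -(sorted_pairwise_in tra); first exact: (sort_sorted_in tot).
  by apply/allP => x; rewrite LE.
have cR : count [in Rd] L = (size Rd).-1.+1.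
  rewrite (permP (permEl (perm_sort leT E))) count_cat.
  have -> : count [in Rd] Rd = size Rd by apply/eqP; rewrite -all_count; apply/allP.
  have -> : count [in Rd] X' = 0%N.
    by apply/eqP; rewrite -leqn0 leqNgt -has_count -all_predC; apply/allP => x /nR.
  by rewrite addn0 prednK // lt0n size_eq0.
have cX : count (predC [in Rd]) L = (size Rd).-1.*2.
  have := count_predC [in Rd] L; rewrite size_sort size_cat cR szX' prednK ?lt0n ?size_eq0 //.
  by move/addnI.
have [w1 [b [w2 [EL C]]]] := word_split cR cX.
have uL : uniq L by rewrite sort_uniq.
have inL x : x \in w1 ++ b :: w2 -> x \in E by rewrite -EL LE.
have bE : b \in E by apply: inL; rewrite mem_cat inE eqxx orbT.
have w1E x : x \in w1 -> [/\ x \in E, x != b & det (dir x) (dir b) < 0].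
  move=> xw; have xE : x \in E by apply: inL; rewrite mem_cat xw.
  have xb : x != b.
    apply/eqP => Exb; move: uL; rewrite EL cat_uniq => /and3P[_ /hasPn/(_ b)].
    by rewrite inE eqxx -Exb xw => /(_ isT).
  split=> //; rewrite lt_neqAle dir0 //=.
  move: pwL; rewrite EL pairwise_cat => /and3P[/allrelP H _ _].
  by apply: H; rewrite // inE eqxx.
have w2E x : x \in w2 -> [/\ x \in E, x != b & det (dir b) (dir x) < 0].
  move=> xw; have xE : x \in E by apply: inL; rewrite mem_cat inE xw !orbT.
  have xb : x != b.
    apply/eqP => Exb; move: uL; rewrite EL cat_uniq => /and3P[_ _ /=].
    by rewrite -Exb xw.
  split=> //; rewrite lt_neqAle dir0 //= 1?eq_sym //.
  move: pwL; rewrite EL pairwise_cat => /and3P[_ _ /=] /andP[/allP H _].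
  exact: H.
have fRd x : x \in Rd -> dir x = x - y by rewrite /dir => ->.
have fX' x : x \notin Rd -> dir x = y - x by rewrite /dir => /negbTE->.
have count_side (P : pred pt) (f : pred pt) (W W' : seq pt) :
    perm_eq E (W ++ W') -> (forall x, x \in W' -> ~~ (P x && f x)) ->
    (count (predI P f) E <= count f W)%N.
  move=> pe HW'; rewrite (permP pe) count_cat.
  have -> : count (predI P f) W' = 0%N.
    by apply/eqP; rewrite -leqn0 leqNgt -has_count -all_predC; apply/allP.
  by rewrite addn0; apply: sub_count => x /andP[].
have count_side' (P : pred pt) (f : pred pt) (W W' : seq pt) :
    perm_eq E (W ++ W') -> (forall x, x \in W -> f x -> P x) ->
    (count f W <= count (predI P f) E)%N.
  move=> pe HW; rewrite (permP pe) count_cat.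
  apply: leq_trans (leq_addr _ _).
  by rewrite leq_eqVlt; apply/orP; left; apply/eqP; apply: eq_in_count => x xW /=; apply/idP/andP => [fx|[]//]; split=> //; exact: HW.
have countR (P : pred pt) : size [seq x <- Rd | P x] = count (predI P [in Rd]) E.
  rewrite count_cat size_filter.
  have -> : count (predI P [in Rd]) X' = 0%N.
    apply/eqP; rewrite -leqn0 leqNgt -has_count -all_predC; apply/allP => x /nR /=.
    by move=> /negbTE ->; rewrite andbF.
  by rewrite addn0; apply: eq_in_count => x xR /=; rewrite xR andbT.
have countX (P : pred pt) : size [seq x <- X' | P x] = count (predI P (predC [in Rd])) E.
  rewrite count_cat size_filter.
  have -> : count (predI P (predC [in Rd])) Rd = 0%N.
    apply/eqP; rewrite -leqn0 leqNgt -has_count -all_predC; apply/allP => x xR /=.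
    by rewrite xR andbF.
  by rewrite add0n; apply: eq_in_count => x /nR xR /=; rewrite xR andbT.
have final d W1 W2 mid : perm_eq E (mid ++ W1 ++ W2) ->
    (forall x, x \in mid -> x \in Rd /\ d = x - y) ->
    (forall x, x \in W1 -> 0 < det d (dir x)) ->
    (forall x, x \in W2 -> det d (dir x) < 0) ->
    0 < det d (p - y) -> det d (q - y) < 0 -> 0 < det d (v - y) ->
    (forall x, x \in A -> x != y -> det d (x - y) != 0) ->
    ((count [in Rd] W1).*2.-1 <= count (predC [in Rd]) W2)%N ->
    ((count [in Rd] W2).*2.-1 <= count (predC [in Rd]) W1)%N -> sol hs p q A Rd.
  move=> pe Hm H1 H2 pl qr vd gA c1 c2.
  have dW1R x : x \in W1 -> x \in Rd -> 0 < det d (x - y) by move=> xw xR; rewrite -fRd ?H1.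
  have dW2R x : x \in W2 -> x \in Rd -> det d (x - y) < 0 by move=> xw xR; rewrite -fRd ?H2.
  have dW1X x : x \in W1 -> x \notin Rd -> det d (x - y) < 0.
    by move=> xw xR; rewrite det_opp -fX' // oppr_lt0 H1.
  have dW2X x : x \in W2 -> x \notin Rd -> 0 < det d (x - y).
    by move=> xw xR; rewrite det_opp -fX' // oppr_gt0 H2.
  have dm x : x \in mid -> det d (x - y) = 0 by move=> /Hm[_ ->]; rewrite detdd.
  apply: (cut y d X') => //.
  - move=> r rR dr; have : r \in E by rewrite mem_cat rR.
    rewrite (perm_mem pe) !mem_cat => /or3P[/Hm[_ ->//]|/dW1R/(_ rR)|/dW2R/(_ rR)]; by rewrite dr ltxx.
  - by move=> x /X'E[/X0X].
  - move=> x r xX' rR; have [xX0 xy] := X'E _ xX'; split; first exact: ymax.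
    by have [] := lens y r yX rR.
  - rewrite countR countX.
    apply: leq_trans (_ : ((count [in Rd] W1).*2.-1 <= _)%N).
      have : (count (predI (fun x => 0 < det d (x - y))%R [in Rd]) E <= count [in Rd] W1)%N.
        apply: (count_side _ _ _ (W2 ++ mid)).
          by rewrite (perm_trans pe) // perm_catC -catA.
        move=> x; rewrite mem_cat => /orP[xw|/dm ->]; last by rewrite ltxx.
        apply/negP => /andP[/= + xR]; by rewrite ltNge (ltW (dW2R _ xw xR)).
      by move=> H; rewrite -!subn1 leq_sub2r // leq_double.
    apply: leq_trans c1 _; apply: (count_side' _ _ _ (mid ++ W1)).
      by rewrite (perm_trans pe) // catA perm_catC.
    by move=> x xw /= xR; exact: dW2X.
  - rewrite countR countX.
    apply: leq_trans (_ : ((count [in Rd] W2).*2.-1 <= _)%N).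
      have : (count (predI (fun x => det d (x - y) < 0)%R [in Rd]) E <= count [in Rd] W2)%N.
        apply: (count_side _ _ _ (mid ++ W1)).
          by rewrite (perm_trans pe) // catA perm_catC.
        move=> x; rewrite mem_cat => /orP[/dm ->|xw]; first by rewrite ltxx.
        apply/negP => /andP[/= + xR]; by rewrite ltNge (ltW (dW1R _ xw xR)).
      by move=> H; rewrite -!subn1 leq_sub2r // leq_double.
    apply: leq_trans c2 _; apply: (count_side' _ _ _ (W2 ++ mid)).
      by rewrite (perm_trans pe) // perm_catC -catA.
    by move=> x xw /= xR; exact: dW1X.
have pEL : perm_eq E (w1 ++ b :: w2) by rewrite -EL perm_sym; apply/permPl/perm_sort.
move: C; case: ifP => [bR [c1 c2]|/negbT bR [c01 c02 c1 c2]].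
  have [lp lq lv] := lens y b yX bR.
  apply: (final (b - y) w1 w2 [:: b]) => //.
  - by rewrite (perm_trans pEL) // -cat1s perm_catCA.
  - by move=> x; rewrite inE => /eqP ->.
  - move=> x /w1E[_ _]; rewrite (fRd b) //.
    rewrite (_ : det (dir x) (b - y) = - det (b - y) (dir x)); last by rewrite /det; ring.
    by rewrite oppr_lt0.
  - by move=> x /w2E[_ _]; rewrite (fRd b).
  - by move: lp; rewrite (_ : ot p y b = det (b - y) (p - y)) // /ot /det !ptE; ring.
  - by move: lq; rewrite (_ : ot q y b = det (b - y) (q - y)) // /ot /det !ptE; ring.
  - by move: lv; rewrite (_ : ot v y b = det (b - y) (v - y)) // /ot /det !ptE; ring.
  - move=> x xA xy; have [bS bY] := ES _ bE.
    have xb : b != x by apply/eqP => Ebx; move: (dAR _ xA); rewrite -Ebx bR.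
    have := GP y b x yS bS (AS _ xA); rewrite eq_sym bY eq_sym xy xb => /(_ isT isT isT).
    by rewrite /ot.
have bX' : b \in X' by move: bE; rewrite mem_cat (negbTE bR).
have kb := dirk _ bE.
have u0 : dir b != 0 by apply/eqP => E0; move: kb; rewrite E0 det0r ltxx.
have [d bd Hd] := generic_dir ((v - y) :: [seq x - y | x <- A] ++ [seq dir x | x <- E]) u0.
have Hdir x : x \in E -> [/\ det d (dir x) != 0, 0 < det (dir b) (dir x) -> 0 < det d (dir x) & det (dir b) (dir x) < 0 -> det d (dir x) < 0].
  move=> xE; apply: Hd; first by rewrite inE mem_cat (map_f dir) ?orbT.
  by apply/eqP => E0; move: (dirk _ xE); rewrite E0 det0r ltxx.
have vd : 0 < det d (v - y).
  have [| |_ H _] := Hd (v - y); first by rewrite inE eqxx.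
    by apply/eqP => E0; move: kb; rewrite -opprB E0 oppr0 /det /= !mul0r subrr ltxx.
  apply: H; rewrite (_ : det (dir b) (v - y) = det (y - v) (dir b)) //.
  by rewrite /det !ptE; ring.
have Hw1 x : x \in w1 -> 0 < det d (dir x).
  move=> /w1E[xE xb D]; have [_ + _] := Hdir _ xE; apply.
  rewrite (_ : det (dir b) (dir x) = - det (dir x) (dir b)) ?oppr_gt0 //; by rewrite /det; ring.
have Hw2 x : x \in b :: w2 -> det d (dir x) < 0.
  rewrite inE => /orP[/eqP->|/w2E[xE xb D]]; last by have [_ _ +] := Hdir _ xE; apply.
  by rewrite (_ : det d (dir b) = - det (dir b) d) ?oppr_lt0 // /det; ring.
move: (c01) (c02); rewrite -!has_count => /hasP[r1 r1w r1R] /hasP[r2 r2w r2R].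
have d1 : 0 < det d (r1 - y) by rewrite -fRd ?Hw1.
have d2 : det d (r2 - y) < 0 by rewrite -fRd // Hw2 // inE r2w orbT.
have k1 : 0 < det d (v - y) := vd.
have [p1 q1 v1] := lens y r1 yX r1R.
have [p2 q2 v2] := lens y r2 yX r2R.
have D12 : det (r1 - y) (r2 - y) < 0.
  have ID : det (r1 - y) (r2 - y) * det d (v - y) = det d (r2 - y) * ot v y r1 - det d (r1 - y) * ot v y r2.
    by rewrite /ot /det !ptE; ring.
  rewrite -(pmulr_llt0 _ vd) ID.
  have : det d (r2 - y) * ot v y r1 < 0 by rewrite pmulr_llt0.
  have : 0 < det d (r1 - y) * ot v y r2 by rewrite mulr_gt0.
  by move=> h /lt_trans/(_ h); rewrite subr_lt0.
have dp : 0 < det d (p - y).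
  have ID : det (r1 - y) (r2 - y) * det d (p - y) = det d (r2 - y) * ot p y r1 - det d (r1 - y) * ot p y r2.
    by rewrite /ot /det !ptE; ring.
  rewrite -(nmulr_rlt0 _ D12) ID.
  have : det d (r2 - y) * ot p y r1 < 0 by rewrite pmulr_llt0.
  have : 0 < det d (r1 - y) * ot p y r2 by rewrite mulr_gt0.
  by move=> h /lt_trans/(_ h); rewrite subr_lt0.
have dq : det d (q - y) < 0.
  have ID : det (r1 - y) (r2 - y) * det d (q - y) = det d (r2 - y) * ot q y r1 - det d (r1 - y) * ot q y r2.
    by rewrite /ot /det !ptE; ring.
  rewrite -(nmulr_rgt0 _ D12) ID.
  have : 0 < det d (r2 - y) * ot q y r1 by rewrite nmulr_rgt0.
  have : det d (r1 - y) * ot q y r2 < 0 by rewrite pmulr_rlt0.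
  by move=> h /(lt_trans h); rewrite subr_gt0.
apply: (final d w1 (b :: w2) [::]) => //.
- move=> x xA xy; have [||] := Hd (x - y) => //.
    by rewrite inE mem_cat (map_f (fun z => z - y)) ?orbT.
  by rewrite subr_eq0.
- by rewrite /= (negbTE bR) add0n; move: c2.
Qed.

End Sector.

(** * Closing up paths *)

Section Assembly.
Variable R : realType.
Notation pt := (R * R)%type.
Implicit Types (a b c d e x y z p q u v w : pt) (h : pt * pt) (hs : seq (pt * pt)) (s : seq pt).

Lemma tr_nth x s i : (i < size s)%N ->
  segment (nth 0 (x :: s) i) (nth 0 (x :: s) i.+1) `<=` tr x s.
Proof.
elim: s x i => [//|y s IH] x [|i] /= Hi w Hw; first by left.
by right; apply: (IH y i).
Qed.

Lemma tr_vertex x s k : (k <= size s)%N -> tr x s (nth 0 (x :: s) k).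
Proof.
elim: s x k => [|y s IH] x [|k] //= Hk; first by left; exact: segment_l.
by right; exact: IH.
Qed.

Lemma spath_inter x s i j : spath x s -> (i < j < size s)%N ->
  segment (nth 0 (x :: s) i) (nth 0 (x :: s) i.+1) `&`
  segment (nth 0 (x :: s) j) (nth 0 (x :: s) j.+1) `<=` [set nth 0 (x :: s) i.+1].
Proof.
elim: s x i j => [|y s IH] x [|i] [|j] //=; rewrite ?andbF //.
  by move=> [H _] Hj w [w1 w2]; apply: H; split=> //; apply: (tr_nth Hj).
by move=> [_ H] Hij; apply: (IH y i j H).
Qed.

Lemma spath_vertex x s k i : spath x s -> uniq (x :: s) -> (k <= size s)%N -> (i < size s)%N ->
  segment (nth 0 (x :: s) i) (nth 0 (x :: s) i.+1) (nth 0 (x :: s) k) ->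
  nth 0 (x :: s) k = nth 0 (x :: s) i \/ nth 0 (x :: s) k = nth 0 (x :: s) i.+1.
Proof.
elim: s x k i => [//|y s IH] x [|k] [|i] /=; try by left.
- move=> [H _] /andP[xy _] _ Hi Hw; exfalso.
  have /= E : [set y] x by apply: H; split; [exact: segment_l|exact: (@tr_nth y s i Hi)].
  by move: xy; rewrite E inE eqxx.
- move=> [H _] _ Hk _ Hw; right; apply: H; split=> //; exact: (@tr_vertex y s k Hk).
- move=> [_ H] /andP[_ us] Hk Hi Hw; exact: (IH y k i H us).
Qed.

Section TwoPaths.
Variables (a b : pt) (s1 s2 : seq pt).
Hypothesis S1 : spath a (rcons s1 b).
Hypothesis S2 : spath b (rcons s2 a).
Hypothesis T12 : tr a (rcons s1 b) `&` tr b (rcons s2 a) `<=` [set a; b].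
Let pol := a :: s1 ++ b :: s2.
Hypothesis upol : uniq pol.
Let L1 := a :: rcons s1 b.
Let L2 := b :: rcons s2 a.

Let szpol : size pol = ((size s1).+1 + (size s2).+1)%N.
Proof. by rewrite /= size_cat /=; lia. Qed.

Let uL1 : uniq L1.
Proof.
move: upol; rewrite /pol /L1 -cat_rcons -cat_cons cat_uniq => /andP[H _]; exact: H.
Qed.

Let uL2 : uniq L2.
Proof.
move: upol; rewrite /pol -cat_cons -(rot_uniq (size (a :: s1))) rot_size_cat /L2.
by rewrite -cat_rcons cat_uniq => /andP[H _]; exact: H.
Qed.

Let edge1 i : (i <= size s1)%N -> edge pol i = segment (nth 0 L1 i) (nth 0 L1 i.+1).
Proof.
move=> Hi; rewrite /edge /vertex !modn_small ?szpol; try lia.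
have E k : (k <= (size s1).+1)%N -> nth 0 pol k = nth 0 L1 k.
  move=> Hk; rewrite /pol /L1 -cat_rcons -cat_cons nth_cat /= size_rcons ltnS.
  by rewrite Hk.
by rewrite !E //; lia.
Qed.

Let vert2a k : (k <= size s2)%N -> vertex pol ((size s1).+1 + k) = nth 0 L2 k.
Proof.
move=> Hk; rewrite /vertex modn_small ?szpol; last lia.
rewrite /pol -cat_cons nth_cat /= ltnNge leq_addr /= addKn.
by rewrite /L2 -rcons_cons nth_rcons /= ltnS Hk.
Qed.

Let vert2b k : (k <= size s2)%N -> vertex pol ((size s1).+1 + k).+1 = nth 0 L2 k.+1.
Proof.
rewrite leq_eqVlt => /orP[/eqP->|Hk]; last by rewrite -addnS vert2a.
rewrite /vertex; have -> : ((size s1).+1 + size s2).+1 = size pol by rewrite szpol addnS.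
by rewrite modnn /= nth_rcons ltnn eqxx.
Qed.

Let edge2 k : (k <= size s2)%N ->
  edge pol ((size s1).+1 + k) = segment (nth 0 L2 k) (nth 0 L2 k.+1).
Proof.
by move=> Hk; rewrite /edge vert2a // vert2b.
Qed.

Let split_index i : (i < size pol)%N ->
  (i <= size s1)%N \/ exists2 k, (k <= size s2)%N & i = ((size s1).+1 + k)%N.
Proof.
rewrite szpol => Hi; have [|H] := leqP i (size s1); first by left.
by right; exists (i - (size s1).+1)%N; lia.
Qed.

Let edge_tr1 i : (i <= size s1)%N -> edge pol i `<=` tr a (rcons s1 b).
Proof. by move=> Hi; rewrite edge1 //; apply: tr_nth; rewrite size_rcons ltnS. Qed.

Let edge_tr2 k : (k <= size s2)%N -> edge pol ((size s1).+1 + k) `<=` tr b (rcons s2 a).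
Proof. by move=> Hi; rewrite edge2 //; apply: tr_nth; rewrite size_rcons ltnS. Qed.

Let ends1 i : (i <= size s1)%N -> edge_ends pol i = [set nth 0 L1 i; nth 0 L1 i.+1].
Proof.
move=> Hi; rewrite /edge_ends /vertex !modn_small ?szpol; try lia.
have E k : (k <= (size s1).+1)%N -> nth 0 pol k = nth 0 L1 k.
  move=> Hk; rewrite /pol /L1 -cat_rcons -cat_cons nth_cat /= size_rcons ltnS.
  by rewrite Hk.
by rewrite !E //; lia.
Qed.

Let ends2 k : (k <= size s2)%N ->
  edge_ends pol ((size s1).+1 + k) = [set nth 0 L2 k; nth 0 L2 k.+1].
Proof.
by move=> Hk; rewrite /edge_ends vert2a // vert2b.
Qed.

Let vert1 w i : w \in L1 -> (i <= size s1)%N -> edge pol i w -> edge_ends pol i w.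
Proof.
move=> /(nthP 0)[k]; rewrite /= size_rcons => Hk <- Hi; rewrite edge1 // ends1 // => Hw.
have := spath_vertex S1 uL1 _ _ Hw; rewrite size_rcons; apply; lia.
Qed.

Let vert2 w k : w \in L2 -> (k <= size s2)%N -> edge pol ((size s1).+1 + k) w ->
  edge_ends pol ((size s1).+1 + k) w.
Proof.
move=> /(nthP 0)[j]; rewrite /= size_rcons => Hj <- Hk; rewrite edge2 // ends2 // => Hw.
have := spath_vertex S2 uL2 _ _ Hw; rewrite size_rcons; apply; lia.
Qed.

Lemma assemble : (3 <= size pol)%N ->
  simple_polygon pol /\ boundary pol `<=` tr a (rcons s1 b) `|` tr b (rcons s2 a).
Proof.
move=> sz3; split; last first.
  move=> w [i /= Hi Hw]; case: (split_index Hi) => [Hi'|[k Hk Ei]].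
    by left; apply: edge_tr1 Hw.
  by right; rewrite Ei in Hw; apply: edge_tr2 Hw.
split=> // .
have main i j : (i < j)%N -> (j < size pol)%N -> edge pol i `&` edge pol j `<=` edge_ends pol i `&` edge_ends pol j.
  move=> ij Hj w [wi wj]; have Hi := ltn_trans ij Hj.
  case: (split_index Hi) => [Hi'|[k Hk Ei]]; case: (split_index Hj) => [Hj'|[k' Hk' Ej]].
  - have wL : w \in L1.
      move: (wi) (wj); rewrite !edge1 // => w1 w2.
      have /= -> := spath_inter S1 (_ : (i < j < size (rcons s1 b))%N) (conj w1 w2); last by rewrite size_rcons ij ltnS.
      by apply: (@mem_nth _ 0 L1 i.+1); rewrite /= size_rcons; lia.
    by split; apply: vert1.
  - have [wa|wb] : [set a; b] w.
      by apply: T12; split; [apply: edge_tr1 wi|rewrite Ej in wj; apply: edge_tr2 wj].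
    + split; first by apply: vert1 => //; rewrite wa inE eqxx.
      by rewrite Ej in wj *; apply: vert2 => //; rewrite wa inE mem_rcons inE eqxx orbT.
    + split; first by apply: vert1 => //; rewrite wb inE mem_rcons inE eqxx orbT.
      by rewrite Ej in wj *; apply: vert2 => //; rewrite wb inE eqxx.
  - lia.
  - have wL : w \in L2.
      move: (wi) (wj); rewrite Ei Ej !edge2 // => w1 w2.
      have /= -> := spath_inter S2 (_ : (k < k' < size (rcons s2 a))%N) (conj w1 w2); last by rewrite size_rcons; lia.
      by apply: (@mem_nth _ 0 L2 k.+1); rewrite /= size_rcons; lia.
    by rewrite Ei Ej in wi wj *; split; apply: vert2.
move=> i j Hi Hj; rewrite neq_ltn => /orP[ij|ji]; first exact: main.
by rewrite setIC [X in _ `<=` X]setIC; exact: main.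
Qed.

End TwoPaths.

Lemma exterior_of (C : set pt) (pol : seq pt) r : connected C -> C r ->
  C `&` boundary pol = set0 -> ~ bounded_set C -> exterior pol r.
Proof.
move=> Cc Cr CB nb B; apply: nb; apply: sub_bounded B.
apply: connected_component_max => // w Cw Bw.
have : (C `&` boundary pol) w by [].
by rewrite CB.
Qed.

(* A region bounded by a supporting line of all vertices leads to infinity. *)
Lemma esc_exterior hs p q (T : set pt) pol r : esc hs p q T r ->
  boundary pol `&` inG hs `<=` T ->
  (forall z, clG hs z -> ~ inG hs z -> 0 < ot p q z ->
     exists h, (forall w, boundary pol w -> 0 <= hp h w) /\ hp h z < 0) ->
  exterior pol r.
Proof.
move=> [C [Cc Cr CT CE]] BT out; case: CE => [[CG nb]|[z [Cz cz nz ez Csub]]].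
  apply: (exterior_of Cc Cr) => //; apply/seteqP; split=> // w [Cw Bw].
  by have : (C `&` T) w; [split=> //; apply: BT; split=> //; apply: CG|rewrite CT].
have [h [Bh hz]] := out z cz nz ez.
have h0 : h.2 != 0 by apply/eqP => E; move: hz; rewrite /hp E /det /= !mul0r subrr ltxx.
have hr (t : R) : hp h (z + t *: h.2) < 0 by rewrite hp_ray detdd mulr0 addr0.
apply: (@exterior_of (C `|` ray z h.2 [set t | 0 <= t])).
- apply: connectedU => //; first by exists z; split=> //; exists 0 => //=; rewrite scale0r addr0.
  by apply: ray_connected => x y /= a0 b0 c /andP[ac cb]; apply: le_trans ac.
- by left.
- apply/seteqP; split=> // w [[Cw|[t _ <-]] Bw]; last by have := Bh _ Bw; rewrite leNgt hr.
  case: (Csub _ Cw) => /= [E|Gw]; first by have := Bh _ Bw; rewrite E leNgt hz.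
  by have : (C `&` T) w; [split=> //; apply: BT; split|rewrite CT].
- move=> B; apply: (@ray_unbounded R z h.2) => //; apply: sub_bounded B => w Hw.
  by right.
Qed.

End Assembly.

(** * Convex hull vertices and edges *)

Section Hull.
Variable R : realType.
Notation pt := (R * R)%type.
Implicit Types (a b c d e x y z p q u v w : pt) (h : pt * pt) (hs : seq (pt * pt)) (s : seq pt).

Lemma list_argmax (T : eqType) (F : T -> R) (s : seq T) : s != [::] ->
  exists2 x : T, x \in s & forall y : T, y \in s -> F y <= F x.
Proof.
elim: s => [//|a s IH] _; have [->|s0] := eqVneq s [::].
  by exists a => [|y]; rewrite inE // => /eqP->.
have [x xs H] := IH s0; have [ax|ax] := leP (F a) (F x).
  by exists x => [|y]; rewrite inE ?xs ?orbT // => /orP[/eqP->|/H].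
exists a => [|y]; rewrite inE ?eqxx // => /orP[/eqP->//|/H] yx.
by apply: le_trans yx _; exact: ltW.
Qed.

Lemma pt0 u : u.1 = 0 -> u.2 = 0 -> u = 0.
Proof. by case: u => ? ? /= -> ->. Qed.

Variable S : seq pt.
Hypothesis GP : gpos S.

(* Vertices of the convex hull of [S], witnessed by a strict support direction,
   and its counterclockwise edges. *)
Definition hv w := w \in S /\ exists e, forall x, x \in S -> x != w -> 0 < det e (x - w).
Definition he a b := [/\ a \in S, b \in S, a != b &
  forall x, x \in S -> x != a -> x != b -> 0 < ot a b x].

Lemma hv_exists : S != [::] -> exists v, hv v.
Proof.
move=> S0; have u0 : ((1, 0) : pt) != 0 by rewrite xpair_eqE /= negb_and oner_eq0.
have [g _ Hg] := generic_dir [seq x - y | x <- S, y <- S] u0.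
have [v vS vmax] := list_argmax (fun x => - det g x) S0.
exists v; split=> //; exists g => x xS xv.
have [||D _ _] := Hg (x - v); [by apply/allpairsP; exists (x, v)|by rewrite subr_eq0|].
rewrite lt_def D /=; have := vmax x xS.
by rewrite lerN2 (_ : det g (x - v) = det g x - det g v) ?subr_ge0 // /det !ptE; ring.
Qed.

Lemma he_hv_r a b : he a b -> hv b.
Proof.
move=> [aS bS ab H]; split=> //.
pose n : pt := (- (b - a).2, (b - a).1).
have nn : 0 < det (b - a) n.
  rewrite /det /n /= mulrN opprK -!expr2 lt_def addr_ge0 ?sqr_ge0 // andbT.
  rewrite paddr_eq0 ?sqr_ge0 // !sqrf_eq0; apply: contra ab => /andP[/eqP h1 /eqP h2].
  rewrite eq_sym -subr_eq0; apply/eqP; exact: (@pt0 (b - a) h1 h2).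
have [e e0 He] := perturb (b - a) n [seq x - b | x <- S].
exists ((b - a) + e *: n) => x xS xb; have [->|xa] := eqVneq x a.
  have -> : det (b - a + e *: n) (a - b) = e * det (b - a) n by rewrite /det !ptE; ring.
  by rewrite mulr_gt0.
have [|P _] := He (x - b); first by apply/mapP; exists x.
apply: P; have := H x xS xa xb.
by rewrite (_ : ot a b x = det (b - a) (x - b)) // /ot /det !ptE; ring.
Qed.

Lemma he_hv_l a b : he a b -> hv a.
Proof.
move=> [aS bS ab H]; split=> //.
pose n : pt := ((b - a).2, - (b - a).1).
have nn : 0 < det n (b - a).
  rewrite /det /n /= mulNr opprK -!expr2 lt_def addr_ge0 ?sqr_ge0 // andbT.
  rewrite paddr_eq0 ?sqr_ge0 // !sqrf_eq0; apply: contra ab => /andP[/eqP h1 /eqP h2].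
  rewrite eq_sym -subr_eq0; apply/eqP; exact: (@pt0 (b - a) h2 h1).
have [e e0 He] := perturb (b - a) n [seq x - a | x <- S].
exists ((b - a) + e *: n) => x xS xa; have [->|xb] := eqVneq x b.
  have -> : det (b - a + e *: n) (b - a) = e * det n (b - a) by rewrite /det !ptE; ring.
  by rewrite mulr_gt0.
have [|P _] := He (x - a); first by apply/mapP; exists x.
by apply: P; exact: H.
Qed.

Lemma hv_beyond v c x x' : hv c -> v \in S -> x \in S -> x' \in S ->
  0 < ot v x c -> 0 < ot v c x' -> ot x x' c < 0.
Proof.
move=> [cS [e He]] vS xS x'S xc cx'; rewrite ltNge; apply/negP => xx'c.
have nc z : z \in S -> (z = c -> False) -> 0 < det e (z - c) by move=> zS zc; apply: He => //; apply/eqP.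
have ev : 0 < det e (v - c) by apply: nc => // E; move: xc; rewrite E /ot /det !ptE; lra.
have ex : 0 < det e (x - c) by apply: nc => // E; move: xc; rewrite E /ot /det !ptE; lra.
have ex' : 0 < det e (x' - c) by apply: nc => // E; move: cx'; rewrite E /ot /det !ptE; lra.
have ID : ot x x' c * det e (v - c) + ot v c x' * det e (x - c) + ot v x c * det e (x' - c) = 0.
  by rewrite /ot /det !ptE; ring.
have : 0 <= ot x x' c * det e (v - c) by rewrite mulr_ge0 // ltW.
have : 0 < ot v c x' * det e (x - c) by rewrite mulr_gt0.
have : 0 < ot v x c * det e (x' - c) by rewrite mulr_gt0.
lra.
Qed.

Section Around.
Variables (v : pt).
Hypothesis hvv : hv v.

Lemma ang_total x y : x \in S -> y \in S -> x != v -> y != v -> x != y ->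
  0 < ot v x y \/ 0 < ot v y x.
Proof.
move=> xS yS xv yv xy; have [vS _] := hvv.
have := GP vS xS yS; rewrite eq_sym xv eq_sym yv xy => /(_ isT isT isT).
rewrite neq_lt => /orP[H|]; last by left.
by right; rewrite ot_anti oppr_gt0.
Qed.

Lemma ang_tr x y z : x \in S -> y \in S -> z \in S ->
  0 < ot v x y -> 0 < ot v y z -> 0 < ot v x z.
Proof.
move=> xS yS zS xy yz; have [vS [e He]] := hvv.
have n1 : x != v by apply/eqP => E; move: xy; rewrite E /ot subrr /det !mul0r subrr ltxx.
have n2 : y != v by apply/eqP => E; move: yz; rewrite E /ot subrr /det !mul0r subrr ltxx.
have n3 : z != v by apply/eqP => E; move: yz; rewrite E /ot subrr det0r ltxx.
by apply: (@ang_trans R e v x y z); auto.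
Qed.

Lemma ang_neq x y : 0 < ot v x y -> [/\ x != v, y != v & x != y].
Proof.
move=> H; split; apply/eqP => E; move: H; rewrite E.
- by rewrite /ot subrr /det !mul0r subrr ltxx.
- by rewrite /ot subrr det0r ltxx.
- by rewrite /ot detdd ltxx.
Qed.

(* The hull edge crossed farthest from [v] by a ray separating the points
   up to [y] from the later ones. *)
Lemma bridge y x0 : y \in S -> x0 \in S -> 0 < ot v y x0 ->
  exists a b, [/\ he a b, a = y \/ 0 < ot v a y & 0 < ot v y b].
Proof.
move=> yS x0S yx0; have [vS [e He]] := hvv.
have [yv x0v _] := ang_neq yx0.
have u0 : y - v != 0 by rewrite subr_eq0.
have [d ud Hd] := generic_dir [seq x - v | x <- S] u0.
have dQ x : x \in S -> 0 < ot v y x -> 0 < det d (x - v).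
  move=> xS yx; have [_ xv _] := ang_neq yx.
  have [||_ H _] := Hd (x - v); [by apply/mapP; exists x|by rewrite subr_eq0|exact: H].
have dy : det d (y - v) < 0.
  by rewrite (_ : det d (y - v) = - det (y - v) d) ?oppr_lt0 // /det; ring.
have dP x : x \in S -> x = y \/ 0 < ot v x y -> det d (x - v) < 0.
  move=> xS [->//|xy]; have [xv _ _] := ang_neq xy.
  have [||_ _ H] := Hd (x - v); [by apply/mapP; exists x|by rewrite subr_eq0|].
  by apply: H; move: xy; rewrite ot_anti oppr_gt0.
pose P := [seq x <- S | (x == y) || (0 < ot v x y)].
pose Q := [seq x <- S | 0 < ot v y x].
pose F (ab : pt * pt) := ot v ab.1 ab.2 / det d (ab.2 - ab.1).
have inP x : x \in P -> x \in S /\ (x = y \/ 0 < ot v x y).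
  by rewrite mem_filter => /andP[/orP[/eqP|] ? ->]; auto.
have inQ x : x \in Q -> x \in S /\ 0 < ot v y x by rewrite mem_filter => /andP[].
have PQ0 : [seq (a, b) | a <- P, b <- Q] != [::].
  apply/eqP => E; have : (y, x0) \in [seq (a, b) | a <- P, b <- Q].
    by apply/allpairsP; exists (y, x0); split=> //=; rewrite mem_filter ?eqxx ?yx0.
  by rewrite E.
have [[a b] /allpairsP[[a' b'] /= [aP bQ [Ea Eb]]] max] := list_argmax F PQ0.
rewrite -{}Ea -{}Eb {a' b'} in aP bQ.
have [aS ay] := inP _ aP; have [bS yb] := inQ _ bQ.
exists a, b; split=> //.
have dB := dQ _ bS yb; have dA := dP _ aS ay.
have ab : 0 < ot v a b by case: ay => [->//|ay]; apply: (ang_tr aS yS bS ay yb).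
have den x z : x \in P -> z \in Q -> 0 < det d (z - x).
  move=> /inP[xS /(dP _ xS) H1] /inQ[zS /(dQ _ zS) H2].
  by rewrite (_ : det d (z - x) = det d (z - v) - det d (x - v)); [lra|rewrite /det !ptE; ring].
have [av bv anb] := ang_neq ab.
split=> // x xS xa xb.
have [->|xv] := eqVneq x v.
  by rewrite (_ : ot a b v = ot v a b) // /ot /det !ptE; ring.
have n0 : ot a b x != 0 by apply: GP; rewrite // eq_sym.
rewrite lt_def n0 /=.
have le (f : bool) (A B C D : R) : 0 < B -> 0 < D -> A / B <= C / D -> A * D <= C * B.
  by move=> B0 D0; rewrite ler_pdivrMr // mulrAC ler_pdivlMr.
have [yx|yx] : (0 < ot v y x) \/ (x = y \/ 0 < ot v x y).
    by have [->|xy] := eqVneq x y; [right; left|case: (ang_total yS xS yv xv); rewrite 1?eq_sym //; auto].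
- have xQ : x \in Q by rewrite mem_filter yx.
  have := max (a, x) _; rewrite /F /= => H.
  have /(le true) : ot v a x / det d (x - a) <= ot v a b / det d (b - a).
    by apply: H; apply/allpairsP; exists (a, x).
  move=> /(_ (den _ _ aP xQ) (den _ _ aP bQ)) H1.
  have ID : - det d (a - v) * ot a b x = ot v a b * det d (x - a) - ot v a x * det d (b - a).
    by rewrite /ot /det !ptE; ring.
  by rewrite -(pmulr_rge0 _ (_ : 0 < - det d (a - v))) ?oppr_gt0 // ID subr_ge0.
- have xP : x \in P by rewrite mem_filter; case: yx => [->|->]; rewrite ?eqxx ?orbT ?xS.
  have := max (x, b) _; rewrite /F /= => H.
  have /(le true) : ot v x b / det d (b - x) <= ot v a b / det d (b - a).
    by apply: H; apply/allpairsP; exists (x, b).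
  move=> /(_ (den _ _ xP bQ) (den _ _ aP bQ)) H1.
  have ID : det d (b - v) * ot a b x = ot v a b * det d (b - x) - ot v x b * det d (b - a).
    by rewrite /ot /det !ptE; ring.
  by rewrite -(pmulr_rge0 _ dB) ID subr_ge0.
Qed.

Fixpoint hchain a s : Prop :=
  if s is b :: s' then [/\ he a b, 0 < ot v a b & hchain b s'] else True.

Lemma chain_exists a b : hv a -> hv b -> 0 < ot v a b -> exists m, hchain a (rcons m b).
Proof.
have [vS _] := hvv.
have [n] := ubnP (size [seq x <- S | 0 < ot v a x]).
elim: n a => [//|n IH] a /ltnSE sz ha hb ab.
have [aS _] := ha; have [bS _] := hb.
have [a' [c [hac a'a ac]]] := bridge aS bS ab.
have [a'S cS a'c hc] := hac.
have Ea : a' = a.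
  case: a'a => // a'a; have [_ _ na] := ang_neq a'a; have [_ _ nc] := ang_neq ac.
  have H := hc a aS; rewrite eq_sym na in H; have H1 := H isT nc.
  have := hv_beyond ha vS a'S cS a'a ac; by rewrite ltNge (ltW H1).
rewrite {a'a a'S}Ea in hac a'c hc.
have [Ecb|cb] := eqVneq c b; first by exists [::]; rewrite /= -Ecb.
have [_ bv nab] := ang_neq ab; have [_ cv nac] := ang_neq ac.
case: (ang_total cS bS cv bv cb) => [lcb|lbc]; last first.
  have H := hc b bS; rewrite eq_sym nab eq_sym cb in H; have H1 := H isT isT.
  have := hv_beyond hb vS aS cS ab lbc; by rewrite ltNge (ltW H1).
have [|m Hm] := IH c _ (he_hv_r hac) hb lcb; last by exists (c :: m).
apply: leq_trans sz; rewrite -(count_predC (fun x => 0 < ot v c x) [seq x <- S | 0 < ot v a x]) -addn1.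
rewrite [size [seq _ <- _ | 0 < ot v c _]]size_filter.
apply: leq_add.
  rewrite count_filter; rewrite leq_eqVlt; apply/orP; left; apply/eqP.
  apply: eq_in_count => x xS /=; apply/idP/andP => [cx|[]//].
  by split=> //; apply: (ang_tr aS cS xS ac cx).
rewrite -has_count; apply/hasP; exists c; first by rewrite mem_filter ac.
by rewrite /= /ot detdd ltxx.
Qed.

Lemma hchain_later a s x : hchain a s -> a \in S -> x \in s -> x \in S /\ 0 < ot v a x.
Proof.
elim: s a => [//|b s IH] a /= [[aS bS _ _] ab H] _; rewrite inE => /orP[/eqP->//|xs].
have [xS bx] := IH b H bS xs; split=> //; exact: (ang_tr aS bS xS ab bx).
Qed.

End Around.

Lemma spath_rcons x s y : spath x s -> tr x s `&` segment (last x s) y `<=` [set last x s] ->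
  spath x (rcons s y).
Proof.
elim: s x => [|z s IH] x /=; first by move=> _ _; split=> // w [].
move=> [H1 H2] H; split; last by apply: IH => // w [w1 w2]; apply: H; split=> //; right.
move=> w [w1]; rewrite tr_rcons => -[w2|w2]; first by apply: H1.
have E : w = last z s by apply: H; split=> //; left.
by apply: H1; split=> //; rewrite E; case: (lastP s) => [|t u]; rewrite ?last_rcons; [exact: tr_head|exact: tr_last].
Qed.

Lemma last_rev_belast a s : last (last a s) (rev (belast a s)) = a.
Proof. by case: s => [//|b s] /=; rewrite rev_cons last_rcons. Qed.

Lemma tr_rev a s : tr (last a s) (rev (belast a s)) = tr a s.
Proof.
elim: s a => [//|b s IH] a /=; rewrite rev_cons tr_rcons IH last_rev_belast.
by rewrite segment_sym setUC.
Qed.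

Lemma hchain_spath v a s : hv v -> a \in S -> hchain v a s ->
  spath (last a s) (rev (belast a s)).
Proof.
move=> hvv; elim: s a => [//|b s IH] a aS /= [[_ bS ab H] lab Hc].
rewrite rev_cons; apply: spath_rcons; first exact: IH.
rewrite tr_rev last_rev_belast => w [w1 w2].
pose h := (a, b - a) : pt * pt.
have hz : hp h w = 0.
  move: w2 => /segmentP[t [_ ->]]; rewrite hp_conv /hp /= subrr det0r detdd; ring.
have := @tr_pos R h b s b _ _ w w1; case.
- by rewrite /hp /= detdd.
- move=> x; rewrite inE => /orP[/eqP->|xs]; first by left.
  have [xS bx] := hchain_later hvv Hc bS xs; right; apply: H => //.
    by have [_ _] := ang_neq (ang_tr hvv aS bS xS lab bx); rewrite eq_sym.
  by have [_ _] := ang_neq bx; rewrite eq_sym.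
- by [].
- by rewrite hz ltxx.
Qed.

End Hull.

(** * Polygons from three sectors *)

Lemma sum3_pos (R : realType) (p q r : R) : p + q + r = 0 -> p < 0 -> r < 0 -> 0 < q.
Proof. lra. Qed.

Lemma sum3_neg (R : realType) (p q r : R) : p + q + r = 0 -> 0 < p -> 0 < q -> r < 0.
Proof. lra. Qed.

Section Roots.
Variable R : realType.
Notation pt := (R * R)%type.
Implicit Types (a b c d e x y z p q u v w : pt) (h : pt * pt) (hs : seq (pt * pt)) (s : seq pt).

Lemma line_through o p z (t : R) : z - o = t *: (p - o) -> z = p + (1 - t) *: (o - p).
Proof.
move=> E; have E1 : z.1 - o.1 = t * (p.1 - o.1) := congr1 fst E.
have E2 : z.2 - o.2 = t * (p.2 - o.2) := congr1 snd E.
rewrite (surjective_pairing z) [RHS]surjective_pairing !ptE.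
by congr (_, _); lra.
Qed.

Lemma ring_assemble v b a s1 s2 s3 (T1 := tr v (rcons s1 b)) (T2 := tr b (rcons s2 a)) (T3 := tr a (rcons s3 v)) :
  spath v (rcons s1 b) -> spath b (rcons s2 a) -> spath a (rcons s3 v) ->
  T1 `&` T2 `<=` [set b] -> T2 `&` T3 `<=` [set a] -> T3 `&` T1 `<=` [set v] ->
  uniq (v :: s1 ++ b :: s2 ++ a :: s3) ->
  simple_polygon (v :: s1 ++ b :: s2 ++ a :: s3) /\
  boundary (v :: s1 ++ b :: s2 ++ a :: s3) `<=` T1 `|` T2 `|` T3.
Proof.
move=> S1 S2 S3 T12 T23 T31 U.
have E1 : rcons (s1 ++ b :: s2) a = rcons s1 b ++ rcons s2 a by rewrite rcons_cat cat_rcons.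
have E2 : s1 ++ b :: s2 ++ a :: s3 = (s1 ++ b :: s2) ++ a :: s3 by rewrite -catA.
have TE : tr v (rcons (s1 ++ b :: s2) a) = T1 `|` T2 by rewrite E1 tr_cat.
rewrite E2 -TE; apply: assemble => //.
- by rewrite E1; apply: spath_cat.
- rewrite TE => w [[w1|w2] w3]; first by left; apply: T31.
  by right; apply: T23.
- by rewrite -E2.
- by rewrite /= !size_cat /=; lia.
Qed.

Variables (S Bl Rd : seq pt).
Hypothesis GP : gpos S.
Hypothesis uBl : uniq Bl.
Hypothesis uRd : uniq Rd.
Hypothesis BS : {subset Bl <= S}.
Hypothesis RS : {subset Rd <= S}.
Hypothesis dBR : forall x, x \in Bl -> x \notin Rd.
Hypothesis hvB : forall w, hv S w -> w \in Bl.

Definition good := exists pol : seq pt,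
  [/\ simple_polygon pol, pol =i Bl & forall r, r \in Rd -> exterior pol r].

Lemma out_line c u (t : R) : hv S c ->
  (forall e, (forall x, x \in S -> x != c -> 0 < det e (x - c)) -> 0 < det e u) -> t < 0 ->
  exists h, (forall w, w \in S -> 0 <= hp h w) /\ hp h (c + t *: u) < 0.
Proof.
move=> [cS [e He]] Hu t0; exists (c, e); split=> [w wS|].
  by have [->|wc] := eqVneq w c; [rewrite /hp subrr det0r|apply: ltW; apply: He].
by rewrite /hp /= addrAC subrr add0r detZr nmulr_rlt0 // Hu.
Qed.

Lemma sub_boundary h pol v b a s1 s2 s3 :
  boundary pol `<=` tr v (rcons s1 b) `|` tr b (rcons s2 a) `|` tr a (rcons s3 v) ->
  {subset v :: s1 ++ b :: s2 ++ a :: s3 <= S} -> (forall w, w \in S -> 0 <= hp h w) ->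
  forall w, boundary pol w -> 0 <= hp h w.
Proof.
move=> Bd sub Hh w /Bd[[]|] Hw; apply: tr_ge0 Hw => x Hx; apply: Hh; apply: sub; move: Hx;
by rewrite !(inE, mem_cat, mem_rcons) => /or3P[] ->; rewrite ?orbT.
Qed.

Lemma sector_hv hs p q (A Rs X : seq pt) : hv S p -> hv S q -> p != q ->
  {subset A <= Bl} -> {subset Rs <= Rd} -> uniq A -> uniq Rs -> uniq X -> {subset X <= A} ->
  (forall y r, y \in X -> r \in Rs -> 0 < ot p y r /\ ot q y r < 0) ->
  clG hs p -> clG hs q -> ~ inG hs p -> ~ inG hs q ->
  (forall h, h \in hs -> 0 < hp h p + hp h q) ->
  (forall x, x \in A -> inG hs x) -> (forall x, x \in Rs -> inG hs x) ->
  ((size Rs).*2.-1 <= size X)%N -> sol hs p q A Rs.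
Proof.
move=> [pS [e He]] [qS _] pq AB RR uA uR uX XA L cp cq nGp nGq J AG RG sz.
apply: (sector (v := p) (g := e) GP _ sz); split; split=> //.
- by move=> x /AB/BS.
- by move=> x /RR/RS.
- by move=> x /AB/dBR; apply: contra => /RR.
- move=> y yX; apply: He; first by apply/BS/AB/XA.
  by apply/eqP => E; apply: nGp; rewrite -E; apply/AG/XA.
- by move=> y r yX rR; have [h1 h2] := L y r yX rR.
Qed.

Lemma hv_S w : hv S w -> w \in S. Proof. by case. Qed.

Section Triple.
Variables (v b a o : pt).
Hypothesis hvv : hv S v.
Hypothesis hvb : hv S b.
Hypothesis hva : hv S a.
Let V x := det (v - o) (x - o).
Let B x := det (b - o) (x - o).
Let A x := det (a - o) (x - o).
Hypothesis bv : 0 < B v.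
Hypothesis ab : 0 < A b.
Hypothesis va : 0 < V a.
Hypothesis genV : forall x, x \in S -> x != v -> V x != 0.
Hypothesis genB : forall x, x \in S -> x != b -> B x != 0.
Hypothesis genA : forall x, x \in S -> x != a -> A x != 0.
Variables (X1 X2 X3 : seq pt).
Hypothesis uX : [/\ uniq X1, uniq X2 & uniq X3].
Hypothesis XB : [/\ {subset X1 <= Bl}, {subset X2 <= Bl} & {subset X3 <= Bl}].
Hypothesis X1s : forall x, x \in X1 -> 0 < B x /\ V x < 0.
Hypothesis X2s : forall x, x \in X2 -> 0 < A x /\ B x < 0.
Hypothesis X3s : forall x, x \in X3 -> 0 < V x /\ A x < 0.
Hypothesis sz : [/\ ((size Rd).*2 <= size X1)%N, ((size Rd).*2 <= size X2)%N & ((size Rd).*2 <= size X3)%N].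
Hypothesis L1 : forall y r, y \in X1 -> r \in Rd -> 0 < B r -> V r < 0 -> 0 < ot v y r /\ ot b y r < 0.
Hypothesis L2 : forall y r, y \in X2 -> r \in Rd -> 0 < A r -> B r < 0 -> 0 < ot b y r /\ ot a y r < 0.
Hypothesis L3 : forall y r, y \in X3 -> r \in Rd -> 0 < V r -> A r < 0 -> 0 < ot a y r /\ ot v y r < 0.

Let hs p q : seq (pt * pt) := [:: (o, q - o); (o, o - p)].

Let inhs p q x : inG (hs p q) x <-> 0 < det (q - o) (x - o) /\ det (p - o) (x - o) < 0.
Proof.
rewrite /hs; split; last first.
  move=> [h1 h2]; apply/in_cut; split=> //; apply/in_cut; split; last by move=> k; rewrite in_nil.
  by rewrite /hp /= -opprB detNl oppr_gt0.
by move=> /in_cut[h1 /in_cut[h2 _]]; split=> //; move: h2; rewrite /hp /= -opprB detNl oppr_gt0.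
Qed.

Let clhs p q x : clG (hs p q) x <-> 0 <= det (q - o) (x - o) /\ det (p - o) (x - o) <= 0.
Proof.
rewrite /hs; split; last first.
  move=> [h1 h2]; apply/cl_cut; split=> //; apply/cl_cut; split; last by move=> k; rewrite in_nil.
  by rewrite /hp /= -opprB detNl oppr_ge0.
by move=> /cl_cut[h1 /cl_cut[h2 _]]; split=> //; move: h2; rewrite /hp /= -opprB detNl oppr_ge0.
Qed.

Let use_sector p q (X : seq pt) : hv S p -> hv S q -> 0 < det (q - o) (p - o) ->
  uniq X -> {subset X <= Bl} -> (forall x, x \in X -> 0 < det (q - o) (x - o) /\ det (p - o) (x - o) < 0) ->
  ((size Rd).*2 <= size X)%N ->
  (forall y r, y \in X -> r \in Rd -> 0 < det (q - o) (r - o) -> det (p - o) (r - o) < 0 -> 0 < ot p y r /\ ot q y r < 0) ->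
  sol (hs p q) p q [seq x <- Bl | (0 < det (q - o) (x - o)) && (det (p - o) (x - o) < 0)]
    [seq x <- Rd | (0 < det (q - o) (x - o)) && (det (p - o) (x - o) < 0)].
Proof.
move=> hvp hvq qp uX' XB' Xs sz' L.
have pq : det (p - o) (q - o) < 0.
  by rewrite (_ : det (p - o) (q - o) = - det (q - o) (p - o)) ?oppr_lt0 // /det; ring.
apply: (@sector_hv _ _ _ _ _ X) => //.
- by apply/eqP => E; move: qp; rewrite E detdd ltxx.
- by move=> x; rewrite mem_filter => /andP[].
- by move=> x; rewrite mem_filter => /andP[].
- exact: filter_uniq.
- exact: filter_uniq.
- by move=> x xX; rewrite mem_filter XB' // andbT; have [-> ->] := Xs x xX.
- by move=> y r yX; rewrite mem_filter => /andP[/andP[h1 h2] rR]; apply: L.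
- by apply/clhs; rewrite detdd lexx; split=> //; exact: ltW.
- by apply/clhs; rewrite detdd lexx; split=> //; exact: ltW.
- by move=> /inhs[_]; rewrite detdd ltxx.
- by move=> /inhs[]; rewrite detdd ltxx.
- move=> h; rewrite !inE => /orP[/eqP->|/eqP->]; rewrite /hp /=.
    by rewrite detdd addr0.
  by rewrite -opprB !detNl detdd oppr0 add0r oppr_gt0.
- by move=> x; rewrite mem_filter => /andP[/andP[h1 h2] _]; apply/inhs.
- by move=> x; rewrite mem_filter => /andP[/andP[h1 h2] _]; apply/inhs.
- by apply: leq_trans sz'; rewrite size_filter (leq_trans (leq_pred _)) // leq_double count_size.
Qed.

Let bary x : A b * V x + B v * A x + V a * B x = 0.
Proof. by rewrite /A /B /V /det !ptE; ring. Qed.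

Let supp c e : (c \in [:: v; b; a]) -> hv S c ->
  (forall x, x \in S -> x != c -> 0 < det e (x - c)) -> 0 < det e (o - c).
Proof.
move=> cin hc He.
have ID : (A b + B v + V a) * det e (o - c) = A b * det e (v - c) + B v * det e (a - c) + V a * det e (b - c).
  by rewrite /A /B /V /det !ptE; ring.
have W : 0 < A b + B v + V a by move: bv ab va; lra.
have nn x : x \in S -> 0 <= det e (x - c).
  by move=> xS; have [->|] := eqVneq x c; [rewrite subrr det0r|move=> /(He _ xS)/ltW].
have vS := hv_S hvv; have bS := hv_S hvb; have aS := hv_S hva.
have m1 := mulr_ge0 (ltW ab) (nn _ vS); have m2 := mulr_ge0 (ltW bv) (nn _ aS).
have m3 := mulr_ge0 (ltW va) (nn _ bS).
have nvb : v != b by apply/eqP => E; move: bv; rewrite /B E detdd ltxx.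
have nab : b != a by apply/eqP => E; move: ab; rewrite /A E detdd ltxx.
have nva : a != v by apply/eqP => E; move: va; rewrite /V E detdd ltxx.
rewrite -(pmulr_rgt0 _ W) ID; move: cin; rewrite !inE => /or3P[] /eqP Ec.
- have : 0 < B v * det e (a - c) by rewrite mulr_gt0 // He // Ec.
  lra.
- have : 0 < A b * det e (v - c) by rewrite mulr_gt0 // He // Ec.
  lra.
- have : 0 < A b * det e (v - c) by rewrite mulr_gt0 // He // Ec eq_sym.
  lra.
Qed.

Let out p q z : (p \in [:: v; b; a]) -> (q \in [:: v; b; a]) -> hv S p -> hv S q -> 0 < det (q - o) (p - o) ->
  clG (hs p q) z -> ~ inG (hs p q) z -> 0 < ot p q z ->
  exists h, (forall w, w \in S -> 0 <= hp h w) /\ hp h z < 0.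
Proof.
move=> pin qin hvp hvq qp /clhs[cz1 cz2] nz ez.
have qo : q - o != 0 by apply/eqP => E; move: qp; rewrite E /det !mul0r subrr ltxx.
have po : p - o != 0 by apply/eqP => E; move: qp; rewrite E det0r ltxx.
have [D1|D1] := ltP 0 (det (q - o) (z - o)).
  have D2 : det (p - o) (z - o) = 0.
    by apply/eqP; rewrite eq_le cz2 /= leNgt; apply/negP => D2; apply: nz; apply/inhs.
  have [t Et] := det_eq0_ray po D2.
  have Ez : z = p + (1 - t) *: (o - p).
    exact: line_through Et.
  rewrite Ez; apply: out_line => //; first by move=> e; apply: supp.
  rewrite subr_lt0; move: ez.
  have -> : ot p q z = (t - 1) * det (q - o) (p - o) by rewrite Ez /ot /det !ptE; ring.
  by rewrite pmulr_lgt0 // subr_gt0.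
have D2 : det (q - o) (z - o) = 0 by apply/eqP; rewrite eq_le cz1 D1.
have [t Et] := det_eq0_ray qo D2.
have Ez : z = q + (1 - t) *: (o - q).
  exact: line_through Et.
rewrite Ez; apply: out_line => //; first by move=> e; apply: supp.
rewrite subr_lt0; move: ez.
have -> : ot p q z = (t - 1) * det (q - o) (p - o) by rewrite Ez /ot /det !ptE; ring.
by rewrite pmulr_lgt0 // subr_gt0.
Qed.

Lemma triple : good.
Proof.
have [u1 u2 u3] := uX; have [XB1 XB2 XB3] := XB; have [sz1 sz2 sz3] := sz.
have [s1 [P1 S1 T1 E1]] := use_sector hvv hvb bv u1 XB1 X1s sz1 L1.
have [s2 [P2 S2 T2 E2]] := use_sector hvb hva ab u2 XB2 X2s sz2 L2.
have [s3 [P3 S3 T3 E3]] := use_sector hva hvv va u3 XB3 X3s sz3 L3.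
have Vv : V v = 0 by rewrite /V detdd.
have Bb : B b = 0 by rewrite /B detdd.
have Aa : A a = 0 by rewrite /A detdd.
have bar x := bary x.
have G1 x : inG (hs v b) x <-> 0 < B x /\ V x < 0 by exact: inhs.
have G2 x : inG (hs b a) x <-> 0 < A x /\ B x < 0 by exact: inhs.
have G3 x : inG (hs a v) x <-> 0 < V x /\ A x < 0 by exact: inhs.
have Av : A v < 0 by move: (va); rewrite (_ : V a = - A v) ?oppr_gt0 // /A /V /det; ring.
have Ba : B a < 0 by move: (ab); rewrite (_ : A b = - B a) ?oppr_gt0 // /A /B /det; ring.
have Vb : V b < 0 by move: (bv); rewrite (_ : B v = - V b) ?oppr_gt0 // /B /V /det; ring.
have n1 x : inG (hs v b) x -> ~ inG (hs b a) x by move=> /G1[h1 h2] /G2[h3 h4]; lra.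
have n2 x : inG (hs b a) x -> ~ inG (hs a v) x by move=> /G2[h1 h2] /G3[h3 h4]; lra.
have n3 x : inG (hs a v) x -> ~ inG (hs v b) x by move=> /G3[h1 h2] /G1[h3 h4]; lra.
have nv : [/\ ~ inG (hs v b) v, ~ inG (hs b a) v & ~ inG (hs a v) v].
  by split; [move=> /G1[]|move=> /G2[]|move=> /G3[]]; lra.
have nb : [/\ ~ inG (hs v b) b, ~ inG (hs b a) b & ~ inG (hs a v) b].
  by split; [move=> /G1[]|move=> /G2[]|move=> /G3[]]; lra.
have na : [/\ ~ inG (hs v b) a, ~ inG (hs b a) a & ~ inG (hs a v) a].
  by split; [move=> /G1[]|move=> /G2[]|move=> /G3[]]; lra.
have [nv1 nv2 nv3] := nv; have [nb1 nb2 nb3] := nb; have [na1 na2 na3] := na.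
have nvb : v != b by apply/eqP => E; move: bv; rewrite E Bb ltxx.
have nba : b != a by apply/eqP => E; move: ab; rewrite E Aa ltxx.
have nav : a != v by apply/eqP => E; move: va; rewrite E Vv ltxx.
have m1 x : x \in s1 = (x \in Bl) && ((0 < B x) && (V x < 0)) by rewrite (perm_mem P1) mem_filter andbC.
have m2 x : x \in s2 = (x \in Bl) && ((0 < A x) && (B x < 0)) by rewrite (perm_mem P2) mem_filter andbC.
have m3 x : x \in s3 = (x \in Bl) && ((0 < V x) && (A x < 0)) by rewrite (perm_mem P3) mem_filter andbC.
have us1 : uniq s1 by rewrite (perm_uniq P1) filter_uniq.
have us2 : uniq s2 by rewrite (perm_uniq P2) filter_uniq.
have us3 : uniq s3 by rewrite (perm_uniq P3) filter_uniq.
have vB := hvB hvv; have bB := hvB hvb; have aB := hvB hva.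
have Upol : uniq (v :: s1 ++ b :: s2 ++ a :: s3).
  rewrite cons_uniq; apply/andP; split.
    rewrite !(mem_cat, inE) m1 m2 m3 Vv !ltxx !andbF (negbTE nvb) eq_sym (negbTE nav) /=.
    by rewrite (lt_gtF Av) !andbF.
  rewrite cat_uniq us1 /=; apply/and3P; split.
  - rewrite negb_or m1 Bb ltxx andbF /=; apply/hasPn => x.
    rewrite mem_cat inE m1 m2 m3 => /or3P[/andP[_ /andP[h1 h2]]|/eqP->|/andP[_ /andP[h1 h2]]].
    + by rewrite (lt_gtF h2) !andbF.
    + by rewrite (lt_gtF Ba) !andbF.
    + by rewrite (lt_gtF h1) !andbF.
  - rewrite mem_cat inE m2 m3 (negbTE nba) Bb ltxx !andbF /=.
    by rewrite (lt_gtF Vb) !andbF.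
  rewrite cat_uniq us2 /= us3 m3 Aa ltxx !andbF /= andbT negb_or m2 Aa ltxx !andbF /=.
  apply/hasPn => x; rewrite m3 m2 => /andP[_ /andP[h1 h2]].
  by rewrite (lt_gtF h2) !andbF.
have [|||simp Bd] := ring_assemble S1 S2 S3 _ _ _ Upol.
- move=> w [/T1 H1 /T2 H2]; case: H1 => [E|//|g1]; case: H2 => [E'|E'|g2] //.
  + by exfalso; move: nav; rewrite -E' E eqxx.
  + by exfalso; rewrite E in g2.
  + by exfalso; rewrite E' in g1.
  + by exfalso; exact: (n1 w).
- move=> w [/T2 H1 /T3 H2]; case: H1 => [E|//|g1]; case: H2 => [E'|E'|g2] //.
  + by exfalso; move: nvb; rewrite -E' E eqxx.
  + by exfalso; rewrite E in g2.
  + by exfalso; rewrite E' in g1.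
  + by exfalso; exact: (n2 w).
- move=> w [/T3 H1 /T1 H2]; case: H1 => [E|//|g1]; case: H2 => [E'|E'|g2] //.
  + by exfalso; move: nba; rewrite -E' E eqxx.
  + by exfalso; rewrite E in g2.
  + by exfalso; rewrite E' in g1.
  + by exfalso; exact: (n3 w).
have posmul (P Q : R) : 0 < P -> 0 < Q -> 0 < P * Q by exact: mulr_gt0.
have negmul (P Q : R) : 0 < P -> Q < 0 -> P * Q < 0 by move=> ? ?; rewrite pmulr_rlt0.
have cover x : x \in S -> x != v -> x != b -> x != a ->
    [\/ 0 < B x /\ V x < 0, 0 < A x /\ B x < 0 | 0 < V x /\ A x < 0].
  move=> xS xv xb xa; have := bar x.
  have := genV xS xv; have := genB xS xb; have := genA xS xa.
  rewrite !neq_lt => /orP[A0|A0] /orP[B0|B0] /orP[V0|V0].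
  - by move=> /sum3_pos/(_ (negmul _ _ ab V0) (negmul _ _ va B0)); rewrite (pmulr_rgt0 _ bv) lt_gtF.
  - by move=> _; apply: Or33.
  - by move=> _; apply: Or31.
  - by move=> _; apply: Or33.
  - by move=> _; apply: Or32.
  - by move=> _; apply: Or32.
  - by move=> _; apply: Or31.
  - by move=> /sum3_neg/(_ (posmul _ _ ab V0) (posmul _ _ bv A0)); rewrite (pmulr_rlt0 _ va) lt_gtF.
exists (v :: s1 ++ b :: s2 ++ a :: s3).
have memB : v :: s1 ++ b :: s2 ++ a :: s3 =i Bl.
  move=> x; rewrite !(mem_cat, inE).
  have [->|xv] := eqVneq x v; first by rewrite vB.
  have [->|xb] := eqVneq x b; first by rewrite bB orbT.
  have [->|xa] := eqVneq x a; first by rewrite aB !orbT.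
  rewrite m1 m2 m3 /=; case xB : (x \in Bl) => //=.
  by have [[-> ->]|[-> ->]|[-> ->]] := cover _ (BS xB) xv xb xa; rewrite ?orbT.
split=> // r rR.
have subS : {subset v :: s1 ++ b :: s2 ++ a :: s3 <= S} by move=> x; rewrite memB => /BS.
have rS := RS rR.
have nrB : r \notin Bl by apply/negP => /dBR; rewrite rR.
have rv : r != v by apply/eqP => E; rewrite E vB in nrB.
have rb : r != b by apply/eqP => E; rewrite E bB in nrB.
have ra : r != a by apply/eqP => E; rewrite E aB in nrB.
have outB hs' p q T : esc hs' p q T r -> boundary (v :: s1 ++ b :: s2 ++ a :: s3) `&` inG hs' `<=` T ->
   (forall z, clG hs' z -> ~ inG hs' z -> 0 < ot p q z -> exists h, (forall w, w \in S -> 0 <= hp h w) /\ hp h z < 0) ->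
   exterior (v :: s1 ++ b :: s2 ++ a :: s3) r.
  move=> esr sub H; apply: (esc_exterior esr sub) => z z1 z2 z3.
  have [h [h1 h2]] := H z z1 z2 z3; exists h; split=> //.
  exact: (sub_boundary Bd subS h1).
case: (cover r rS rv rb ra) => [[h1 h2]|[h1 h2]|[h1 h2]].
- apply: (outB _ _ _ _ (E1 r _)); first by rewrite mem_filter rR -/(B r) -/(V r) h1 h2.
    move=> w [/Bd[[//|/T2]|/T3] H gw]; exfalso; case: H => [E|E|g]; rewrite ?E in gw => //; [exact: (n1 w)|exact: (n3 w)].
  by move=> z; apply: out; rewrite // !inE eqxx ?orbT.
- apply: (outB _ _ _ _ (E2 r _)); first by rewrite mem_filter rR -/(B r) -/(A r) h1 h2.
    move=> w [/Bd[[/T1|//]|/T3] H gw]; exfalso; case: H => [E|E|g]; rewrite ?E in gw => //; [exact: (n1 w)|exact: (n2 w)].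
  by move=> z; apply: out; rewrite // !inE eqxx ?orbT.
- apply: (outB _ _ _ _ (E3 r _)); first by rewrite mem_filter rR -/(A r) -/(V r) h1 h2.
    move=> w [/Bd[[/T1|/T2]|//] H gw]; exfalso; case: H => [E|E|g]; rewrite ?E in gw => //; [exact: (n3 w)|exact: (n2 w)].
  by move=> z; apply: out; rewrite // !inE eqxx ?orbT.
Qed.

End Triple.

End Roots.

(** * Polygons from two sectors and a hull chain *)

Section Spread.
Variable R : realType.
Notation pt := (R * R)%type.
Implicit Types (a b c d e x y z p q u v w : pt) (h : pt * pt) (hs : seq (pt * pt)) (s : seq pt).
Variables (S Bl Rd : seq pt).
Hypothesis GP : gpos S.
Hypothesis uBl : uniq Bl.
Hypothesis uRd : uniq Rd.
Hypothesis BS : {subset Bl <= S}.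
Hypothesis RS : {subset Rd <= S}.
Hypothesis dBR : forall x, x \in Bl -> x \notin Rd.
Hypothesis hvB : forall w, hv S w -> w \in Bl.
Variable v : pt.
Hypothesis hvv : hv S v.

Fixpoint hedges a s : seq (pt * pt) :=
  if s is b :: s' then (a, b - a) :: hedges b s' else [::].

Lemma hedgesP a s h : hchain S v a s -> h \in hedges a s ->
  exists c c', [/\ he S c c', c \in a :: s, c' \in s & h = (c, c' - c)].
Proof.
elim: s a => [//|b s IH] a /= [H _ Hc]; rewrite inE => /orP[/eqP->|hin].
  by exists a, b; rewrite !inE !eqxx.
have [c [c' [h1 h2 h3 h4]]] := IH b Hc hin; exists c, c'; split=> //.
  by rewrite inE h2 orbT.
by rewrite inE h3 orbT.
Qed.

Lemma edge_hedges a s x : hchain S v a s -> s != [::] -> tr a s x ->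
  exists2 h, h \in hedges a s & hp h x = 0.
Proof.
elim: s a => [//|b s IH] a /= [H _ Hc] _ [xs|xs].
  exists (a, b - a); first by rewrite inE eqxx.
  move: xs => /segmentP[t [_ ->]]; rewrite hp_conv /hp /= subrr det0r detdd; ring.
have [E|s0] := eqVneq s [::].
  move: xs; rewrite E /= => ->; exists (a, b - a); first by rewrite inE eqxx.
  by rewrite /hp /= detdd.
have [h h1 h2] := IH b Hc s0 xs; exists h => //.
by rewrite inE h1 orbT.
Qed.

Lemma hchain_hv a s c : hv S a -> hchain S v a s -> c \in a :: s -> hv S c.
Proof.
elim: s a => [|b s IH] a ha /=; first by move=> _; rewrite inE => /eqP->.
move=> [H _ Hc]; rewrite inE => /orP[/eqP->//|]; apply: IH => //.
exact: he_hv_r H.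
Qed.

Lemma hchain_last a s c : a \in S -> hchain S v a s -> c \in a :: s ->
  c = last a s \/ 0 < ot v c (last a s).
Proof.
elim: s a c => [|b s IH] a c aS /=; first by move=> _; rewrite inE => /eqP->; left.
move=> [[_ bS _ _] ab Hc]; rewrite inE => /orP[/eqP->|cs]; last exact: IH.
have lS : last b s \in S.
  have : last b s \in b :: s by rewrite mem_last.
  rewrite inE => /orP[/eqP->//|ls]; by have [] := hchain_later hvv Hc bS ls.
right; case: (IH b b bS Hc (mem_head b s)) => [<-//|bl].
exact: (ang_tr hvv aS bS lS ab bl).
Qed.

Lemma hchain_uniq a s : a \in S -> hchain S v a s -> uniq (a :: s).
Proof.
elim: s a => [//|b s IH] a aS Hc; rewrite cons_uniq; apply/andP; split.
  apply/negP => ain; have [_ ] := hchain_later hvv Hc aS ain.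
  by rewrite /ot detdd ltxx.
by case: Hc => [[_ bS _ _] _ Hc]; apply: IH.
Qed.

Variables (a b dl : pt) (m : seq pt).
Hypothesis hva : hv S a.
Hypothesis hvb : hv S b.
Hypothesis ab : 0 < ot v a b.
Hypothesis chain : hchain S v a (rcons m b).
Let side x := det dl (x - v).
Hypothesis sa : side a < 0.
Hypothesis sb : 0 < side b.
Hypothesis gen : forall x, x \in S -> x != v -> side x != 0.
Hypothesis dlsupp : forall e, (forall x, x \in S -> x != v -> 0 < det e (x - v)) -> 0 < det e dl.
Variables (XR XL : seq pt).
Hypothesis uXR : uniq XR.
Hypothesis uXL : uniq XL.
Hypothesis XRP : forall y, y \in XR -> [/\ y \in Bl, ~ hv S y, 0 < side y & 0 < ot v y b].
Hypothesis XLP : forall y, y \in XL -> [/\ y \in Bl, ~ hv S y, side y < 0 & 0 < ot v a y].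
Hypothesis RR : forall r, r \in Rd -> 0 < side r -> 0 < ot v b r.
Hypothesis RL : forall r, r \in Rd -> side r < 0 -> 0 < ot v r a.
Hypothesis szR : ((size Rd).*2 <= size XR)%N.
Hypothesis szL : ((size Rd).*2 <= size XL)%N.

Let C := a :: rcons m b.
Let E := hedges a (rcons m b).
Let aS := hv_S hva.
Let bS := hv_S hvb.
Let vS := hv_S hvv.

Let Chv c : c \in C -> hv S c. Proof. exact: hchain_hv. Qed.

Let Cneq c : c \in C -> v != c.
Proof.
rewrite inE => /orP[/eqP->|cin].
  by have [+ _ _] := ang_neq ab; rewrite eq_sym.
by have [_ H] := hchain_later hvv chain aS cin; have [_ + _] := ang_neq H; rewrite eq_sym.
Qed.

Let Ca c : c \in C -> c = a \/ 0 < ot v a c.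
Proof.
rewrite inE => /orP[/eqP->|cin]; first by left.
by right; have [_] := hchain_later hvv chain aS cin.
Qed.

Let Cb c : c \in C -> c = b \/ 0 < ot v c b.
Proof. by move=> /(hchain_last aS chain); rewrite last_rcons. Qed.

Let EP h : h \in E -> exists c c', [/\ he S c c', c \in C, c' \in C & h = (c, c' - c)].
Proof.
move=> /(hedgesP chain)[c [c' [h1 h2 h3 h4]]]; exists c, c'; split=> //.
by rewrite inE h3 orbT.
Qed.

Let Epos h x : h \in E -> x \in S -> x \notin C -> 0 < hp h x.
Proof.
move=> /EP[c [c' [[_ _ _ H] cC c'C ->]]] xS xC; apply: H => //.
  by apply: contra xC => /eqP->.
by apply: contra xC => /eqP->.
Qed.

Let Ege0 h x : h \in E -> x \in S -> 0 <= hp h x.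
Proof.
move=> /EP[c [c' [[_ _ _ H] cC c'C ->]]] xS.
have [->|xc] := eqVneq x c; first by rewrite /hp subrr det0r.
have [->|xc'] := eqVneq x c'; first by rewrite /hp detdd.
by apply: ltW; apply: H.
Qed.

Let vnC : v \notin C. Proof. by apply/negP => /Cneq; rewrite eqxx. Qed.

Let Ea : exists2 h, h \in E & hp h a = 0.
Proof.
rewrite /E; case: (m) => [|c m'] /=; [exists (a, b - a)|exists (a, c - a)];
 by rewrite ?inE ?eqxx // /hp /= subrr det0r.
Qed.

Let Eb : exists2 h, h \in E & hp h b = 0.
Proof. by apply: edge_hedges chain _ (tr_last _ _ _); case: (m). Qed.

Let ER := (v, dl) :: E.
Let EL := (v, - dl) :: E.

Let inER x : inG ER x <-> 0 < side x /\ inG E x. Proof. exact: in_cut. Qed.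
Let inEL x : inG EL x <-> side x < 0 /\ inG E x.
Proof. rewrite /EL; split=> [/in_cut|[h1 h2]]; last apply/in_cut; rewrite /hp /= detNl oppr_gt0 //. Qed.
Let clER x : clG ER x <-> 0 <= side x /\ clG E x. Proof. exact: cl_cut. Qed.
Let clEL x : clG EL x <-> side x <= 0 /\ clG E x.
Proof. rewrite /EL; split=> [/cl_cut|[h1 h2]]; last apply/cl_cut; rewrite /hp /= detNl oppr_ge0 //. Qed.

Let sv : side v = 0. Proof. by rewrite /side subrr det0r. Qed.
Let nEa : ~ inG E a. Proof. by have [h h1 h2] := Ea => /(_ h h1); rewrite h2 ltxx. Qed.
Let nEb : ~ inG E b. Proof. by have [h h1 h2] := Eb => /(_ h h1); rewrite h2 ltxx. Qed.
Let clS x : x \in S -> clG E x. Proof. by move=> xS h hin; apply: Ege0. Qed.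
Let inS x : x \in S -> x \notin C -> inG E x. Proof. by move=> xS xC h hin; apply: Epos. Qed.
Let RC r : r \in Rd -> r \notin C.
Proof. by move=> rR; apply/negP => /Chv/hvB/dBR; rewrite rR. Qed.
Let nhvC y : ~ hv S y -> y \notin C. Proof. by move=> H; apply/negP => /Chv. Qed.

Let AR := [seq x <- Bl | (0 < side x) && (x \notin C)].
Let AL := [seq x <- Bl | (side x < 0) && (x \notin C)].

Let solR : sol ER v b AR [seq r <- Rd | 0 < side r].
Proof.
have [_ bv nvb] := ang_neq ab.
apply: (sector_hv GP BS RS dBR (X := XR)) => //.
- by rewrite eq_sym.
- by move=> x; rewrite mem_filter => /andP[].
- by move=> x; rewrite mem_filter => /andP[].
- exact: filter_uniq.
- exact: filter_uniq.
- by move=> x /XRP[xB /nhvC xC sx _]; rewrite mem_filter sx xC xB.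
- move=> y r /XRP[yB ny sy yb]; rewrite mem_filter => /andP[sr rR].
  have yS := BS yB; have rS := RS rR; have br := RR rR sr.
  split; first exact: (ang_tr hvv yS bS rS yb br).
  have := hv_beyond hvb vS yS rS yb br.
  by rewrite (_ : ot b y r = ot y r b) // /ot /det !ptE; ring.
- by apply/clER; rewrite sv lexx; split=> //; exact: clS.
- by apply/clER; split; [exact: ltW|exact: clS].
- by move=> /inER[]; rewrite sv ltxx.
- by move=> /inER[_ /nEb].
- move=> h; rewrite inE => /orP[/eqP->|hE]; first by rewrite /hp /= subrr det0r add0r.
  by rewrite ltr_pwDl ?Epos ?Ege0.
- by move=> x; rewrite mem_filter => /andP[/andP[sx xC] xB]; apply/inER; split=> //; apply: inS => //; exact: BS.
- by move=> x; rewrite mem_filter => /andP[sx xR]; apply/inER; split=> //; apply: inS; [exact: RS|exact: RC].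
- by apply: leq_trans szR; rewrite size_filter (leq_trans (leq_pred _)) // leq_double count_size.
Qed.

Let solL : sol EL a v AL [seq r <- Rd | side r < 0].
Proof.
have [av bv nvb] := ang_neq ab.
apply: (sector_hv GP BS RS dBR (X := XL)) => //.
- by move=> x; rewrite mem_filter => /andP[].
- by move=> x; rewrite mem_filter => /andP[].
- exact: filter_uniq.
- exact: filter_uniq.
- by move=> x /XLP[xB /nhvC xC sx _]; rewrite mem_filter sx xC xB.
- move=> y r /XLP[yB ny sy ay]; rewrite mem_filter => /andP[sr rR].
  have yS := BS yB; have rS := RS rR; have ra := RL rR sr.
  split; last by rewrite ot_anti oppr_lt0; exact: (ang_tr hvv rS aS yS ra ay).
  have := hv_beyond hva vS rS yS ra ay.
  by rewrite (_ : ot a y r = - ot r y a) ?oppr_gt0 // /ot /det !ptE; ring.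
- by apply/clEL; split; [exact: ltW|exact: clS].
- by apply/clEL; rewrite sv lexx; split=> //; exact: clS.
- by move=> /inEL[_ /nEa].
- by move=> /inEL[]; rewrite sv ltxx.
- move=> h; rewrite inE => /orP[/eqP->|hE].
    by rewrite /hp /= !detNl subrr det0r oppr0 addr0 oppr_gt0.
  by rewrite ltr_wpDl ?Epos ?Ege0.
- by move=> x; rewrite mem_filter => /andP[/andP[sx xC] xB]; apply/inEL; split=> //; apply: inS => //; exact: BS.
- by move=> x; rewrite mem_filter => /andP[sx xR]; apply/inEL; split=> //; apply: inS; [exact: RS|exact: RC].
- by apply: leq_trans szL; rewrite size_filter (leq_trans (leq_pred _)) // leq_double count_size.
Qed.

(* An exit point on the line of a hull edge cannot lie on the edge itself. *)
Let outE (l : pt -> R) z h :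
  (forall c c' (t : R), l (c + t *: (c' - c)) = (1 - t) * l c + t * l c') ->
  (forall c, c \in C -> l c <= 0) -> 0 < l z -> h \in E -> hp h z = 0 ->
  exists h', (forall w, w \in S -> 0 <= hp h' w) /\ hp h' z < 0.
Proof.
move=> aff lC lz /EP[c [c' [[cS c'S cc' _] cC c'C ->]]] hz.
have d0 : c' - c != 0 by rewrite subr_eq0 eq_sym.
have [t Et] := det_eq0_ray d0 hz.
have Ez : z = c + t *: (c' - c) by rewrite -Et addrC subrK.
have [t0|t0] := ltP t 0.
  rewrite Ez; apply: out_line => //; first exact: Chv.
  by move=> e He; apply: He => //; rewrite eq_sym.
have [t1|t1] := ltP 1 t.
  have -> : z = c' + (1 - t) *: (c - c').
    by rewrite Ez (surjective_pairing (_ + _)) [RHS]surjective_pairing !ptE; congr (_, _); lra.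
  apply: out_line; [exact: Chv| |by rewrite subr_lt0].
  by move=> e He; apply: He.
move: lz; rewrite Ez aff.
have : 0 <= (1 - t) * - l c by rewrite mulr_ge0 ?subr_ge0 // oppr_ge0 lC.
have : 0 <= t * - l c' by rewrite mulr_ge0 // oppr_ge0 lC.
lra.
Qed.

Let dn0 : dl != 0.
Proof. by apply/eqP => E0; move: sb; rewrite /side E0 /det !mul0r subrr ltxx. Qed.

Lemma spread : good Bl Rd.
Proof.
have [s1 [P1 S1 T1 E1]] := solR; have [s3 [P3 S3 T3 E3]] := solL.
have [av bv nab] := ang_neq ab.
have S2 : spath b (rcons (rev m) a).
  have := hchain_spath hvv aS chain; by rewrite last_rcons belast_rcons rev_cons.
have T2 : tr b (rcons (rev m) a) = tr a (rcons m b).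
  by rewrite -[RHS]tr_rev last_rcons belast_rcons rev_cons.
have T2E w : tr b (rcons (rev m) a) w -> ~ inG E w.
  rewrite T2 => /(edge_hedges chain)[|h h1 h2]; first by case: (m).
  by move=> /(_ h h1); rewrite h2 ltxx.
have Ev : inG E v by exact: inS.
have m1 x : x \in s1 = [&& x \in Bl, 0 < side x & x \notin C].
  by rewrite (perm_mem P1) mem_filter andbC.
have m3 x : x \in s3 = [&& x \in Bl, side x < 0 & x \notin C].
  by rewrite (perm_mem P3) mem_filter andbC.
have us1 : uniq s1 by rewrite (perm_uniq P1) filter_uniq.
have us3 : uniq s3 by rewrite (perm_uniq P3) filter_uniq.
have uC : uniq C := hchain_uniq aS chain.
have mC x : x \in C = [|| x == b, x \in rev m | x == a].
  by rewrite inE mem_rcons inE mem_rev; case: (x == a); case: (x == b); rewrite ?orbT ?orbF.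
have vB := hvB hvv.
have Upol : uniq (v :: s1 ++ b :: rev m ++ a :: s3).
  have pe : perm_eq (v :: s1 ++ b :: rev m ++ a :: s3) (v :: C ++ s1 ++ s3).
    rewrite perm_cons; apply: (@perm_trans _ (s1 ++ C ++ s3)); last by rewrite perm_catCA.
    rewrite perm_cat2l -cat_cons -[a :: s3]cat1s catA perm_cat2r.
    have -> : (b :: rev m) ++ [:: a] = rev C by rewrite /C rev_cons rev_rcons cats1.
    by rewrite perm_rev.
  rewrite (perm_uniq pe) cons_uniq !cat_uniq uC us1 us3 !mem_cat !m1 !m3 sv !ltxx !andbF !orbF (negbTE vnC) /= andbT.
  apply/andP; split; apply/hasPn => x.
    by rewrite mem_cat m1 m3 => /orP[] /and3P[].
  by rewrite m3 m1 => /and3P[_ h _]; rewrite (lt_gtF h) andbF.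
have nRL w : inG ER w -> ~ inG EL w by move=> /inER[h1 _] /inEL[/(lt_trans h1)]; rewrite ltxx.
have [|||simp Bd] := ring_assemble S1 S2 S3 _ _ _ Upol.
- move=> w [/T1 H1 H2]; case: H1 => [Ew|//|/inER[_ g]]; exfalso.
    by apply: (T2E w H2); rewrite Ew.
  exact: (T2E w H2).
- move=> w [H2 /T3 H1]; case: H1 => [//|Ew|/inEL[_ g]]; exfalso.
    by apply: (T2E w H2); rewrite Ew.
  exact: (T2E w H2).
- move=> w [/T3 H1 /T1 H2]; case: H1 => [Ew|//|g1]; case: H2 => [//|Ew'|g2] //; exfalso.
  + by move: nab; rewrite -Ew Ew' eqxx.
  + by move: g2 => /inER[_]; rewrite Ew.
  + by move: g1 => /inEL[_]; rewrite Ew'.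
  + exact: (nRL w).
exists (v :: s1 ++ b :: rev m ++ a :: s3).
have memB : v :: s1 ++ b :: rev m ++ a :: s3 =i Bl.
  move=> x; rewrite !(mem_cat, inE) m1 m3.
  have [->|xv] := eqVneq x v; first by rewrite vB.
  have [xC|xC] := boolP (x \in C).
    rewrite (hvB (Chv xC)) /= !andbF /= orbF; move: xC; rewrite mC.
    by case: (x == b); case: (x == a); rewrite ?orbT ?orbF // => ->.
  move: (xC); rewrite mC => /norP[/negbTE-> /norP[/negbTE-> /negbTE->]] /=; rewrite !andbT.
  case xB : (x \in Bl) => //=.
  by have := gen (BS xB) xv; rewrite neq_lt => /orP[] ->; rewrite ?orbT.
split=> // r rR.
have subS : {subset v :: s1 ++ b :: rev m ++ a :: s3 <= S} by move=> x; rewrite memB => /BS.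
have rS := RS rR.
have nrB : r \notin Bl by apply/negP => /dBR; rewrite rR.
have rv : r != v by apply/eqP => Er; rewrite Er vB in nrB.
have outB hs' p q T : esc hs' p q T r -> boundary (v :: s1 ++ b :: rev m ++ a :: s3) `&` inG hs' `<=` T ->
   (forall z, clG hs' z -> ~ inG hs' z -> 0 < ot p q z -> exists h, (forall w, w \in S -> 0 <= hp h w) /\ hp h z < 0) ->
   exterior (v :: s1 ++ b :: rev m ++ a :: s3) r.
  move=> esr sub H; apply: (esc_exterior esr sub) => z z1 z2 z3.
  have [h [h1 h2]] := H z z1 z2 z3; exists h; split=> //.
  exact: (sub_boundary Bd subS h1).
have nonpos z : clG E z -> ~ inG E z -> exists2 h, h \in E & hp h z = 0.
  move=> cz nz; apply: contrapT => H; apply: nz => h hE.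
  rewrite lt_def cz // andbT; apply/eqP => hz; apply: H; by exists h.
have onL z : side z = 0 -> exists t : R, z = v + t *: dl.
  by move=> /(det_eq0_ray dn0)[t Et]; exists t; rewrite -Et addrC subrK.
have affR c c' (t : R) : ot v b (c + t *: (c' - c)) = (1 - t) * ot v b c + t * ot v b c'.
  by rewrite /ot /det !ptE; ring.
have affL c c' (t : R) : ot a v (c + t *: (c' - c)) = (1 - t) * ot a v c + t * ot a v c'.
  by rewrite /ot /det !ptE; ring.
have := gen rS rv; rewrite neq_lt => /orP[sr|sr].
- apply: (outB _ _ _ _ (E3 r _)); first by rewrite mem_filter sr rR.
    move=> w [/Bd[[/T1 H|/T2E H]|//] gw]; exfalso; last by apply: H; case/inEL: gw.
    by case: H => [Ew|Ew|g]; rewrite ?Ew in gw; [move: gw => /inEL[]; rewrite sv ltxx|move: gw => /inEL[_ /nEb]|exact: (nRL w)].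
  move=> z /clEL[c1 c2] nz ez.
  have [c3|c3] := ltP (side z) 0.
    have [|h hE hz] := nonpos z c2; first by move=> g; apply: nz; apply/inEL.
    apply: (outE affL _ ez hE hz) => c cC.
    have -> : ot a v c = - ot v a c by rewrite /ot /det !ptE; ring.
    by rewrite oppr_le0; case: (Ca cC) => [->|/ltW//]; rewrite /ot detdd.
  have sz0 : side z = 0 by apply/eqP; rewrite eq_le c1.
  have [t Et] := onL z sz0; rewrite Et; apply: out_line => //.
  move: ez; have -> : ot a v z = t * side a by rewrite Et /ot /side /det !ptE; ring.
  by rewrite nmulr_lgt0.
- apply: (outB _ _ _ _ (E1 r _)); first by rewrite mem_filter sr rR.
    move=> w [/Bd[[//|/T2E H]|/T3 H] gw]; exfalso; first by apply: H; case/inER: gw.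
    by case: H => [Ew|Ew|g]; rewrite ?Ew in gw; [move: gw => /inER[_ /nEa]|move: gw => /inER[]; rewrite sv ltxx|exact: (nRL w)].
  move=> z /clER[c1 c2] nz ez.
  have [c3|c3] := ltP 0 (side z).
    have [|h hE hz] := nonpos z c2; first by move=> g; apply: nz; apply/inER.
    apply: (outE affR _ ez hE hz) => c cC.
    case: (Cb cC) => [->|H]; first by rewrite /ot detdd.
    by rewrite ot_anti oppr_le0 ltW.
  have sz0 : side z = 0 by apply/eqP; rewrite eq_le c1 c3.
  have [t Et] := onL z sz0; rewrite Et; apply: out_line => //.
  move: ez; have -> : ot v b z = - (t * side b) by rewrite Et /ot /side /det !ptE; ring.
  by rewrite oppr_gt0 pmulr_llt0.
Qed.

End Spread.

(** * Selecting points *)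

Lemma kth_split (R : realType) (T : eqType) (F : T -> R) (s : seq T) k : (k < size s)%N ->
  exists y L Rr, [/\ perm_eq s (L ++ y :: Rr), size L = k,
    forall x, x \in L -> F x <= F y & forall x, x \in Rr -> F y <= F x].
Proof.
pose r x y := F x <= F y.
have rt : transitive r by move=> y x z; exact: le_trans.
have rT : total r by move=> x y; exact: le_total.
case: s => [//|y0 s'] ks; set s := y0 :: s' in ks *.
have := sort_sorted rT s; rewrite sorted_pairwise // => Hs.
have ps : perm_eq s (sort r s) by rewrite perm_sym perm_sort.
have kt : (k < size (sort r s))%N by rewrite size_sort.
move: Hs ps; rewrite -{1 2}(cat_take_drop k (sort r s)) (drop_nth y0 kt) pairwise_cat /=.
move=> /and3P[/allrelP h1 _ /andP[/allP h2 _]] ps.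
exists (nth y0 (sort r s) k), (take k (sort r s)), (drop k.+1 (sort r s)).
split=> //; first by rewrite size_take kt.
by move=> x xL; apply: h1 => //; rewrite mem_head.
Qed.

Lemma pigeon (T : eqType) (f : T -> nat) l (s : seq T) : (forall x, x \in s -> (f x <= l)%N) ->
  exists k, (size s <= l.+1 * size [seq x <- s | f x == k])%N.
Proof.
elim: l s => [|l IH] s H.
  exists 0%N; rewrite (_ : [seq x <- s | f x == 0%N] = s) ?mul1n //.
  by apply/all_filterP/allP => x /H; rewrite leqn0.
have [|h] := leqP (size s) (l.+2 * size [seq x <- s | f x == l.+1]); first by exists l.+1.
have [|k Hk] := IH [seq x <- s | f x != l.+1].
  by move=> x; rewrite mem_filter => /andP[fx /H]; rewrite leq_eqVlt (negbTE fx).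
exists k; have := count_predC (fun x => f x == l.+1) s.
rewrite -!size_filter /= => E.
have : (size [seq x <- [seq x <- s | f x != l.+1] | f x == k] <= size [seq x <- s | f x == k])%N.
  by rewrite -filter_predI !size_filter; apply: sub_count => x /= /andP[].
rewrite [[seq x <- s | predC _ x]](_ : _ = [seq x <- s | f x != l.+1]) // in E.
move: h Hk E; set n := size s; set c := size [seq x <- s | f x == k].
set n1 := size [seq x <- s | f x == _]; set n2 := size [seq x <- s | _ != _].
set c' := size [seq x <- _ | _] => h Hk E cc'; rewrite leqNgt; apply/negP => Hc.
have h1 : (l.+2 * n2 <= l.+2 * (l.+1 * c))%N by rewrite leq_mul2l (leq_trans Hk) // leq_mul2l cc' orbT.
have h2 : (l.+1 * (l.+2 * c) < l.+1 * n)%N by rewrite ltn_mul2l.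
have h3 : (l.+2 * n1 + l.+2 * n2 = l.+2 * n)%N by rewrite -mulnDr E.
have h4 : (l.+2 * n = l.+1 * n + n)%N by rewrite mulSn addnC.
have h5 : (l.+1 * (l.+2 * c) = l.+2 * (l.+1 * c))%N by rewrite mulnCA.
by move: h h1 h2 h3 h4 h5; clear; lia.
Qed.

Lemma count_le (T : eqType) (P Q : pred T) (s : seq T) :
  {in s, forall t, Q t -> P t} -> (count Q s <= count P s)%N.
Proof.
elim: s => [//|t s IH] sub /=; rewrite leq_add //; last first.
  by apply: IH => t' ts; apply: sub; rewrite inE ts orbT.
by have := sub t (mem_head _ _); case: (Q t) => // ->.
Qed.

Lemma count_lt (T : eqType) (P Q : pred T) (s : seq T) (r : T) :
  {in s, forall t, Q t -> P t} -> r \in s -> P r -> ~~ Q r -> (count Q s < count P s)%N.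
Proof.
move=> sub rs Pr Qr; rewrite !(permP (perm_to_rem rs)) /= Pr (negbTE Qr) add0n add1n ltnS.
by apply: count_le => t /mem_rem; exact: sub.
Qed.

Section Select.
Variable R : realType.
Notation pt := (R * R)%type.
Implicit Types (a b c d e f x y z p q u v w r : pt) (h : pt * pt) (hs : seq (pt * pt)) (s Q Y : seq pt).
Variables (S Bl Rd : seq pt).
Hypothesis GP : gpos S.
Hypothesis uBl : uniq Bl.
Hypothesis uRd : uniq Rd.
Hypothesis BS : {subset Bl <= S}.
Hypothesis RS : {subset Rd <= S}.
Hypothesis dBR : forall x, x \in Bl -> x \notin Rd.
Hypothesis hvB : forall w, hv S w -> w \in Bl.

Definition inner Y := uniq Y /\ forall y, y \in Y -> y \in Bl /\ ~ hv S y.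

Lemma inner_sub Y Q : inner Y -> uniq Q -> {subset Q <= Y} -> inner Q.
Proof. by move=> [_ H] uQ QY; split=> // y /QY/H. Qed.

Lemma innerP Y y w : inner Y -> y \in Y -> hv S w -> [/\ y \in S, y \in Bl & y != w].
Proof.
by move=> [_ H] /H[yB nh] hw; split=> //; [exact: BS|apply/eqP => E; rewrite E in nh].
Qed.

Lemma redP r w : r \in Rd -> hv S w -> r \in S /\ r != w.
Proof.
by move=> rR hw; split; [exact: RS|apply/eqP => E; have := dBR (hvB hw); rewrite -E rR].
Qed.

Lemma ang_split v Y k : hv S v -> inner Y -> (k < size Y)%N -> exists y L Rr,
  [/\ perm_eq Y (L ++ y :: Rr), size L = k, forall x, x \in L -> 0 < ot v x y &
    forall x, x \in Rr -> 0 < ot v y x].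
Proof.
move=> hvv IY kY; have [vS [e He]] := hvv.
pose f : pt := (- e.2, e.1).
have [y [L [Rr [pY sL HL HR]]]] := kth_split (fun x => det f (x - v) / det e (x - v)) kY.
have uY : uniq (L ++ y :: Rr) by rewrite -(perm_uniq pY); case: IY.
have mY x : x \in L ++ y :: Rr -> x \in S /\ x != v.
  by rewrite -(perm_mem pY) => /(innerP IY)/(_ hvv)[].
have key x z : x \in L ++ y :: Rr -> z \in L ++ y :: Rr -> x != z ->
    det f (x - v) / det e (x - v) <= det f (z - v) / det e (z - v) -> 0 < ot v x z.
  move=> /mY[xS xv] /mY[zS zv] xz.
  have ex : 0 < det e (x - v) by exact: He.
  have ez : 0 < det e (z - v) by exact: He.
  have ef : 0 <= det e f by rewrite /det /f /=; nra.
  rewrite ler_pdivrMr // mulrAC ler_pdivlMr // => key.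
  have ID : det f (z - v) * det e (x - v) - det f (x - v) * det e (z - v) = det e f * ot v x z.
    by rewrite /ot /det !ptE; ring.
  have [//|H] := ang_total GP hvv xS zS xv zv xz.
  have ef0 : det e f = 0.
    apply/eqP; rewrite eq_le ef andbT leNgt; apply/negP => ef1.
    have : 0 < det e f * ot v z x by exact: mulr_gt0.
    by rewrite ot_anti mulrN -ID; lra.
  have [h1 h2] : e.1 = 0 /\ e.2 = 0.
    have E : e.1 ^+ 2 + e.2 ^+ 2 = 0 by move: ef0; rewrite /det /f /= => <-; ring.
    by split; apply/eqP; rewrite -sqrf_eq0 eq_le sqr_ge0 andbT -E ?lerDl ?lerDr sqr_ge0.
  by move: ex; rewrite (pt0 h1 h2) /det /= !mul0r subrr ltxx.
have yin : y \in L ++ y :: Rr by rewrite mem_cat mem_head orbT.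
exists y, L, Rr; split=> // x xin; have xin' : x \in L ++ y :: Rr by rewrite mem_cat ?inE xin ?orbT.
- apply: key => //; last exact: HL.
  move: uY; rewrite cat_uniq /= => /and3P[_ /norP[yL _] _]; by apply: contraNneq yL => <-.
- apply: key => //; last exact: HR.
  move: uY; rewrite cat_uniq /= => /and3P[_ _ /andP[yR _]]; by apply: contraNneq yR => ->.
Qed.

Lemma median_dir v y x0 : hv S v -> y \in S -> x0 \in S -> 0 < ot v y x0 ->
  exists d, [/\ forall e, (forall x, x \in S -> x != v -> 0 < det e (x - v)) -> 0 < det e d,
    forall x, x \in S -> x = y \/ 0 < ot v x y -> det d (x - v) < 0 &
    forall x, x \in S -> 0 < ot v y x -> 0 < det d (x - v)].
Proof.
move=> hvv yS x0S yx0; have [yv x0v _] := ang_neq yx0.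
have u0 : y - v != 0 by rewrite subr_eq0.
have [d ud Hd] := generic_dir [seq x - v | x <- S] u0.
have dR x : x \in S -> 0 < ot v y x -> 0 < det d (x - v).
  move=> xS yx; have [_ xv _] := ang_neq yx.
  have [||_ H _] := Hd (x - v); [by apply/mapP; exists x|by rewrite subr_eq0|exact: H].
have dy : det d (y - v) < 0.
  by rewrite (_ : det d (y - v) = - det (y - v) d) ?oppr_lt0 // /det; ring.
exists d; split=> //.
  move=> e He; have ey := He y yS yv; have ex := He x0 x0S x0v; have dx := dR x0 x0S yx0.
  have ID : det e d * ot v y x0 = det e (y - v) * det d (x0 - v) + det e (x0 - v) * - det d (y - v).
    by rewrite /ot /det !ptE; ring.
  have H : 0 < det e d * ot v y x0 by rewrite ID addr_gt0 // mulr_gt0 // oppr_gt0.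
  by move: H; rewrite pmulr_lgt0.
move=> x xS [->//|xy]; have [xv _ _] := ang_neq xy.
have [||_ _ H] := Hd (x - v); [by apply/mapP; exists x|by rewrite subr_eq0|apply: H].
by move: xy; rewrite ot_anti oppr_gt0.
Qed.

Definition same w Q := forall y y' r, y \in Q -> y' \in Q -> r \in Rd -> 0 < ot w y r -> 0 < ot w y' r.

Lemma same_sub w Y Q : same w Y -> {subset Q <= Y} -> same w Q.
Proof. by move=> H QY y y' r /QY h1 /QY h2; apply: H. Qed.

Lemma same_neg w Q y y' r : hv S w -> inner Q -> same w Q -> y \in Q -> y' \in Q -> r \in Rd ->
  ot w y r < 0 -> ot w y' r < 0.
Proof.
move=> hw IQ sQ yQ y'Q rR h; have [y'S y'B y'w] := innerP IQ y'Q hw; have [rS rw] := redP rR hw.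
have [|H|H] := @ang_total _ S GP w hw y' r y'S rS y'w rw.
- by apply/eqP => E; have := dBR y'B; rewrite E rR.
- by have := lt_trans h (sQ _ _ _ y'Q yQ rR H); rewrite ltxx.
- by rewrite ot_anti oppr_lt0.
Qed.

Lemma same_exists w Y : hv S w -> inner Y ->
  exists Q, [/\ inner Q, {subset Q <= Y}, same w Q & (size Y <= (size Rd).+1 * size Q)%N].
Proof.
move=> hw IY; pose f y := count (fun r => 0 < ot w y r) Rd.
have [y _|k Hk] := pigeon (f := f) (l := size Rd) (s := Y); first exact: count_size.
exists [seq y <- Y | f y == k]; split=> //.
- apply: (inner_sub IY); first by apply: filter_uniq; case: IY.
  by move=> x; rewrite mem_filter => /andP[].
- by move=> x; rewrite mem_filter => /andP[].
move=> y y' r; rewrite !mem_filter => /andP[/eqP fy yY] /andP[/eqP fy' y'Y] rR yr.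
have [yS _ yw] := innerP IY yY hw; have [y'S _ y'w] := innerP IY y'Y hw.
have [rS rw] := redP rR hw.
have [<-//|yy'] := eqVneq y y'.
have [H|H] := ang_total GP hw yS y'S yw y'w yy'; last exact: (ang_tr hw y'S yS rS H yr).
have sub : {in Rd, forall t, 0 < ot w y' t -> 0 < ot w y t}.
  by move=> t tR; apply: (ang_tr hw yS y'S (RS tR) H).
have E : count (fun r => 0 < ot w y r) Rd = count (fun r => 0 < ot w y' r) Rd by rewrite -/(f y) -/(f y') fy fy'.
apply: contrapT => /negP nr; have := count_lt sub rR yr nr.
by rewrite E ltnn.
Qed.

Lemma triangle_side v a b d y : 0 < ot v a b -> 0 < ot v a y -> 0 < ot v y b -> 0 < ot a b y ->
  det d (a - v) < 0 -> 0 < det d (b - v) ->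
  [/\ 0 < det d (b - v) - det d (y - v), det d (a - v) - det d (y - v) < 0,
  ot v y b * (det d (b - v) - det d (a - v)) < ot v a b * (det d (b - v) - det d (y - v)) &
  ot v a y * (det d (b - v) - det d (a - v)) < ot v a b * (det d (y - v) - det d (a - v))].
Proof.
move=> ab ay yb aby sa sb; pose side x := det d (x - v).
have I1 : ot v a b * (side b - side y) = ot v y b * (side b - side a) + ot a b y * side b.
  by rewrite /side /ot /det !ptE; ring.
have I2 : ot v a b * (side y - side a) = ot v a y * (side b - side a) + ot a b y * - side a.
  by rewrite /side /ot /det !ptE; ring.
have h0 : 0 < side b - side a by rewrite subr_gt0 (lt_trans sa sb).
have p1 : 0 < ot v y b * (side b - side a) by exact: mulr_gt0.
have p2 : 0 < ot a b y * side b by exact: mulr_gt0.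
have p3 : 0 < ot v a y * (side b - side a) by exact: mulr_gt0.
have p4 : 0 < ot a b y * - side a by rewrite mulr_gt0 // oppr_gt0.
split.
- by rewrite -(pmulr_rgt0 _ ab) I1 addr_gt0.
- by rewrite -oppr_gt0 opprB -(pmulr_rgt0 _ ab) I2 addr_gt0.
- by rewrite I1 ltrDl.
- by rewrite I2 ltrDl.
Qed.

Section TripleAt.
Variables (v a b d ym : pt) (Q X1 X2 X3 : seq pt) (lam0 : R).
Hypothesis hvv : hv S v.
Hypothesis hab : he S a b.
Hypothesis ab : 0 < ot v a b.
Hypothesis IQ : inner Q.
Hypothesis sQ : [/\ same v Q, same a Q & same b Q].
Hypothesis Qab : forall y, y \in Q -> 0 < ot v a y /\ 0 < ot v y b.
Hypothesis ymQ : ym \in Q.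
Let side x := det d (x - v).
Hypothesis side_l : forall x, x \in S -> x = ym \/ 0 < ot v x ym -> side x < 0.
Hypothesis side_r : forall x, x \in S -> 0 < ot v ym x -> 0 < side x.
Let B0 x := ot v b x + lam0 * (side b - side x).
Let A0 x := ot v a x + lam0 * (side a - side x).
Hypothesis lam0_ge0 : 0 <= lam0.
Hypothesis uX : [/\ uniq X1, uniq X2 & uniq X3].
Hypothesis XQ : [/\ {subset X1 <= Q}, {subset X2 <= Q} & {subset X3 <= Q}].
Hypothesis X1P : forall x, x \in X1 -> 0 < side x /\ 0 <= B0 x.
Hypothesis X2P : forall x, x \in X2 -> 0 < side x /\ B0 x < 0 \/ side x < 0 /\ 0 < A0 x.
Hypothesis X3P : forall x, x \in X3 -> side x < 0 /\ A0 x <= 0.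
Hypothesis sz : [/\ ((size Rd).*2 <= size X1)%N, ((size Rd).*2 <= size X2)%N & ((size Rd).*2 <= size X3)%N].
Hypothesis Rd0 : (0 < size Rd)%N.

Let hva := he_hv_l hab.
Let hvb := he_hv_r hab.
Let aS := hv_S hva.
Let bS := hv_S hvb.
Let vS := hv_S hvv.

Let sa : side a < 0.
Proof.
by apply: side_l => //; right; have [] := Qab ymQ.
Qed.

Let sb : 0 < side b.
Proof. by apply: side_r => //; have [] := Qab ymQ. Qed.

Let gen x : x \in S -> x != v -> side x != 0.
Proof.
have [ymS _ ymv] := innerP IQ ymQ hvv => xS xv.
have [->|xy] := eqVneq x ym; first by rewrite lt_eqF // side_l //; left.
have [H|H] := ang_total GP hvv xS ymS xv ymv xy.
  by rewrite lt_eqF // side_l //; right.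
by rewrite gt_eqF // side_r.
Qed.

Let barQ y : y \in Q -> [/\ 0 < side b - side y, side a - side y < 0,
  ot v y b * (side b - side a) < ot v a b * (side b - side y) &
  ot v a y * (side b - side a) < ot v a b * (side y - side a)].
Proof.
move=> yQ; have [yS yB yv] := innerP IQ yQ hvv; have [ay yb] := Qab yQ.
have [_ _ ya] := innerP IQ yQ hva; have [_ _ yb'] := innerP IQ yQ hvb.
have [_ _ _ /(_ y yS ya yb') aby] := hab.
exact: triangle_side.
Qed.

Let inX2 : exists2 x, x \in X2 & x \in Q.
Proof.
have [_ + _] := sz; have [_ + _] := XQ; case: (X2) => [|x s] sub.
  by rewrite leqn0 double_eq0 => /eqP E; move: Rd0; rewrite E.
by move=> _; exists x; [|apply: sub]; exact: mem_head.
Qed.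

Let inX1 : exists2 x, x \in X1 & x \in Q.
Proof.
have [+ _ _] := sz; have [+ _ _] := XQ; case: (X1) => [|x s] sub.
  by rewrite leqn0 double_eq0 => /eqP E; move: Rd0; rewrite E.
by move=> _; exists x; [|apply: sub]; exact: mem_head.
Qed.

Let inX3 : exists2 x, x \in X3 & x \in Q.
Proof.
have [_ _ +] := sz; have [_ _ +] := XQ; case: (X3) => [|x s] sub.
  by rewrite leqn0 double_eq0 => /eqP E; move: Rd0; rewrite E.
by move=> _; exists x; [|apply: sub]; exact: mem_head.
Qed.

Let A0b : 0 < A0 b.
Proof.
have h0 : 0 < side b - side a by rewrite subr_gt0 (lt_trans sa sb).
have [x xX2 xQ] := inX2; have [s1 s2 i1 i2] := barQ xQ.
rewrite /A0 -opprB mulrN subr_gt0.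
case: (X2P xX2) => [[sx Bx]|[sx Ax]].
  rewrite -(ltr_pM2r s1); apply: le_lt_trans i1; rewrite mulrAC ler_pM2r //.
  by move: Bx; rewrite /B0 ot_anti addrC subr_lt0 => /ltW.
have s2' : 0 < side x - side a by rewrite -oppr_lt0 opprB.
rewrite -(ltr_pM2r s2'); apply: le_lt_trans i2; rewrite mulrAC ler_pM2r //.
by move: Ax; rewrite /A0 -[side a - _]opprB mulrN subr_gt0 => /ltW.
Qed.

Let across w o e x r : 0 < det e (o - w) -> 0 < det e (x - w) -> 0 < det e (r - w) ->
  0 < det (w - o) (x - o) -> det (w - o) (r - o) < 0 -> 0 < ot w x r.
Proof.
move=> h1 h2 h3 h4 h5; apply: (ang_trans h2 h1 h3).
  by move: h4; congr (0 < _); rewrite /ot /det !ptE; ring.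
by move: h5; rewrite -oppr_gt0; congr (0 < _); rewrite /ot /det !ptE; ring.
Qed.

Lemma triple_at : good Bl Rd.
Proof.
have [e e0 He] := small_eps ([seq (B0 x, side b - side x) | x <- S] ++ [seq (A0 x, side a - side x) | x <- S]).
pose lam := lam0 + e; have lam_gt0 : 0 < lam by rewrite /lam ltr_wpDl.
pose o := v + lam *: d.
pose V x := det (v - o) (x - o).
pose B x := det (b - o) (x - o).
pose A x := det (a - o) (x - o).
have VE x : V x = - (lam * side x) by rewrite /V /o /side /det !ptE; ring.
have BE x : B x = B0 x + e * (side b - side x) by rewrite /B /o /lam /B0 /side /ot /det !ptE; ring.
have AE x : A x = A0 x + e * (side a - side x) by rewrite /A /o /lam /A0 /side /ot /det !ptE; ring.
have keepB x : x \in S -> (0 < B0 x -> 0 < B x) /\ (B0 x < 0 -> B x < 0).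
  by move=> xS; rewrite BE; apply: He; rewrite mem_cat; apply/orP; left; apply/mapP; exists x.
have keepA x : x \in S -> (0 < A0 x -> 0 < A x) /\ (A0 x < 0 -> A x < 0).
  by move=> xS; rewrite AE; apply: He; rewrite mem_cat; apply/orP; right; apply/mapP; exists x.
have sv : side v = 0 by rewrite /side subrr det0r.
have Bv : 0 < B v.
  by rewrite (_ : B v = lam * side b) ?mulr_gt0 // /B /o /side /det !ptE; ring.
have Va : 0 < V a by rewrite VE oppr_gt0 pmulr_rlt0.
have Ab : 0 < A b by have [H _] := keepA b bS; exact: H.
have bary x : A b * V x + B v * A x + V a * B x = 0.
  by rewrite /A /B /V /det !ptE; ring.
have Vneg x : 0 < side x -> V x < 0 by move=> sx; rewrite VE oppr_lt0 mulr_gt0.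
have Vpos x : side x < 0 -> 0 < V x by move=> sx; rewrite VE oppr_gt0 pmulr_rlt0.
have [uX1 uX2 uX3] := uX; have [XQ1 XQ2 XQ3] := XQ.
have QS y : y \in Q -> y \in S by move=> yQ; have [] := innerP IQ yQ hvv.
have QB y : y \in Q -> y \in Bl by move=> yQ; have [] := innerP IQ yQ hvv.
have X1s x : x \in X1 -> 0 < B x /\ V x < 0.
  move=> xX; have [sx Bx] := X1P xX; have [s1 _ _ _] := barQ (XQ1 _ xX); split; last exact: Vneg.
  by rewrite BE ltr_wpDl // mulr_gt0.
have X3s x : x \in X3 -> 0 < V x /\ A x < 0.
  move=> xX; have [sx Ax] := X3P xX; have [_ s1 _ _] := barQ (XQ3 _ xX); split; first exact: Vpos.
  by rewrite AE ltr_wnDl // pmulr_rlt0.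
have X2s x : x \in X2 -> 0 < A x /\ B x < 0.
  move=> xX; have xS := QS _ (XQ2 _ xX); have := bary x.
  case: (X2P xX) => -[sx H] E.
    have Bx : B x < 0 by have [_ H'] := keepB x xS; exact: H'.
    split=> //; rewrite -(pmulr_rgt0 _ Bv).
    apply: (sum3_pos E); first by rewrite pmulr_rlt0 // Vneg.
    by rewrite pmulr_rlt0.
  have Ax : 0 < A x by have [H' _] := keepA x xS; exact: H'.
  split=> //; rewrite -(pmulr_rlt0 _ Va).
  by apply: (sum3_neg E); rewrite mulr_gt0 // Vpos.
have genV x : x \in S -> x != v -> V x != 0.
  by move=> xS xv; rewrite VE oppr_eq0 mulf_neq0 ?gen // gt_eqF.
have gen_aux c x (al be : R) : c \in S -> c != v -> side c != 0 -> x \in S -> x != c ->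
    al = ot v c x + lam0 * be -> be = side c - side x ->
    (0 < al -> 0 < al + e * be) -> (al < 0 -> al + e * be < 0) -> al + e * be != 0.
  move=> cS cv sc xS xc alE beE h1 h2; have [al0|] := eqVneq al 0; last first.
    by rewrite neq_lt => /orP[/h2 H|/h1 H]; [rewrite lt_eqF|rewrite gt_eqF].
  rewrite al0 add0r mulf_neq0 // ?(gt_eqF e0) //; apply/eqP => be0.
  move: alE; rewrite al0 be0 mulr0 addr0 => /esym.
  have [xv|xv] := eqVneq x v; first by move: beE; rewrite be0 xv sv subr0 => E; rewrite -E eqxx in sc.
  by apply/eqP/GP => //; rewrite eq_sym.
have bv : b != v by have [_ + _] := ang_neq ab.
have av : a != v by have [+ _ _] := ang_neq ab.
have genB x : x \in S -> x != b -> B x != 0.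
  move=> xS xb; rewrite BE; have [k1 k2] := keepB x xS; rewrite BE in k1 k2.
  by apply: (gen_aux b x) => //; rewrite gt_eqF.
have genA x : x \in S -> x != a -> A x != 0.
  move=> xS xa; rewrite AE; have [k1 k2] := keepA x xS; rewrite AE in k1 k2.
  by apply: (gen_aux a x) => //; rewrite lt_eqF.
have supp w (l1 l2 : R) p q : hv S w -> p \in S -> q \in S -> p != w -> q != w -> 0 < l1 -> 0 < l2 ->
    (A b + B v + V a) *: (o - w) = l1 *: (p - w) + l2 *: (q - w) ->
    exists e', 0 < det e' (o - w) /\ forall x, x \in S -> x != w -> 0 < det e' (x - w).
  move=> [wS [e' He']] pS qS pw qw l1p l2p E; exists e'; split=> //.
  have s0 : 0 < A b + B v + V a by rewrite addr_gt0 // addr_gt0.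
  have : 0 < l1 * det e' (p - w) + l2 * det e' (q - w) by rewrite addr_gt0 // mulr_gt0 // He'.
  rewrite (_ : l1 * _ + _ = det e' (l1 *: (p - w) + l2 *: (q - w))); last by rewrite /det !ptE; ring.
  by rewrite -E detZr pmulr_rgt0.
have [ea [oa Ha]] : exists e', 0 < det e' (o - a) /\ forall x, x \in S -> x != a -> 0 < det e' (x - a).
  apply: (supp a (A b) (V a) v b); rewrite // 1?eq_sym //; first by have [_ _] := ang_neq ab.
  rewrite (surjective_pairing (_ *: _)) [RHS]surjective_pairing /A /B /V /det !ptE; congr (_, _); ring.
have [eb [ob Hb]] : exists e', 0 < det e' (o - b) /\ forall x, x \in S -> x != b -> 0 < det e' (x - b).
  apply: (supp b (A b) (B v) v a); rewrite // 1?eq_sym //; first by rewrite eq_sym; have [_ _] := ang_neq ab.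
  rewrite (surjective_pairing (_ *: _)) [RHS]surjective_pairing /A /B /V /det !ptE; congr (_, _); ring.
have [sv' sa' sb'] := sQ; have [ymS _ ymv] := innerP IQ ymQ hvv.
have ym_r r : r \in Rd -> [/\ r \in S, r != v, r != a, r != b & r != ym].
  move=> rR; have [h1 h2] := redP rR hvv; have [_ h3] := redP rR hva; have [_ h4] := redP rR hvb.
  by split=> //; apply/eqP => E; have := dBR (QB _ ymQ); rewrite -E rR.
have acr_a x r : x \in Q -> r \in Rd -> 0 < A x -> A r < 0 -> 0 < ot a x r.
  move=> xQ rR; have [xS _ xa] := innerP IQ xQ hva; have [rS _ ra _ _] := ym_r r rR.
  by apply: across oa _ _; apply: Ha.
have acr_a' x r : x \in Q -> r \in Rd -> A x < 0 -> 0 < A r -> ot a x r < 0.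
  move=> xQ rR h1 h2; have [xS _ xa] := innerP IQ xQ hva; have [rS _ ra _ _] := ym_r r rR.
  by rewrite ot_anti oppr_lt0; apply: across oa _ _ h2 h1; apply: Ha.
have acr_b x r : x \in Q -> r \in Rd -> 0 < B x -> B r < 0 -> 0 < ot b x r.
  move=> xQ rR; have [xS _ xb] := innerP IQ xQ hvb; have [rS _ _ rb _] := ym_r r rR.
  by apply: across ob _ _; apply: Hb.
have acr_b' x r : x \in Q -> r \in Rd -> B x < 0 -> 0 < B r -> ot b x r < 0.
  move=> xQ rR h1 h2; have [xS _ xb] := innerP IQ xQ hvb; have [rS _ _ rb _] := ym_r r rR.
  by rewrite ot_anti oppr_lt0; apply: across ob _ _ h2 h1; apply: Hb.
have [x1 x1X x1Q] := inX1; have [x2 x2X x2Q] := inX2; have [x3 x3X x3Q] := inX3.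
have [x1B _] := X1s _ x1X; have [x2A x2B] := X2s _ x2X; have [_ x3A] := X3s _ x3X.
apply: (triple GP uBl uRd BS RS dBR hvB hvv hvb hva Bv Ab Va genV genB genA (X1 := X1) (X2 := X2) (X3 := X3)) => //.
- by split=> x; [move=> /XQ1|move=> /XQ2|move=> /XQ3]; exact: QB.
- move=> y r yX rR rB rV; have yQ := XQ1 _ yX; have [rS rv _ _ rym] := ym_r r rR; split.
    apply: (sv' ym) => //; case: (ang_total GP hvv ymS rS ymv rv) => // [|H]; first by rewrite eq_sym.
    by have := Vpos r (side_l rS (or_intror H)) => /(lt_trans rV); rewrite ltxx.
  by apply: (same_neg hvb IQ sb' x2Q yQ rR); exact: acr_b'.
- move=> y r yX rR rA rB; have yQ := XQ2 _ yX; split.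
    by apply: (sb' x1) => //; exact: acr_b.
  by apply: (same_neg hva IQ sa' x3Q yQ rR); exact: acr_a'.
- move=> y r yX rR rV rA; have yQ := XQ3 _ yX; have [rS rv _ _ rym] := ym_r r rR; split.
    by apply: (sa' x2) => //; exact: acr_a.
  apply: (same_neg hvv IQ sv' ymQ yQ rR); rewrite ot_anti oppr_lt0.
  case: (ang_total GP hvv ymS rS ymv rv) => // [|H]; first by rewrite eq_sym.
  by have := Vneg r (side_r rS H) => /(lt_trans rV); rewrite ltxx.
Qed.

End TripleAt.

(* The parameter at which [v + t *: d] reaches the line through [c] and [y]. *)
Definition thr v d c y := ot v c y / (det d (y - v) - det d (c - v)).

Lemma thr_neq v d c y z : c \in S -> y \in S -> z \in S -> y != c -> z != c -> y != z ->
  det d (c - v) != 0 -> det d (y - v) - det d (c - v) != 0 -> det d (z - v) - det d (c - v) != 0 ->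
  thr v d c y != thr v d c z.
Proof.
move=> cS yS zS yc zc yz sc Dy Dz; rewrite /thr eqr_div // -subr_eq0.
rewrite (_ : _ - _ = - (det d (c - v) * ot c y z)); last by rewrite /ot /det !ptE; ring.
by rewrite oppr_eq0 mulf_neq0 //; apply: GP => //; rewrite eq_sym.
Qed.

Lemma triple_select v a b F : hv S v -> he S a b -> 0 < ot v a b -> inner F -> same v F ->
  (forall y, y \in F -> 0 < ot v a y /\ 0 < ot v y b) -> (0 < size Rd)%N ->
  (8 * size Rd * (size Rd).+1 ^ 2 <= size F)%N -> good Bl Rd.
Proof.
move=> hvv hab ab IF sF Fab l0 szF.
have hva := he_hv_l hab; have hvb := he_hv_r hab.
have [Q1 [IQ1 Q1F sa1 sz1]] := same_exists hva IF.
have [Q [IQ QQ1 sb sz2]] := same_exists hvb IQ1.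
have QF : {subset Q <= F} by move=> x /QQ1/Q1F.
have sv := same_sub sF QF; have sa := same_sub sa1 QQ1.
have Qab y : y \in Q -> 0 < ot v a y /\ 0 < ot v y b by move=> /QF/Fab.
have szQ : (8 * size Rd <= size Q)%N.
  have h : (size F <= (size Rd).+1 ^ 2 * size Q)%N.
    by rewrite (leq_trans sz1) // expnS expn1 -mulnA leq_mul2l sz2 orbT.
  by have := leq_trans szF h; rewrite mulnC leq_pmul2l // expn_gt0.
set l := size Rd in l0 szQ *.
have [|ym [L [Rr [pQ szL HL HR]]]] := ang_split (k := (4 * l).-1) hvv IQ.
  by move: l0 szQ; clear; lia.
have szR : (4 * l <= size Rr)%N.
  by move: (perm_size pQ) szQ l0 szL; rewrite size_cat /=; clear; lia.
have inQ x : x \in L ++ ym :: Rr -> x \in Q by rewrite (perm_mem pQ).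
have QS y : y \in Q -> y \in S by move=> yQ; have [] := innerP IQ yQ hvv.
have [x0 x0R] : exists x0, x0 \in Rr.
  case: (Rr) szR => [|x s] /= h; last by exists x; exact: mem_head.
  by move: h l0; clear; lia.
have ymQ : ym \in Q by apply: inQ; rewrite mem_cat mem_head orbT.
have x0Q : x0 \in Q by apply: inQ; rewrite mem_cat inE x0R !orbT.
have [d [_ dl dr]] := median_dir hvv (QS _ ymQ) (QS _ x0Q) (HR _ x0R).
pose side x := det d (x - v).
have aS := hv_S hva; have bS := hv_S hvb.
have s_a : side a < 0 by apply: dl => //; right; have [] := Qab ym ymQ.
have s_b : 0 < side b by apply: dr => //; have [] := Qab ym ymQ.
have tri y : y \in Q -> 0 < side b - side y /\ 0 < side y - side a.
  move=> yQ; have [yS _ ya] := innerP IQ yQ hva; have [_ _ yb] := innerP IQ yQ hvb.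
  have [_ _ _ /(_ y yS ya yb) aby] := hab; have [ay yb'] := Qab y yQ.
  by have [h1 h2 _ _] := triangle_side ab ay yb' aby s_a s_b; split; rewrite // -oppr_lt0 opprB.
have szL' : size (ym :: L) = (4 * l)%N by rewrite /= szL prednK // muln_gt0.
have [|yR [LR [RR [pR szLR HLR HRR]]]] := kth_split (thr v d b) (s := Rr) (k := l.*2.-1).
  by apply: leq_trans szR; move: l0; rewrite -addnn; clear; lia.
have [|yL [LL [RL [pL szLL HLL HRL]]]] := kth_split (thr v d a) (s := ym :: L) (k := l.*2.-1).
  by rewrite szL'; move: l0; rewrite -addnn; clear; lia.
have szX1 : size (yR :: LR) = l.*2 by rewrite /= szLR prednK // double_gt0.
have szX3 : size (yL :: LL) = l.*2 by rewrite /= szLL prednK // double_gt0.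
have szRR : (l.*2 <= size RR)%N.
  have := perm_size pR; rewrite size_cat /= szLR => E; move: szR l0.
  by rewrite E -addnn; clear; lia.
have szRL : (l.*2 <= size RL)%N.
  have := perm_size pL; rewrite size_cat /= szLL => E; move: szL' l0.
  by rewrite [size _]E -addnn; clear; lia.
have uQ : uniq (L ++ ym :: Rr) by rewrite -(perm_uniq pQ); case: IQ.
have uRr : uniq (LR ++ yR :: RR).
  by rewrite -(perm_uniq pR); move: uQ; rewrite cat_uniq cons_uniq => /and3P[_ _ /andP[]].
have uLl : uniq (LL ++ yL :: RL).
  rewrite -(perm_uniq pL); move: uQ; rewrite cat_uniq cons_uniq /= => /and3P[-> /norP[-> _] _] //.
have memR x : x \in LR ++ yR :: RR -> x \in Q /\ 0 < side x.
  rewrite -(perm_mem pR) => xR; have xQ : x \in Q by apply: inQ; rewrite mem_cat inE xR !orbT.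
  by split=> //; apply: dr; [exact: QS|exact: HR].
have memL x : x \in LL ++ yL :: RL -> x \in Q /\ side x < 0.
  rewrite -(perm_mem pL) inE => /orP[/eqP->|xL].
    by split=> //; apply: dl; [exact: QS|left].
  have xQ : x \in Q by apply: inQ; rewrite mem_cat xL.
  by split=> //; apply: dl; [exact: QS|right; exact: HL].
have X1m x : x \in yR :: LR -> x \in LR ++ yR :: RR by rewrite mem_cat !inE => /orP[] ->; rewrite ?orbT.
have X3m x : x \in yL :: LL -> x \in LL ++ yL :: RL by rewrite mem_cat !inE => /orP[] ->; rewrite ?orbT.
have RRm x : x \in RR -> x \in LR ++ yR :: RR by rewrite mem_cat !inE => ->; rewrite !orbT.
have RLm x : x \in RL -> x \in LL ++ yL :: RL by rewrite mem_cat !inE => ->; rewrite !orbT.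
have uX1 : uniq (yR :: LR).
  by move: uRr; rewrite cat_uniq /= => /and3P[-> /norP[-> _] _].
have uX3 : uniq (yL :: LL).
  by move: uLl; rewrite cat_uniq /= => /and3P[-> /norP[-> _] _].
have [yRR uRR] : yR \notin RR /\ uniq RR.
  by move: uRr; rewrite cat_uniq /= => /and3P[_ _ /andP[]].
have [yRL uRL] : yL \notin RL /\ uniq RL.
  by move: uLl; rewrite cat_uniq /= => /and3P[_ _ /andP[]].
have X1t x : x \in yR :: LR -> thr v d b x <= thr v d b yR by rewrite inE => /orP[/eqP->//|/HLR].
have X3t x : x \in yL :: LL -> thr v d a x <= thr v d a yL by rewrite inE => /orP[/eqP->//|/HLL].
have RRt x : x \in RR -> thr v d b yR < thr v d b x.
  move=> xR; have [yQ _] := memR yR (X1m _ (mem_head _ _)); have [xQ _] := memR x (RRm _ xR).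
  have [yS _ yb] := innerP IQ yQ hvb; have [xS _ xb] := innerP IQ xQ hvb.
  rewrite lt_def HRR // andbT; apply: thr_neq => //.
  - by apply: contraNneq yRR => <-.
  - by rewrite gt_eqF.
  - by have [h _] := tri x xQ; rewrite lt_eqF // -oppr_gt0 opprB.
  - by have [h _] := tri yR yQ; rewrite lt_eqF // -oppr_gt0 opprB.
have RLt x : x \in RL -> thr v d a yL < thr v d a x.
  move=> xR; have [yQ _] := memL yL (X3m _ (mem_head _ _)); have [xQ _] := memL x (RLm _ xR).
  have [yS _ yb] := innerP IQ yQ hva; have [xS _ xb] := innerP IQ xQ hva.
  rewrite lt_def HRL // andbT; apply: thr_neq => //.
  - by apply: contraNneq yRL => <-.
  - by rewrite lt_eqF.
  - by have [_ h] := tri x xQ; rewrite gt_eqF.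
  - by have [_ h] := tri yL yQ; rewrite gt_eqF.
have tB y (lam : R) : y \in Q -> (thr v d b y <= lam) = (0 <= ot v b y + lam * (side b - side y)).
  move=> /tri[h _]; rewrite /thr -opprB invrN mulrN -mulNr ler_pdivrMr // -/(side b) -/(side y).
  by rewrite -subr_ge0 opprK addrC.
have tA y (lam : R) : y \in Q -> (thr v d a y <= lam) = (ot v a y + lam * (side a - side y) <= 0).
  move=> /tri[_ h]; rewrite /thr ler_pdivrMr // -subr_le0 -/(side a) -/(side y).
  by rewrite -mulrN opprB.
have tpos y : y \in Q -> 0 <= thr v d a y.
  move=> yQ; have [_ h] := tri y yQ; have [h' _] := Qab y yQ.
  by apply: divr_ge0; exact: ltW.
have lam_pos : 0 <= Num.max (thr v d b yR) (thr v d a yL).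
  by rewrite le_max tpos ?orbT //; have [] := memL yL (X3m _ (mem_head _ _)).
have subX1 : {subset yR :: LR <= Q} by move=> x /X1m/memR[].
have subX3 : {subset yL :: LL <= Q} by move=> x /X3m/memL[].
have P1 x : x \in yR :: LR -> 0 < side x /\
    0 <= ot v b x + Num.max (thr v d b yR) (thr v d a yL) * (side b - side x).
  move=> xX; have [xQ sx] := memR x (X1m _ xX); split=> //.
  by rewrite -tB // le_max X1t.
have P3 x : x \in yL :: LL -> side x < 0 /\
    ot v a x + Num.max (thr v d b yR) (thr v d a yL) * (side a - side x) <= 0.
  move=> xX; have [xQ sx] := memL x (X3m _ xX); split=> //.
  by rewrite -tA // le_max X3t ?orbT.
have [h|h] := leP (thr v d a yL) (thr v d b yR).
  apply: (triple_at hvv hab ab IQ (And3 sv sa sb) Qab ymQ dl dr lam_pos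
     (X1 := yR :: LR) (X2 := RR) (X3 := yL :: LL)); rewrite -/l ?szX1 ?szX3 //.
  - by split=> // x /RRm/memR[].
  - move=> x xX; have [xQ sx] := memR x (RRm _ xX); left; split=> //.
    by rewrite ltNge -tB // -ltNge max_l // RRt.
apply: (triple_at hvv hab ab IQ (And3 sv sa sb) Qab ymQ dl dr lam_pos
   (X1 := yR :: LR) (X2 := RL) (X3 := yL :: LL)); rewrite -/l ?szX1 ?szX3 //.
- by split=> // x /RLm/memL[].
- move=> x xX; have [xQ sx] := memL x (RLm _ xX); right; split=> //.
  by rewrite ltNge -tA // -ltNge max_r ?ltW // RLt.
Qed.

End Select.

Lemma size_cover (T : eqType) (p q r : pred T) (s : seq T) :
  (forall x, x \in s -> [|| p x, q x | r x]) ->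
  (size s <= size (seq.filter p s) + size (seq.filter q s) + size (seq.filter r s))%N.
Proof.
rewrite !size_filter; elim: s => [//|x s IH] H /=.
have := H x (mem_head _ _); have /IH : forall y, y \in s -> [|| p y, q y | r y].
  by move=> y ys; apply: H; rewrite inE ys orbT.
by case: (p x); case: (q x); case: (r x) => //=; lia.
Qed.

Section Selection.
Variable R : realType.
Notation pt := (R * R)%type.
Implicit Types (a b c d e x y z u v w r : pt) (s Y : seq pt).
Variables (S Bl Rd : seq pt).
Hypothesis GP : gpos S.
Hypothesis uBl : uniq Bl.
Hypothesis uRd : uniq Rd.
Hypothesis BS : {subset Bl <= S}.
Hypothesis RS : {subset Rd <= S}.
Hypothesis dBR : forall x, x \in Bl -> x \notin Rd.
Hypothesis hvB : forall w, hv S w -> w \in Bl.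
Let l := size Rd.
Let T := (8 * l * l.+1 ^ 2)%N.

Lemma wedge v a b Y U y1 y2 : hv S v -> hv S a -> hv S b -> inner S Bl Y -> same Rd v Y ->
  y1 \in Y -> y2 \in Y -> 0 < ot v y1 a -> 0 < ot v b y2 ->
  uniq U -> {subset U <= Y} -> (forall y, y \in U -> 0 < ot v a y /\ 0 < ot v y b) ->
  (0 < l)%N -> (4 * l <= size U)%N -> good Bl Rd.
Proof.
move=> hvv hva hvb IY sY y1Y y2Y y1a by2 uU UY Uab l0 szU.
have IU := inner_sub IY uU UY.
have aS := hv_S hva; have bS := hv_S hvb.
have [|ym [L [Rr [pU szL HL HR]]]] := ang_split GP BS (k := l.*2.-1) hvv IU.
  by apply: leq_trans szU; move: l0; rewrite -addnn; clear; lia.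
have szR : (l.*2 <= size Rr)%N.
  have := perm_size pU; rewrite size_cat /= szL => E; move: szU l0.
  by rewrite E -addnn; clear; lia.
have [x0 x0R] : exists x0, x0 \in Rr.
  case: (Rr) szR => [|x s] /= h; last by exists x; exact: mem_head.
  by move: h l0; rewrite -addnn; clear; lia.
have inU x : x \in L ++ ym :: Rr -> x \in U by rewrite (perm_mem pU).
have ymU : ym \in U by apply: inU; rewrite mem_cat mem_head orbT.
have RU x : x \in Rr -> x \in U by move=> xR; apply: inU; rewrite mem_cat inE xR !orbT.
have LU x : x \in ym :: L -> x \in U.
  by move=> xL; apply: inU; move: xL; rewrite mem_cat !inE => /orP[] ->; rewrite ?orbT.
have US x : x \in U -> [/\ x \in S, x \in Bl & ~ hv S x].
  by move=> xU; case: IU => _ /(_ x xU)[xB nx]; split=> //; exact: BS.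
have [ymS ymB _] := US _ ymU; have [x0S _ _] := US _ (RU _ x0R).
have [d [dsupp dl dr]] := median_dir hvv ymS x0S (HR _ x0R).
have [aym ymb] := Uab _ ymU.
have ab : 0 < ot v a b := ang_tr hvv aS ymS bS aym ymb.
have [m chain] := chain_exists GP hvv hva hvb ab.
have [_ ymv _] := ang_neq aym.
have redm r : r \in Rd -> 0 < ot v ym r \/ 0 < ot v r ym.
  move=> rR; have [rS rv] := redP RS dBR hvB rR hvv; apply: (ang_total GP hvv) => //.
  by apply: contraTneq rR => <-; exact: dBR.
have [y2S _ _] := innerP BS IY y2Y hvv; have [y1S _ _] := innerP BS IY y1Y hvv.
have uLR : uniq (L ++ ym :: Rr) by rewrite -(perm_uniq pU).
apply: (spread GP uBl uRd BS RS dBR hvB hvv hva hvb ab chain (dl := d) _ _ _ dsupp (XR := Rr) (XL := ym :: L)) => //.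
- by apply: dl => //; right.
- by apply: dr.
- move=> x xS xv; have [->|xy] := eqVneq x ym; first by rewrite lt_eqF // dl //; left.
  have [H|H] := ang_total GP hvv xS ymS xv ymv xy.
    by rewrite lt_eqF // dl //; right.
  by rewrite gt_eqF // dr.
- by move: uLR; rewrite cat_uniq /= => /and3P[_ _ /andP[]].
- by move: uLR; rewrite cat_uniq /= => /and3P[-> /norP[-> _] _].
- move=> y yR; have [yS yB ny] := US _ (RU _ yR); have [_ yb] := Uab _ (RU _ yR); split=> //.
  by apply: dr => //; exact: HR.
- move=> y yL; have [yS yB ny] := US _ (LU _ yL); have [ay _] := Uab _ (LU _ yL); split=> //.
  by apply: dl => //; move: yL; rewrite inE => /orP[/eqP->|/HL]; [left|right].
- move=> r rR sr; have rS := RS rR; case: (redm r rR) => H; last first.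
    by have := dl r rS (or_intror H) => /(lt_trans sr); rewrite ltxx.
  apply: (ang_tr hvv bS y2S rS by2); exact: sY (UY _ ymU) y2Y rR H.
- move=> r rR sr; have rS := RS rR; case: (redm r rR) => H.
    by have := dr r rS H => /(lt_trans sr); rewrite ltxx.
  apply: (ang_tr hvv rS y1S aS _ y1a); rewrite ot_anti oppr_gt0.
  apply: (same_neg GP BS RS dBR hvB hvv IY sY (UY _ ymU) y1Y rR).
  by rewrite ot_anti oppr_lt0.
- by rewrite /= szL prednK // double_gt0.
Qed.

Lemma select Y0 : inner S Bl Y0 -> (0 < l)%N -> (l.+1 * (2 * T + 4 * l + 2) <= size Y0)%N -> good Bl Rd.
Proof.
move=> IY0 l0 sz0.
have S0 : S != [::].
  have : (0 < size Y0)%N by apply: leq_trans sz0; rewrite muln_gt0 addn2.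
  case: Y0 IY0 {sz0} => [//|y s] [_ H] _; have [yB _] := H y (mem_head _ _).
  by apply/eqP => E; have := BS yB; rewrite E.
have [v hvv] := hv_exists S0.
have [Y [IY _ sY szY]] := same_exists GP BS RS dBR hvB hvv IY0.
have {szY sz0} szY : (2 * T + 4 * l + 2 <= size Y)%N.
  by have := leq_trans sz0 szY; rewrite leq_pmul2l.
have YS y : y \in Y -> [/\ y \in S & ~ hv S y].
  by move=> yY; case: IY => _ /(_ y yY)[yB nh]; split=> //; exact: BS.
have N2 : (2 <= size Y)%N by apply: leq_trans szY; exact: leq_addl.
have [|y1 [L1 [R1 [p1 sL1 _ H1]]]] := ang_split GP BS (k := 0) hvv IY; first exact: ltnW.
have {sL1 L1 p1} p1 : perm_eq Y (y1 :: R1) by case: L1 sL1 p1.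
have [|y2 [L2 [R2 [p2 sL2 H2 H2']]]] := ang_split GP BS (k := (size Y).-2) hvv IY.
  by move: N2; case: (size Y) => [|[]].
have in1 x : x \in y1 :: R1 -> x \in Y by rewrite (perm_mem p1).
have in2 x : x \in L2 ++ y2 :: R2 -> x \in Y by rewrite (perm_mem p2).
have y1Y : y1 \in Y by apply: in1; exact: mem_head.
have y2Y : y2 \in Y by apply: in2; rewrite mem_cat mem_head orbT.
have [x1 x1R] : exists x, x \in R1.
  by have := perm_size p1; move: N2; case: (R1) => [|x s] /=; [move=> + E; rewrite E|exists x; exact: mem_head].
have [x2 x2R] : exists x, x \in R2.
  have := perm_size p2; rewrite size_cat sL2 /=; move: N2; case: (R2) => [|x s] /=; last by exists x; exact: mem_head.
  by case: (size Y) => [|[|n]] //= _ /eqP; rewrite addn1 eqSS gtn_eqF.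
have [y1S ny1] := YS _ y1Y; have [y2S ny2] := YS _ y2Y.
have [x1S _] := YS _ (in1 x1 (mem_behead (s := y1 :: R1) x1R)).
have [x2S _] : [/\ x2 \in S & ~ hv S x2] by apply: YS; apply: in2; rewrite mem_cat inE x2R !orbT.
have [a1 [b1 [e1 ay1 yb1]]] := bridge GP hvv y1S x1S (H1 _ x1R).
have [a2 [b2 [e2 ay2 yb2]]] := bridge GP hvv y2S x2S (H2' _ x2R).
have ha1 := he_hv_l e1; have hb1 := he_hv_r e1; have ha2 := he_hv_l e2; have hb2 := he_hv_r e2.
have {}ay1 : 0 < ot v a1 y1 by case: ay1 => // E; rewrite E in ha1.
have {}ay2 : 0 < ot v a2 y2 by case: ay2 => // E; rewrite E in ha2.
have [a1S b1S a2S b2S] := And4 (hv_S ha1) (hv_S hb1) (hv_S ha2) (hv_S hb2).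
have Y1 y : y \in Y -> y = y1 \/ 0 < ot v y1 y.
  by rewrite (perm_mem p1) inE => /orP[/eqP->|/H1]; [left|right].
pose Y' := rcons L2 y2.
have Y'Y : {subset Y' <= Y}.
  by move=> x; rewrite mem_rcons => h; apply: in2; move: h; rewrite mem_cat !inE => /orP[] ->; rewrite ?orbT.
have Y'2 y : y \in Y' -> y = y2 \/ 0 < ot v y y2.
  by rewrite mem_rcons inE => /orP[/eqP->|/H2]; [left|right].
have uY' : uniq Y'.
  have : uniq (L2 ++ y2 :: R2) by rewrite -(perm_uniq p2); case: IY.
  by rewrite -cat_rcons cat_uniq => /and3P[].
have b2Y y : y \in Y' -> 0 < ot v y b2.
  move=> yY; have [yS _] := YS _ (Y'Y _ yY).
  by case: (Y'2 y yY) => [->//|h]; exact: (ang_tr hvv yS y2S b2S h yb2).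
have a1Y y : y \in Y -> 0 < ot v a1 y.
  move=> yY; have [yS _] := YS _ yY.
  by case: (Y1 y yY) => [->//|h]; exact: (ang_tr hvv a1S y1S yS ay1 h).
pose P1 y := 0 < ot v y b1; pose P2 y := 0 < ot v a2 y.
pose P3 y := (0 < ot v b1 y) && (0 < ot v y a2).
have F_sub P : {subset seq.filter P Y' <= Y} by move=> x; rewrite mem_filter => /andP[_ /Y'Y].
have F_inner P : inner S Bl (seq.filter P Y') by apply: (inner_sub IY _ (@F_sub P)); exact: filter_uniq.
have F_same P : same Rd v (seq.filter P Y') := same_sub sY (@F_sub P).
have [h1|h1] := leqP T (size (seq.filter P1 Y')).
  apply: (triple_select GP uBl uRd BS RS dBR hvB hvv e1 _ (F_inner _) (F_same _) _ l0 h1).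
    exact: (ang_tr hvv a1S y1S b1S ay1 yb1).
  by move=> y; rewrite mem_filter => /andP[yb /Y'Y/a1Y].
have [h2|h2] := leqP T (size (seq.filter P2 Y')).
  apply: (triple_select GP uBl uRd BS RS dBR hvB hvv e2 _ (F_inner _) (F_same _) _ l0 h2).
    exact: (ang_tr hvv a2S y2S b2S ay2 yb2).
  by move=> y; rewrite mem_filter => /andP[yb /b2Y].
apply: (wedge hvv hb1 ha2 IY sY y1Y y2Y yb1 ay2 (filter_uniq P3 uY') (@F_sub P3)) => //.
  by move=> y; rewrite mem_filter => /andP[/andP[]].
have cov : (size Y' <= size (seq.filter P1 Y') + size (seq.filter P2 Y') + size (seq.filter P3 Y'))%N.
  apply: size_cover => y /Y'Y yY; have [yS ny] := YS _ yY; have [_ _ yv] := innerP BS IY yY hvv.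
  have nb : y != b1 by apply/eqP => E; rewrite E in ny.
  have na : y != a2 by apply/eqP => E; rewrite E in ny.
  have [_ b1v _] := ang_neq yb1; have [a2v _ _] := ang_neq ay2.
  rewrite /P1 /P2 /P3; case: (ang_total GP hvv yS b1S yv b1v nb) => [->//|->].
  by case: (ang_total GP hvv yS a2S yv a2v na) => ->; rewrite ?orbT.
have sY' : size Y' = (size Y).-1.
  by rewrite size_rcons sL2; move: N2; case: (size Y) => [|[]].
have arith n f1 f2 f3 t m : (n.-1 <= f1 + f2 + f3 -> f1 < t -> f2 < t -> 2 * t + 4 * m + 2 <= n ->
  4 * m <= f3)%N by clear; lia.
by apply: arith h1 h2 szY; rewrite -sY'.
Qed.

End Selection.

(** * The theorem *)

Lemma hv_extreme (R : realType) (S : seq (R * R)) (U : set (R * R)) w :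
  U = [set` S] -> hv S w -> extreme_points (conv_hull U) w.
Proof.
move=> US [wS [e He]]; pose L (x : R * R) := det e (x - w).
pose A : set (R * R) := [set x | x = w \/ 0 < L x].
have Lw : L w = 0 by rewrite /L subrr det0r.
have LA x : A x -> 0 <= L x by case=> [->|/ltW//]; rewrite Lw.
have LA0 x : A x -> L x <= 0 -> x = w by case=> // H /(lt_le_trans H); rewrite ltxx.
have Lc (k : R) x y : L (k *: x + (1 - k) *: y) = k * L x + (1 - k) * L y.
  by rewrite /L /det !ptE; ring.
have HA : conv_hull U `<=` A.
  apply: smallest_sub; last first.
    move=> x; rewrite US /= => xS; have [->|xw] := eqVneq x w; [by left|right; exact: He].
  apply/(@convex_setW R (R * R)%type) => x y /set_mem xA /set_mem yA k k0 k1; apply/mem_set.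
  have k1' : 0 < 1 - k%:num by rewrite subr_gt0.
  change (A (k%:num *: x + (1 - k%:num) *: y)).
  case: xA => [->|xL]; case: yA => [->|yL].
  - by left; rewrite -scalerDl addrC subrK scale1r.
  - by right; rewrite Lc Lw mulr0 add0r mulr_gt0.
  - by right; rewrite Lc Lw mulr0 addr0 mulr_gt0.
  - by right; rewrite Lc addr_gt0 // mulr_gt0.
split; first by apply: sub_gen_smallest; rewrite US.
move=> y z /HA yA /HA zA t /andP[t0 t1] E.
have Ly := LA y yA; have Lz := LA z zA.
have t1' : 0 < 1 - t by rewrite subr_gt0.
have E0 : t * L z + (1 - t) * L y = 0 by rewrite -Lc addrC -E Lw.
have h1 : 0 <= t * L z by rewrite mulr_ge0 // ltW.
have h2 : 0 <= (1 - t) * L y by rewrite mulr_ge0 // ltW.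
transitivity w; [|symmetry]; apply: LA0 => //.
  by rewrite -(pmulr_rle0 _ t1') -E0 lerDr.
by rewrite -(pmulr_rle0 _ t0) -E0 lerDl.
Qed.

Lemma gpos_of_general (R : realType) (S : {fset R * R}) : general_position S -> gpos S.
Proof.
move=> GP a b c aS bS cS ab ac bc; apply/eqP => ot0; apply: (GP a b c) => //.
have ba : b - a != 0 by rewrite subr_eq0 eq_sym.
have [t Et] := det_eq0_ray ba ot0.
exists a, (b - a); split=> //.
- by exists 0 => //; rewrite scale0r addr0.
- by exists 1 => //; rewrite scale1r addrC subrK.
- by exists t => //; rewrite -Et addrC subrK.
Qed.

Definition Kbound (l : nat) := (l.+1 * (2 * (8 * l * l.+1 ^ 2) + 4 * l + 2))%N.

Lemma Kbound_le l : (1 <= l)%N -> (Kbound l <= 140 * l ^ 4)%N.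
Proof.
move=> l1; have h1 : (l.+1 <= 2 * l)%N by rewrite mul2n -addnn -addn1 leq_add2l.
have -> : (140 * l ^ 4 = (2 * l) * (2 * (8 * l * (2 * l) ^ 2) + 6 * l ^ 3))%N by rewrite !expnS expn0; lia.
have h3 : (l <= l ^ 3)%N by rewrite -{1}(expn1 l) leq_pexp2l.
have h2 : (l.+1 ^ 2 <= (2 * l) ^ 2)%N by rewrite leq_exp2r.
apply: leq_mul => //; rewrite -addnA; apply: leq_add.
  by rewrite leq_mul2l /= leq_mul2l h2 orbT.
by move: h3 l1; clear; lia.
Qed.

Theorem theorem1 (R : realType) :
  exists K0 : nat -> nat,
    (forall l : nat, (1 <= l)%N -> (1 <= K0 l)%N) /\
    ((fun l : nat => (K0 l)%:R : R^o) =O_\oo (fun l : nat => (l%:R ^+ 4 : R^o))) /\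
    forall (Blue Red : {fset R * R}) (l n k : nat),
      [disjoint Blue & Red]%fset ->
      general_position (Blue `|` Red)%fset ->
      #|` Red| = l -> (1 <= l)%N ->
      (extreme_points (conv_hull [set` (Blue `|` Red)%fset]) `<=` [set` Blue]) ->
      (extreme_points (conv_hull [set` (Blue `|` Red)%fset]) #= `I_n)%card ->
      k = (#|` Blue| - n)%N ->
      (K0 l <= k)%N ->
      exists p : seq (R * R), polygonization Blue p /\ excludes p Red.
Proof.
exists Kbound; split; first by move=> l _; rewrite muln_gt0 addn2.
split.
  apply/eqO_exP; exists 140; first by [].
  exists 1%N => // l /= l1; rewrite ger0_norm ?ler0n // ger0_norm ?exprn_ge0 ?ler0n //.
  by rewrite -natrX -natrM ler_nat Kbound_le.
move=> Blue Red l n k dBR gen cR l0 extB extn kE Kk.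
set U := (Blue `|` Red)%fset in gen extB extn.
pose S : seq (R * R) := U.
have GP : gpos S := gpos_of_general gen.
have hvB w : hv S w -> w \in (Blue : seq _).
  by move=> H; apply: extB; apply: (hv_extreme _ H).
have BS : {subset (Blue : seq (R * R)) <= S} by move=> x xB; rewrite /S /U in_fsetU; apply/orP; left.
have RS : {subset (Red : seq (R * R)) <= S} by move=> x xR; rewrite /S /U in_fsetU; apply/orP; right.
have dBR' x : x \in (Blue : seq (R * R)) -> x \notin (Red : seq (R * R)).
  by move=> xB; apply: (fdisjointP dBR).
pose P x := `[< hv S x >].
have szH : (size [seq y <- (Blue : seq (R * R)) | P y] <= n)%N.
  have -> : size [seq y <- (Blue : seq (R * R)) | P y] = #|` seq_fset tt [seq y <- (Blue : seq (R * R)) | P y]|.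
    by rewrite size_seq_fset undup_id // filter_uniq.
  rewrite -[seq_fset _ _]set_fsetK; apply: geq_card_fset_set.
  rewrite -(card_le_eqr extn); apply: subset_card_le => x xH.
  have : x \in [seq y <- (Blue : seq (R * R)) | P y] by rewrite -(seq_fsetE tt).
  by rewrite mem_filter => /andP[/asboolP H _]; apply: (hv_extreme _ H).
have [|||p [p1 p2 p3]] := select GP (fset_uniq Blue) (fset_uniq Red) BS RS dBR' hvB
   (Y0 := [seq y <- (Blue : seq (R * R)) | ~~ P y]).
- split; first exact: filter_uniq (fset_uniq Blue).
  by move=> y; rewrite mem_filter => /andP[/asboolP].
- by rewrite cR.
- rewrite cR; apply: leq_trans Kk _; rewrite kE leq_subLR.
  have := count_predC P Blue; rewrite -!size_filter => <-.
  by rewrite leq_add2r.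
by exists p; split=> //; split.
Qed.
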